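(* Let $d\ge2$, $\nu=d/2-1$, $\ell\ge0$ an integer, $0<R_1<R_2$, and $\alpha_1,\alpha_2>0$. (i) (Small-$k$ expansion.) For $d=3$ and $\ell=0$, in the spherical normalisation, $$\Delta^{\mathrm{sph}}_0(k;\alpha_1,\alpha_2)=\frac{C_{-1}}k+C_1k+O(k^3),\qquad k\to0^+,$$ where, with $\delta=R_2-R_1$ and $\rho=R_1R_2$, $$C_{-1}=\frac{\alpha_1}{R_2^2}+\frac{\alpha_2}{R_1^2}+\frac{\alpha_1\alpha_2\delta}{\rho}>0,\qquad C_1=C_1^0+O(\alpha_1+\alpha_2),\quad C_1^0=-\frac{R_2^3-R_1^3}{3R_1^2R_2^2}<0 ;$$ in the unified normalisation, $\Delta_0$ remains bounded as $k\to0^+$ and equals $2C_{-1}/\pi+O(k^2)$. For $\ell\ge1$, $\Delta_\ell>0$ for all sufficiently small $k>0$. For general $d\ge3$ the same structure holds (a leading term with positive coefficient followed by a correction of relative order $k^2$), with coefficients coming from the small-argument expansions of $J_\nu$ and $Y_\nu$. For $d=2$ and $\ell=0$ the determinant remains bounded as $k\to0^+$ and $$\Delta_0(k)\longrightarrow\frac2\pi\Bigl(\frac{\alpha_1}{R_2}+\frac{\alpha_2}{R_1}+\alpha_1\alpha_2\ln\frac{R_2}{R_1}\Bigr)>0 .$$ (ii) (Transparent interval.) For every $\ell\ge0$ there exists a first positive root $k_{c,\ell}$ of $\Delta_\ell(k;\alpha_1,\alpha_2)=0$, and $\Delta_\ell(k)>0$ for $0<k<k_{c,\ell}$. Moreover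 $\ell\mapsto k_{c,\ell}$ is strictly increasing, so $$k_c:=\min_{\ell\ge0}k_{c,\ell}=k_{c,0}>0,$$ and the band $(0,k_c)$ contains no resonant modes (zeros of $\Delta_\ell$) of any angular order $\ell$. (iii) (Small-impedance expansion of the threshold.) Let $\beta_i=\alpha_iR_i\to0^+$. Then $$k_c^2=\frac{d\bigl(\alpha_1R_1^{d-1}+\alpha_2R_2^{d-1}\bigr)}{R_2^d-R_1^d}\bigl(1+O(\beta_1+\beta_2)\bigr),$$ where for $d=2$ the relative remainder is $O(\alpha|\ln\alpha|)$, $\alpha=\alpha_1+\alpha_2$, instead. For $d=3$, writing $D=R_2^3-R_1^3$ and $S=R_1^2+R_1R_2+R_2^2$, $$k_c^2=\mu_1\alpha_1+\mu_2\alpha_2+\nu_1\alpha_1^2+\nu_2\alpha_2^2+\nu_{12}\alpha_1\alpha_2+O(\alpha^3)$$ as $\alpha\to0$, with $$\mu_1=\frac{3R_1^2}D,\qquad\mu_2=\frac{3R_2^2}D,\qquad \nu_1=-\frac{3R_1^3\bigl(R_1^3+3R_1^2R_2+6R_1R_2^2+5R_2^3\bigr)}{5S^3},$$ $$\nu_2=-\frac{3R_2^3\bigl(5R_1^3+6R_1^2R_2+3R_1R_2^2+R_2^3\bigr)}{5S^3},\qquad \nu_{12}=\frac{9R_1^2R_2^2\bigl(R_1^2+3R_1R_2+R_2^2\bigr)}{5S^3}.$$ In particular $\nu_1,\nu_2<0$ and $\nu_{12}>0$ (consistently with the Rayleigh upper bound $k_c^2\le d(\alpha_1R_1^{d-1}+\alpha_2R_2^{d-1})/(R_2^d-R_1^d)$),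 and as $R_1\to0$ the expansion reduces to the ball asymptotics $k_c^2=\frac{3\alpha_2}{R_2}\bigl(1-\frac{\alpha_2R_2}5+O(\alpha_2^2)\bigr)$. For $R_1=1$, $R_2=2$ and $\alpha_1=\alpha_2=\eta$ it reads $k_c^2=\frac{15}7\eta-0.4111\,\eta^2+O(\eta^3)$ (coefficient rounded to four decimals).
   Context: Unified normalisation: with $\mu=\ell+\nu$ and $Z_\mu\in\{J_\mu,Y_\mu\}$ (Bessel functions), $$\mathcal B_1[Z_\mu]=R_1^{-\nu}\Bigl[kZ_{\mu+1}(kR_1)+\bigl(\alpha_1-\tfrac{\ell}{R_1}\bigr)Z_\mu(kR_1)\Bigr],\qquad \mathcal B_2[Z_\mu]=R_2^{-\nu}\Bigl[\bigl(\alpha_2+\tfrac{\ell}{R_2}\bigr)Z_\mu(kR_2)-kZ_{\mu+1}(kR_2)\Bigr],$$ $$\Delta_\ell(k;\alpha_1,\alpha_2)=\mathcal B_1[J_\mu]\mathcal B_2[Y_\mu]-\mathcal B_2[J_\mu]\mathcal B_1[Y_\mu],\qquad k>0.$$ Spherical normalisation ($d=3$ only): with spherical Bessel functions $z_\ell\in\{j_\ell,y_\ell\}$, $\mathcal B_1[z_\ell]=(\alpha_1-\frac{\ell}{R_1})z_\ell(kR_1)+kz_{\ell+1}(kR_1)$, $\mathcal B_2[z_\ell]=(\alpha_2+\frac{\ell}{R_2})z_\ell(kR_2)-kz_{\ell+1}(kR_2)$, and $\Delta_\ell^{\mathrm{sph}}=\mathcal B_1[j_\ell]\mathcal B_2[y_\ell]-\mathcal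 B_2[j_\ell]\mathcal B_1[y_\ell]$. For $d=3$ the two determinants differ only by a positive factor depending on $k$, so they have the same positive zeros and signs. In $O(\alpha^3)$, $\alpha=\alpha_1+\alpha_2$; the symbols $\mu_1,\mu_2,\nu_1,\nu_2,\nu_{12}$ in (iii) are just the named coefficients. $O(\alpha_1+\alpha_2)$ in $C_1$ is as $\alpha_1,\alpha_2\to0$ with $R_1,R_2$ fixed. *)

(* Defs.v *)
From Stdlib Require Import Reals Factorial.
From Coquelicot Require Import Coquelicot.
Open Scope R_scope.

(** The reciprocal Gamma function 1/Gamma(z), by Gauss's product
    1/Gamma(z) = lim z (z+1) ... (z+n) / (n! n^z), which converges for every
    real z and vanishes at 0, -1, -2, ... *)
Definition rgamma (z : R) : R :=
  real (Lim_seq (fun n : nat =>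
    prod_f_R0 (fun j => z + INR j) n / (INR (fact n) * Rpower (INR n) z))).

(** Meaningful for x > 0 only, since [Rpower] is. *)
Definition besselJ (mu x : R) : R :=
  Rpower (x / 2) mu *
  Series (fun m : nat =>
    (-1) ^ m / INR (fact m) * rgamma (mu + INR m + 1) * (x / 2) ^ (2 * m)).

Definition besselY_quotient (mu x : R) : R :=
  (besselJ mu x * cos (mu * PI) - besselJ (- mu) x) / sin (mu * PI).

(** At integer orders, i.e. where sin (mu * PI) = 0, the quotient is replaced
    by its limiting value. *)
Definition besselY (mu x : R) : R :=
  if Req_EM_T (sin (mu * PI)) 0
  then real (Lim (fun s => besselY_quotient s x) mu)
  else besselY_quotient mu x.

Definition sph_j (l : nat) (x : R) : R :=
  sqrt (PI / (2 * x)) * besselJ (INR l + 1 / 2) x.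
Definition sph_y (l : nat) (x : R) : R :=
  sqrt (PI / (2 * x)) * besselY (INR l + 1 / 2) x.

Definition nu (d : nat) : R := INR d / 2 - 1.

(** [Z] is a family of functions, applied to an order and an argument. *)
Definition B1 (Z : R -> R -> R) (d l : nat) (R1 a1 k : R) : R :=
  let mu := INR l + nu d in
  Rpower R1 (- nu d) *
  (k * Z (mu + 1) (k * R1) + (a1 - INR l / R1) * Z mu (k * R1)).

Definition B2 (Z : R -> R -> R) (d l : nat) (R2 a2 k : R) : R :=
  let mu := INR l + nu d in
  Rpower R2 (- nu d) *
  ((a2 + INR l / R2) * Z mu (k * R2) - k * Z (mu + 1) (k * R2)).

Definition Delta_l (d l : nat) (R1 R2 a1 a2 k : R) : R :=
  B1 besselJ d l R1 a1 k * B2 besselY d l R2 a2 k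
  - B2 besselJ d l R2 a2 k * B1 besselY d l R1 a1 k.

Definition B1_sph (z : nat -> R -> R) (l : nat) (R1 a1 k : R) : R :=
  (a1 - INR l / R1) * z l (k * R1) + k * z (S l) (k * R1).

Definition B2_sph (z : nat -> R -> R) (l : nat) (R2 a2 k : R) : R :=
  (a2 + INR l / R2) * z l (k * R2) - k * z (S l) (k * R2).

Definition Delta_sph (l : nat) (R1 R2 a1 a2 k : R) : R :=
  B1_sph sph_j l R1 a1 k * B2_sph sph_y l R2 a2 k
  - B2_sph sph_j l R2 a2 k * B1_sph sph_y l R1 a1 k.

Definition bigO {T : Type} (F : (T -> Prop) -> Prop) (f g : T -> R) : Prop :=
  exists M : R, F (fun x => Rabs (f x) <= M * Rabs (g x)).

(** Both components tend to 0 from the right, independently. *)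
Definition at_right00 : (R * R -> Prop) -> Prop :=
  filter_prod (at_right 0) (at_right 0).

Definition is_first_positive_root (f : R -> R) (k : R) : Prop :=
  0 < k /\ f k = 0 /\ (forall x, 0 < x < k -> f x <> 0).

(** Infimum of the positive zeros; it is the first positive root whenever
    there is one. *)
Definition first_positive_root (f : R -> R) : R :=
  real (Glb_Rbar (fun k => 0 < k /\ f k = 0)).

Definition kcl (d : nat) (R1 R2 a1 a2 : R) (l : nat) : R :=
  first_positive_root (Delta_l d l R1 R2 a1 a2).

Definition kc (d : nat) (R1 R2 a1 a2 : R) : R :=
  real (Glb_Rbar (fun k => exists l : nat, k = kcl d R1 R2 a1 a2 l)).

(** Threshold of the ball of radius R2, where only the regular solution j_0
    and the outer boundary condition remain (d = 3). *)
Definition kc_ball (R2 a2 : R) : R :=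
  first_positive_root (B2_sph sph_j 0 R2 a2).

Definition Cm1 (R1 R2 a1 a2 : R) : R :=
  a1 / R2 ^ 2 + a2 / R1 ^ 2 + a1 * a2 * (R2 - R1) / (R1 * R2).

Definition C1_0 (R1 R2 : R) : R := - (R2 ^ 3 - R1 ^ 3) / (3 * R1 ^ 2 * R2 ^ 2).

(** As x -> 0+, for n > 0:  J_n(x) ~ lead_J n * x^n  and
    Y_n(x) ~ lead_Y n * x^(-n). *)
Definition lead_J (n : R) : R := rgamma (n + 1) / Rpower 2 n.
Definition lead_Y (n : R) : R := - Rpower 2 n / (PI * rgamma n).

(** Leading coefficient of Delta_0 for d >= 3.  To leading order
    r^(-nu) J_nu(kr) and r^(-nu) Y_nu(kr) are multiples of the functions
    1 and r^(-2 nu), whose boundary forms u |-> - u'(R1) + a1 u(R1) and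
    u |-> u'(R2) + a2 u(R2) give the bracket; the powers of k cancel. *)
Definition A0 (d : nat) (R1 R2 a1 a2 : R) : R :=
  lead_J (nu d) * lead_Y (nu d) *
  (a1 * (a2 * Rpower R2 (- 2 * nu d)
         - 2 * nu d * Rpower R2 (- 2 * nu d - 1))
   - a2 * (a1 * Rpower R1 (- 2 * nu d)
           + 2 * nu d * Rpower R1 (- 2 * nu d - 1))).

Definition kc2_lead (d : nat) (R1 R2 a1 a2 : R) : R :=
  INR d * (a1 * R1 ^ (d - 1) + a2 * R2 ^ (d - 1)) / (R2 ^ d - R1 ^ d).

Definition S3 (R1 R2 : R) : R := R1 ^ 2 + R1 * R2 + R2 ^ 2.
Definition mu1 (R1 R2 : R) : R := 3 * R1 ^ 2 / (R2 ^ 3 - R1 ^ 3).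
Definition mu2 (R1 R2 : R) : R := 3 * R2 ^ 2 / (R2 ^ 3 - R1 ^ 3).
Definition nu1 (R1 R2 : R) : R :=
  - (3 * R1 ^ 3 * (R1 ^ 3 + 3 * R1 ^ 2 * R2 + 6 * R1 * R2 ^ 2 + 5 * R2 ^ 3)
     / (5 * S3 R1 R2 ^ 3)).
Definition nu2 (R1 R2 : R) : R :=
  - (3 * R2 ^ 3 * (5 * R1 ^ 3 + 6 * R1 ^ 2 * R2 + 3 * R1 * R2 ^ 2 + R2 ^ 3)
     / (5 * S3 R1 R2 ^ 3)).
Definition nu12 (R1 R2 : R) : R :=
  9 * R1 ^ 2 * R2 ^ 2 * (R1 ^ 2 + 3 * R1 * R2 + R2 ^ 2)
  / (5 * S3 R1 R2 ^ 3).

Definition kc2_quad (R1 R2 a1 a2 : R) : R :=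
  mu1 R1 R2 * a1 + mu2 R1 R2 * a2
  + nu1 R1 R2 * a1 ^ 2 + nu2 R1 R2 * a2 ^ 2 + nu12 R1 R2 * a1 * a2.

(* Main.v *)
(** For a cylinder function [Z] of order [mu = l + nu], the function
    [u(r) = r^(-nu) Z_mu(k r)] solves the radial equation
    [(r^(d-1) u')' + (k^2 - l (l + d - 2) / r^2) r^(d-1) u = 0], and [B1], [B2]
    are the boundary forms [a1 u - u'] at [R1] and [a2 u + u'] at [R2]. By the
    Wronskian of [J] and [Y], the solution [w] with [w(R1) = (2/PI) R1^(1-d)]
    and [w'(R1) = a1 w(R1)] satisfies [Delta_l = a2 w(R2) + w'(R2)].

    Sturm comparison in [k] and in [l] shows that the [k] for which [w > 0] on
    [[R1, R2]] and [Delta_l(k) > 0] form an interval, which ends at the first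
    root, and that this root increases with [l]. The Riccati variable
    [v = r^(d-1) w'/w] runs from [a1 R1^(d-1)] down to [- a2 R2^(d-1)] at
    [k = k_c], [l = 0], and integrating [v' = - k^2 r^(d-1) - v^2 / r^(d-1)]
    gives the Rayleigh bound and the leading asymptotics of [k_c]. For [d = 3]
    the function [r w(r)] is trigonometric, and the second-order terms come from
    the Taylor expansion of the resulting determinant.

    At integer orders [Y] is a limit of quotients: [1/Gamma] is differentiable
    with quadratic error at the nonnegative integers, so [J_s] is differentiable
    in [s] at [-1, 0, 1]; this gives [Y_0] and [Y_1], and the three-term
    recurrence gives the rest. *)

Require Import Defs.
From Stdlib Require Import Reals Factorial Lra Lia.
From Coquelicot Require Import Coquelicot.
(* Again, since [Stdlib.Reals] has its own [B1]. *)
Require Import Defs.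
Open Scope R_scope.

(** The orders [l + d / 2 - 1] are integers or half-integers, and at integers [besselY] is known
    only as a limit in the order. The obstacle is therefore to differentiate in [x] after a limit in
    [s]. Pairs [(Z_s, Z_(s+1))] satisfy a first-order system whose energy is controlled uniformly in
    [s]; this bounds second derivatives, and quadratic remainders survive the limit.

    The good set of [k] asks for positivity of the whole mode, not only of the determinant, because
    this is the property that comparison hands down to smaller [k]. At its supremum the mode cannot
    touch zero, since the zero would be double; only the determinant can vanish there.

    The initial data of a mode at [R1] do not depend on [k], so for [l = 0] the small-[k] expansion
    is a perturbation of the explicit solution at [k = 0]. Positivity of the mode supplies the a
    priori bound, and [A0], which is written with Bessel constants, is matched afterwards. The
    expansions of thresholds likewise start from an a priori bound on the root (the Rayleigh bound,
    or a bracketing for the ball); feeding the root equation into itself then replaces any implicit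
    function argument. *)

Ltac positivity :=
  first
  [ assumption | lra
  | match goal with
    | |- _ >= 0 => apply Rle_ge; positivity
    | |- _ > 0 => red; positivity
    | |- _ <> 0 => apply Rgt_not_eq; positivity
    | |- 0 < _ * _ => apply Rmult_lt_0_compat; positivity
    | |- 0 < _ / _ => apply Rdiv_lt_0_compat; positivity
    | |- 0 < / _ => apply Rinv_0_lt_compat; positivity
    | |- 0 < _ ^ _ => apply pow_lt; positivity
    | |- 0 <= _ ^ 2 => apply pow2_ge_0
    | |- 0 <= _ * _ => apply Rmult_le_pos; positivity
    | |- 0 <= _ / _ => apply Rmult_le_pos; positivity
    | |- 0 <= / _ => left; positivity
    | |- 0 <= _ ^ _ => apply pow_le; positivity
    | |- 0 < _ + _ => apply Rplus_lt_0_compat; positivity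
    end ].

(** * Calculus *)

Lemma nondecreasing_of_derive (f f' : R -> R) (a b : R) :
  a <= b -> (forall x, a <= x <= b -> is_derive f x (f' x)) ->
  (forall x, a <= x <= b -> 0 <= f' x) -> f a <= f b.
Proof.
intros hab hf hf'.
destruct (MVT_gen f a b f') as [c [hc heq]];
  rewrite ?Rmin_left, ?Rmax_right in * by lra.
- intros x hx; apply hf; lra.
- intros x hx; apply continuity_pt_filterlim.
  apply (ex_derive_continuous (V := R_NormedModule)).
  exists (f' x); apply hf; lra.
- specialize (hf' c hc); nra.
Qed.

Lemma nonincreasing_of_derive (f f' : R -> R) (a b : R) :
  a <= b -> (forall x, a <= x <= b -> is_derive f x (f' x)) ->
  (forall x, a <= x <= b -> f' x <= 0) -> f b <= f a.
Proof.
intros hab hf hf'.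
apply Ropp_le_cancel.
apply (nondecreasing_of_derive (fun x => - f x) (fun x => - f' x)); [lra| |].
- intros x hx; apply (is_derive_opp (V := R_NormedModule) f x (f' x)), hf, hx.
- intros x hx; specialize (hf' x hx); lra.
Qed.

Lemma constant_of_derive (f : R -> R) (a b : R) :
  a <= b -> (forall x, a <= x <= b -> is_derive f x 0) -> f a = f b.
Proof.
intros hab hf; apply Rle_antisym.
- apply (nondecreasing_of_derive f (fun _ => 0)); auto; intros; lra.
- apply (nonincreasing_of_derive f (fun _ => 0)); auto; intros; lra.
Qed.

Lemma is_derive_continuity (f : R -> R) (x l : R) :
  is_derive f x l -> continuity_pt f x.
Proof.
intros h; apply continuity_pt_filterlim.
apply (ex_derive_continuous (V := R_NormedModule)); exists l; exact h.
Qed.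

Lemma is_derive_Rmult (f g : R -> R) (x a b : R) :
  is_derive f x a -> is_derive g x b ->
  is_derive (fun y => f y * g y) x (a * g x + f x * b).
Proof.
intros hf hg; apply (is_derive_mult (K := R_AbsRing) f g x a b hf hg).
intros; apply Rmult_comm.
Qed.

Lemma is_derive_Rplus (f g : R -> R) (x a b : R) :
  is_derive f x a -> is_derive g x b -> is_derive (fun y => f y + g y) x (a + b).
Proof. exact (is_derive_plus (V := R_NormedModule) f g x a b). Qed.

Lemma is_derive_Rminus (f g : R -> R) (x a b : R) :
  is_derive f x a -> is_derive g x b -> is_derive (fun y => f y - g y) x (a - b).
Proof. exact (is_derive_minus (V := R_NormedModule) f g x a b). Qed.

Lemma is_derive_Rconst (c x : R) : is_derive (fun _ => c) x 0.
Proof. exact (is_derive_const (V := R_NormedModule) c x). Qed.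

Lemma is_derive_Rcomp (f g : R -> R) (x a b : R) :
  is_derive f (g x) a -> is_derive g x b ->
  is_derive (fun y => f (g y)) x (b * a).
Proof. exact (is_derive_comp (V := R_NormedModule) f g x a b). Qed.

(** A quadratic remainder bound passes through sums and limits, which a bare derivative does not.
    This criterion gives differentiability of [rgamma] at [1], of [besselJ] in the order, and of
    limits of Bessel quotients. *)
Lemma is_derive_of_quadratic_bound (f : R -> R) (x l M r : R) :
  0 < r ->
  (forall h, Rabs h <= r -> Rabs (f (x + h) - f x - l * h) <= M * h ^ 2) ->
  is_derive f x l.
Proof.
intros hr hf.
apply is_derive_Reals; intros eps heps.
assert (hM : 0 < Rabs M + 1) by (pose proof (Rabs_pos M); lra).
assert (hd : 0 < Rmin r (eps / (Rabs M + 1))).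
{ apply Rmin_glb_lt; [exact hr|positivity]. }
exists (mkposreal _ hd); intros h hh0 hh; simpl in hh.
pose proof (Rlt_le_trans _ _ _ hh (Rmin_l _ _)) as h1.
pose proof (Rlt_le_trans _ _ _ hh (Rmin_r _ _)) as h2.
specialize (hf h (Rlt_le _ _ h1)).
replace ((f (x + h) - f x) / h - l) with ((f (x + h) - f x - l * h) / h)
  by (field; exact hh0).
rewrite Rabs_div by exact hh0.
assert (hp : 0 < Rabs h) by (apply Rabs_pos_lt; exact hh0).
apply Rmult_lt_reg_r with (Rabs h); [exact hp|].
replace (Rabs (f (x + h) - f x - l * h) / Rabs h * Rabs h)
  with (Rabs (f (x + h) - f x - l * h)) by (field; lra).
apply Rle_lt_trans with (1 := hf).
rewrite <- (pow2_abs h).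
assert (h3 : Rabs h * (Rabs M + 1) < eps).
{ apply Rmult_lt_reg_r with (/ (Rabs M + 1));
    [positivity|].
  rewrite Rmult_assoc, Rinv_r, Rmult_1_r by lra; exact h2. }
pose proof (Rle_abs M).
nra.
Qed.

Lemma exp_le_mono (x y : R) : x <= y -> exp x <= exp y.
Proof. intros [h | ->]; [left; apply exp_increasing, h|apply Rle_refl]. Qed.

(** The function [(1 + y + y ^ 2) * exp (- y)] has derivative [y * (1 - y) * exp (- y)], so on
    [y <= 1] its minimum is its value [1] at [0]. *)
Lemma exp_le_quadratic (y : R) : y <= 1 -> exp y <= 1 + y + y ^ 2.
Proof.
intros hy.
assert (hd : forall x, is_derive (fun x => (1 + x + x ^ 2) * exp (- x)) x
                         ((x - x ^ 2) * exp (- x))).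
{ intros x; auto_derive; [exact I|ring]. }
assert (h : 1 <= (1 + y + y ^ 2) * exp (- y)).
{ replace 1 with ((1 + 0 + 0 ^ 2) * exp (- 0)) at 1
    by (rewrite Ropp_0, exp_0; ring).
  destruct (Rle_dec 0 y).
  - apply (nondecreasing_of_derive (fun x => (1 + x + x ^ 2) * exp (- x))
             (fun x => (x - x ^ 2) * exp (- x))); [lra|intros; apply hd|].
    intros x hx; pose proof (exp_pos (- x)).
    apply Rmult_le_pos; nra.
  - apply (nonincreasing_of_derive (fun x => (1 + x + x ^ 2) * exp (- x))
             (fun x => (x - x ^ 2) * exp (- x))); [lra|intros; apply hd|].
    intros x hx; pose proof (exp_pos (- x)).
    assert (x - x ^ 2 <= 0) by nra. nra. }
rewrite exp_Ropp in h; pose proof (exp_pos y).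
apply Rmult_le_reg_r with (/ exp y); [positivity|].
rewrite Rinv_r by lra; exact h.
Qed.

(** The derivative of [(1 + y) * exp (y ^ 2 - y)] carries the factor [y * (1 + 2 * y)]: the minimum
    [1] is at [0], and [- 1 / 2] is where the other factor changes sign. *)
Lemma exp_quadratic_le (y : R) : - (1 / 2) <= y -> exp (y - y ^ 2) <= 1 + y.
Proof.
intros hy.
assert (hd : forall x, is_derive (fun x => (1 + x) * exp (x ^ 2 - x)) x
                         (x * (1 + 2 * x) * exp (x ^ 2 - x))).
{ intros x; auto_derive; [exact I|].
  simpl; unfold Rminus; ring. }
assert (h : 1 <= (1 + y) * exp (y ^ 2 - y)).
{ replace 1 with ((1 + 0) * exp (0 ^ 2 - 0)) at 1
    by (replace (0 ^ 2 - 0) with 0 by ring; rewrite exp_0; ring).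
  destruct (Rle_dec 0 y).
  - apply (nondecreasing_of_derive (fun x => (1 + x) * exp (x ^ 2 - x))
             (fun x => x * (1 + 2 * x) * exp (x ^ 2 - x)));
      [lra|intros; apply hd|].
    intros x hx; pose proof (exp_pos (x ^ 2 - x)).
    positivity.
  - apply (nonincreasing_of_derive (fun x => (1 + x) * exp (x ^ 2 - x))
             (fun x => x * (1 + 2 * x) * exp (x ^ 2 - x)));
      [lra|intros; apply hd|].
    intros x hx; pose proof (exp_pos (x ^ 2 - x)).
    assert (x * (1 + 2 * x) <= 0) by nra. nra. }
replace (y ^ 2 - y) with (- (y - y ^ 2)) in h by ring.
rewrite exp_Ropp in h; pose proof (exp_pos (y - y ^ 2)).
apply Rmult_le_reg_r with (/ exp (y - y ^ 2));
  [positivity|].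
rewrite Rinv_r by lra; exact h.
Qed.

Lemma ln_step_lower (n : nat) : / (INR n + 2) <= ln ((INR n + 2) / (INR n + 1)).
Proof.
pose proof (pos_INR n).
assert (h : ln ((INR n + 1) / (INR n + 2)) <= - / (INR n + 2)).
{ rewrite <- (ln_exp (- / (INR n + 2))).
  apply ln_le; [positivity|].
  apply Rle_trans with (2 := exp_ineq1_le _).
  apply Req_le; field; lra. }
replace ((INR n + 2) / (INR n + 1)) with (/ ((INR n + 1) / (INR n + 2)))
  by (field; lra).
rewrite ln_Rinv by positivity; lra.
Qed.

Lemma ln_step_upper (n : nat) : ln ((INR n + 2) / (INR n + 1)) <= / (INR n + 1).
Proof.
pose proof (pos_INR n).
rewrite <- (ln_exp (/ (INR n + 1))).
apply ln_le; [positivity|].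
apply Rle_trans with (2 := exp_ineq1_le _).
apply Req_le; field; lra.
Qed.

(** * The reciprocal Gamma function *)

(** At [n = 0] the power [Rpower 0 z] is only a default value, so the quantitative estimates start
    at index [S n]. *)
Definition gauss (z : R) (n : nat) : R :=
  prod_f_R0 (fun j => z + INR j) n / (INR (fact n) * Rpower (INR n) z).

Lemma Rpower_pos (x y : R) : 0 < Rpower x y.
Proof. apply exp_pos. Qed.

Lemma INR_fact_pos (n : nat) : 0 < INR (fact n).
Proof. apply INR_fact_lt_0. Qed.

Lemma gauss_step (z : R) (n : nat) :
  gauss z (S (S n)) =
  gauss z (S n) * ((z + INR n + 2) / (INR n + 2)
                   * exp (- (z * ln ((INR n + 2) / (INR n + 1))))).
Proof.
unfold gauss.
change (prod_f_R0 (fun j => z + INR j) (S (S n)))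
  with (prod_f_R0 (fun j => z + INR j) (S n) * (z + INR (S (S n)))).
rewrite (fact_simpl (S n)), mult_INR.
pose proof (pos_INR n).
replace (INR (S (S n))) with (INR n + 2) by (rewrite !S_INR; ring).
replace (INR (S n)) with (INR n + 1) by (rewrite !S_INR; ring).
replace (Rpower (INR n + 2) z)
  with (Rpower (INR n + 1) z * exp (z * ln ((INR n + 2) / (INR n + 1)))).
2:{ unfold Rpower; rewrite <- exp_plus; f_equal.
    rewrite ln_div by lra; ring. }
rewrite exp_Ropp.
pose proof (exp_pos (z * ln ((INR n + 2) / (INR n + 1)))).
pose proof (Rpower_pos (INR n + 1) z).
pose proof (INR_fact_pos (S n)).
replace (z + (INR n + 2)) with (z + INR n + 2) by ring.
field; repeat split; lra.
Qed.

Lemma gauss_nonneg (z : R) (n : nat) : 0 <= z -> 0 <= gauss z n.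
Proof.
intros hz; unfold gauss.
apply Rmult_le_pos.
- induction n as [|n IH]; [simpl; lra|].
  apply Rmult_le_pos; [exact IH|]; pose proof (pos_INR (S n)); lra.
- left; apply Rinv_0_lt_compat, Rmult_lt_0_compat;
    [apply INR_fact_pos|apply Rpower_pos].
Qed.

(** The factor in [gauss_step] is at most [1]: with [q] the logarithm there, [1 + z / (n + 2) <= 1 +
    z * q <= exp (z * q)]. *)
Lemma gauss_decr (z : R) (n : nat) :
  0 <= z -> gauss z (S (S n)) <= gauss z (S n).
Proof.
intros hz; rewrite gauss_step.
pose proof (gauss_nonneg z (S n) hz) as hg.
pose proof (pos_INR n).
rewrite <- (Rmult_1_r (gauss z (S n))) at 2.
apply Rmult_le_compat_l; [exact hg|].
rewrite exp_Ropp.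
pose proof (exp_pos (z * ln ((INR n + 2) / (INR n + 1)))).
apply Rmult_le_reg_r with (exp (z * ln ((INR n + 2) / (INR n + 1))));
  [assumption|].
rewrite Rmult_assoc, Rinv_l, Rmult_1_l, Rmult_1_r by lra.
apply Rle_trans with (1 + z * ln ((INR n + 2) / (INR n + 1)));
  [|apply exp_ineq1_le].
pose proof (ln_step_lower n).
replace ((z + INR n + 2) / (INR n + 2)) with (1 + z * / (INR n + 2))
  by (field; lra).
apply Rplus_le_compat_l, Rmult_le_compat_l; assumption.
Qed.

Lemma is_lim_seq_INR_plus (c : R) : is_lim_seq (fun n => INR n + c) p_infty.
Proof.
eapply is_lim_seq_plus; [apply is_lim_seq_INR|apply is_lim_seq_const|reflexivity].
Qed.

Lemma eventually_INR_plus_pos (c : R) : eventually (fun n => 0 < INR n + c).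
Proof. apply (proj2 (is_lim_seq_spec _ _) (is_lim_seq_INR_plus c) 0). Qed.

Lemma is_lim_seq_INR_ratio (a b : R) :
  is_lim_seq (fun n => (INR n + a) / (INR n + b)) 1.
Proof.
apply is_lim_seq_ext_loc with (fun n => 1 + (a - b) * / (INR n + b)).
- destruct (eventually_INR_plus_pos b) as [N hN].
  exists N; intros n hn; specialize (hN n hn); field; lra.
- replace (Finite 1) with (Finite (1 + (a - b) * 0)) by (f_equal; ring).
  apply is_lim_seq_plus'; [apply is_lim_seq_const|].
  apply is_lim_seq_mult'; [apply is_lim_seq_const|].
  apply (is_lim_seq_inv _ _ (is_lim_seq_INR_plus b)); discriminate.
Qed.

Lemma prod_f_R0_shift (z : R) (n : nat) :
  prod_f_R0 (fun j => z + INR j) n * (z + 1 + INR n) =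
  z * prod_f_R0 (fun j => z + 1 + INR j) n.
Proof.
induction n as [|n IH].
- simpl; ring.
- change (prod_f_R0 (fun j => z + INR j) n * (z + INR (S n))
            * (z + 1 + INR (S n)) =
          z * (prod_f_R0 (fun j => z + 1 + INR j) n * (z + 1 + INR (S n)))).
  rewrite <- Rmult_assoc, <- IH, S_INR; ring.
Qed.

(** Pushes convergence one unit to the left and yields the functional equation at the same time, so
    the poles of Gamma need no separate treatment. The termwise identity holds only eventually,
    since [z + 1 + n] may vanish for small [n]. *)
Lemma is_lim_gauss_down (z l : R) :
  is_lim_seq (gauss (z + 1)) l -> is_lim_seq (gauss z) (z * l).
Proof.
intros h.
apply is_lim_seq_ext_loc
  with (fun n => z * gauss (z + 1) n * ((INR n + 0) / (INR n + (z + 1)))).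
- destruct (eventually_INR_plus_pos (z + 1)) as [N hN].
  exists (S N); intros n hn.
  assert (hn' : (N <= n)%nat) by lia; specialize (hN n hn').
  unfold gauss.
  assert (hn0 : 0 < INR n) by (apply lt_0_INR; lia).
  rewrite Rpower_plus, Rpower_1 by exact hn0.
  pose proof (Rpower_pos (INR n) z).
  pose proof (INR_fact_pos n).
  apply Rmult_eq_reg_r with (INR (fact n) * Rpower (INR n) z * (z + 1 + INR n)).
  2:{ positivity. }
  transitivity (prod_f_R0 (fun j => z + INR j) n * (z + 1 + INR n)).
  + rewrite prod_f_R0_shift. field. repeat split; lra.
  + field. repeat split; lra.
- replace (Finite (z * l)) with (Finite (z * l * 1)) by (f_equal; ring).
  apply is_lim_seq_mult'; [|apply is_lim_seq_INR_ratio].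
  apply is_lim_seq_mult'; [apply is_lim_seq_const|exact h].
Qed.

(** Monotone convergence covers [z >= 0]; the induction is on a natural number [m] with
    [- m <= z]. *)
Lemma ex_lim_gauss (z : R) : ex_finite_lim_seq (gauss z).
Proof.
destruct (nfloor_ex (Rabs z)) as [N [_ hN]]; [apply Rabs_pos|].
assert (hz : - (INR N + 1) <= z).
{ pose proof (Rle_abs (- z)); rewrite Rabs_Ropp in *; lra. }
clear hN; rewrite <- S_INR in hz; revert z hz.
induction (S N) as [|m IH]; intros z hz.
- simpl in hz.
  destruct (ex_finite_lim_seq_decr (fun n => gauss z (S n)) 0) as [l hl].
  + intros n; apply gauss_decr; lra.
  + intros n; apply gauss_nonneg; lra.
  + exists l; apply is_lim_seq_incr_1, hl.
- rewrite S_INR in hz.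
  destruct (IH (z + 1)) as [l hl]; [lra|].
  exists (z * l); apply is_lim_gauss_down, hl.
Qed.

Lemma is_lim_gauss (z : R) : is_lim_seq (gauss z) (rgamma z).
Proof. apply (Lim_seq_correct' (gauss z)), ex_lim_gauss. Qed.

Lemma rgamma_unique (z l : R) : is_lim_seq (gauss z) l -> rgamma z = l.
Proof.
intros h; change (real (Lim_seq (gauss z)) = l).
rewrite (is_lim_seq_unique _ _ h); reflexivity.
Qed.

Lemma rgamma_rec (z : R) : rgamma z = z * rgamma (z + 1).
Proof. apply rgamma_unique, is_lim_gauss_down, is_lim_gauss. Qed.

(** Once [z >= 1], the relation [rgamma z = z * rgamma (z + 1)] makes [Rabs (rgamma (z + m))]
    nonincreasing in [m]; the finitely many earlier shifts go into a maximum. Together with [1 / m!]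
    this gives the Bessel series an infinite radius. *)
Lemma rgamma_shift_bounded (z : R) :
  exists K, forall m : nat, Rabs (rgamma (z + INR m)) <= K.
Proof.
destruct (nfloor_ex (Rabs z)) as [N [_ hN]]; [apply Rabs_pos|].
assert (hz : 1 - (INR (S (S N))) <= z).
{ pose proof (Rle_abs (- z)); rewrite Rabs_Ropp in *; rewrite !S_INR; lra. }
clear hN; revert z hz.
induction (S (S N)) as [|n IH]; intros z hz.
- simpl in hz; exists (Rabs (rgamma z)); intros m.
  induction m as [|m IHm]; [simpl; rewrite Rplus_0_r; lra|].
  apply Rle_trans with (2 := IHm).
  rewrite (rgamma_rec (z + INR m)), Rabs_mult, S_INR.
  pose proof (pos_INR m).
  rewrite (Rabs_right (z + INR m)) by lra.
  replace (z + INR m + 1) with (z + (INR m + 1)) by ring.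
  pose proof (Rabs_pos (rgamma (z + (INR m + 1)))); nra.
- rewrite S_INR in hz.
  destruct (IH (z + 1)) as [K hK]; [lra|].
  exists (Rmax (Rabs (rgamma z)) K); intros [|m].
  + simpl; rewrite Rplus_0_r; apply Rmax_l.
  + apply Rle_trans with (2 := Rmax_r _ _).
    rewrite S_INR; replace (z + (INR m + 1)) with (z + 1 + INR m) by ring.
    apply hK.
Qed.

(** This is [H_(n+2) - ln (n + 1)], which tends to Euler's constant. The offset of the indices is
    the one produced by the logarithm of [gauss (1 + e) (S n)]. *)
Definition harmonic_gap (n : nat) : R :=
  sum_f_R0 (fun j => / (INR j + 1)) (S n) - ln (INR n + 1).

(** The sequence decreases from its value [1 + 1 / 2 - ln 1 = 3 / 2] at index [0], hence the upper
    bound. *)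
Lemma is_lim_harmonic_gap :
  exists g : R, is_lim_seq harmonic_gap g /\ 0 <= g <= 3 / 2.
Proof.
assert (hdecr : forall n, harmonic_gap (S n) <= harmonic_gap n).
{ intros n; unfold harmonic_gap.
  change (sum_f_R0 (fun j => / (INR j + 1)) (S (S n)))
    with (sum_f_R0 (fun j => / (INR j + 1)) (S n) + / (INR (S (S n)) + 1)).
  pose proof (ln_step_lower n) as h; pose proof (pos_INR n).
  rewrite ln_div in h by lra.
  rewrite !S_INR.
  replace (INR n + 1 + 1) with (INR n + 2) by ring.
  assert (/ (INR n + 2 + 1) <= / (INR n + 2)) by (apply Rinv_le_contravar; lra).
  lra. }
assert (hpos : forall n, 0 <= harmonic_gap n).
{ assert (hs : forall n, ln (INR n + 2) <= sum_f_R0 (fun j => / (INR j + 1)) n).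
  { induction n as [|n IH].
    - simpl; rewrite Rplus_0_l, Rplus_0_l, Rinv_1.
      rewrite <- (ln_exp 1) at 1.
      apply ln_le; [lra|]. pose proof (exp_ineq1_le 1); lra.
    - change (ln (INR (S n) + 2) <=
                sum_f_R0 (fun j => / (INR j + 1)) n + / (INR (S n) + 1)).
      pose proof (ln_step_upper (S n)) as h; pose proof (pos_INR n).
      rewrite !S_INR in *.
      rewrite ln_div in h by lra.
      replace (INR n + 1 + 1) with (INR n + 2) in h |- * by ring.
      lra. }
  intros n; unfold harmonic_gap.
  pose proof (hs (S n)) as h; pose proof (pos_INR n).
  assert (ln (INR n + 1) <= ln (INR (S n) + 2))
    by (apply ln_le; rewrite ?S_INR; lra).
  lra. }
destruct (ex_finite_lim_seq_decr harmonic_gap 0 hdecr hpos) as [g hg].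
exists g; split; [exact hg|split].
- apply (is_lim_seq_le (fun _ => 0) harmonic_gap 0 g hpos); [|exact hg].
  apply is_lim_seq_const.
- apply (is_lim_seq_le harmonic_gap (fun _ => 3 / 2) g (3 / 2));
    [|exact hg|apply is_lim_seq_const].
  intros n; induction n as [|n IH].
  + unfold harmonic_gap; simpl.
    rewrite !Rplus_0_l, ln_1; lra.
  + apply Rle_trans with (2 := IH), hdecr.
Qed.

(** Each factor [1 + e / (j + 1)] of the product lies between [exp (y - y ^ 2)] and [exp y] with
    [y = e / (j + 1)]; the squares [y ^ 2] sum to at most [2 * e ^ 2]. *)
Lemma gauss_one_bounds (e : R) (n : nat) :
  Rabs e <= 1 / 2 ->
  (INR n + 2) / (INR n + 1) * exp (e * harmonic_gap n - 2 * e ^ 2)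
    <= gauss (1 + e) (S n)
    <= (INR n + 2) / (INR n + 1) * exp (e * harmonic_gap n).
Proof.
intros he; apply Rabs_le_between in he.
(* The coefficient [2 - 1 / (m + 1)] lets the induction close, since [1 / (m + 2) ^ 2 <= 1 / (m + 1)
   - 1 / (m + 2)]. *)
assert (hprod : forall m,
  exp (e * sum_f_R0 (fun j => / (INR j + 1)) m - (2 - / (INR m + 1)) * e ^ 2)
    <= prod_f_R0 (fun j => 1 + e + INR j) m / INR (fact (S m))
    <= exp (e * sum_f_R0 (fun j => / (INR j + 1)) m)).
{ induction m as [|m IH].
  - simpl; rewrite Rplus_0_l, Rplus_0_r, Rinv_1.
    replace (e * 1 - (2 - 1) * (e * (e * 1))) with (e - e ^ 2) by ring.
    replace ((1 + e) / 1) with (1 + e) by field.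
    rewrite Rmult_1_r; split; [apply exp_quadratic_le; lra|apply exp_ineq1_le].
  - change (prod_f_R0 (fun j => 1 + e + INR j) (S m))
      with (prod_f_R0 (fun j => 1 + e + INR j) m * (1 + e + INR (S m))).
    change (sum_f_R0 (fun j => / (INR j + 1)) (S m))
      with (sum_f_R0 (fun j => / (INR j + 1)) m + / (INR (S m) + 1)).
    rewrite (fact_simpl (S m)), mult_INR.
    pose proof (INR_fact_pos (S m)); pose proof (pos_INR m).
    rewrite !S_INR in *.
    replace (INR m + 1 + 1) with (INR m + 2) by ring.
    set (y := e / (INR m + 2)).
    assert (hy : - (1 / 2) <= y).
    { unfold y; apply Rmult_le_reg_r with (INR m + 2); [lra|].
      unfold Rdiv at 2; rewrite Rmult_assoc, Rinv_l, Rmult_1_r by lra; nra. }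
    set (P := prod_f_R0 (fun j => 1 + e + INR j) m / INR (fact (S m))) in *.
    replace (prod_f_R0 (fun j => 1 + e + INR j) m * (1 + e + (INR m + 1))
               / ((INR m + 2) * INR (fact (S m))))
      with (P * (1 + y)) by (unfold P, y; field; lra).
    replace (e * (sum_f_R0 (fun j => / (INR j + 1)) m + / (INR m + 2)))
      with (e * sum_f_R0 (fun j => / (INR j + 1)) m + y)
      by (unfold y; field; lra).
    pose proof (exp_quadratic_le y hy) as hl.
    pose proof (exp_ineq1_le y) as hu.
    pose proof (exp_pos (y - y ^ 2)).
    pose proof (exp_pos (e * sum_f_R0 (fun j => / (INR j + 1)) m
                         - (2 - / (INR m + 1)) * e ^ 2)).
    split.
    + apply Rle_trans with
        (exp (e * sum_f_R0 (fun j => / (INR j + 1)) m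
              - (2 - / (INR m + 1)) * e ^ 2) * exp (y - y ^ 2)).
      * rewrite <- exp_plus; 
        assert (hq : y ^ 2 <= e ^ 2 * (/ (INR m + 1) - / (INR m + 2))).
        { unfold y.
          replace ((e / (INR m + 2)) ^ 2) with (e ^ 2 * / (INR m + 2) ^ 2)
            by (field; lra).
          apply Rmult_le_compat_l; [positivity|].
          replace (/ (INR m + 1) - / (INR m + 2))
            with (/ ((INR m + 1) * (INR m + 2))) by (field; lra).
          apply Rinv_le_contravar; nra. }
        apply exp_le_mono; lra.
      * apply Rmult_le_compat; try lra.
    + rewrite exp_plus; apply Rmult_le_compat; try lra. }
pose proof (pos_INR n).
unfold harmonic_gap.
set (s := sum_f_R0 (fun j => / (INR j + 1)) (S n)) in *.
assert (hg : gauss (1 + e) (S n) =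
  (INR n + 2) / (INR n + 1)
  * (prod_f_R0 (fun j => 1 + e + INR j) (S n) / INR (fact (S (S n))))
  * exp (- (e * ln (INR n + 1)))).
{ unfold gauss.
  rewrite (fact_simpl (S n)), mult_INR, !S_INR.
  rewrite Rpower_plus, Rpower_1 by lra.
  unfold Rpower; rewrite exp_Ropp.
  pose proof (exp_pos (e * ln (INR n + 1))).
  pose proof (INR_fact_pos (S n)).
  field; repeat split; lra. }
rewrite hg.
assert (hc : 0 < (INR n + 2) / (INR n + 1)) by positivity.
pose proof (exp_pos (- (e * ln (INR n + 1)))) as hE.
rewrite !Rmult_assoc.
split; apply Rmult_le_compat_l; try lra.
- apply Rle_trans with
    (exp (e * s - (2 - / (INR (S n) + 1)) * e ^ 2) * exp (- (e * ln (INR n + 1)))).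
  + rewrite <- exp_plus.
    apply exp_le_mono.
    assert (0 < / (INR (S n) + 1))
      by (apply Rinv_0_lt_compat; rewrite S_INR; lra).
    nra.
  + apply Rmult_le_compat_r; [lra|apply hprod].
- replace (e * (s - ln (INR n + 1))) with (e * s + - (e * ln (INR n + 1))) by ring.
  rewrite exp_plus; apply Rmult_le_compat_r; [lra|apply hprod].
Qed.

(** Here [g] is Euler's constant. The bounds [0 <= g <= 3 / 2] give [e * g <= 1], as
    [exp_le_quadratic] requires, and [9 / 4] as a bound for [g ^ 2]; the lower side loses only
    [2 * e ^ 2]. *)
Lemma rgamma_one_quadratic :
  exists g, forall e, Rabs e <= 1 / 2 ->
    Rabs (rgamma (1 + e) - 1 - g * e) <= 9 / 4 * e ^ 2.
Proof.
destruct is_lim_harmonic_gap as [g [hg hg1]].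
exists g; intros e he.
pose proof (is_lim_seq_INR_ratio 2 1) as hr.
assert (hexp : forall c, is_lim_seq
          (fun n => (INR n + 2) / (INR n + 1) * exp (e * harmonic_gap n - c))
          (exp (e * g - c))).
{ intros c; replace (exp (e * g - c)) with (1 * exp (e * g - c)) by ring.
  apply is_lim_seq_mult'; [exact hr|].
  apply (is_lim_seq_continuous exp).
  - apply derivable_continuous_pt, derivable_pt_exp.
  - apply is_lim_seq_minus'; [|apply is_lim_seq_const].
    apply is_lim_seq_mult'; [apply is_lim_seq_const|exact hg]. }
pose proof (proj1 (is_lim_seq_incr_1 _ _) (is_lim_gauss (1 + e))) as hlim.
assert (hlo : exp (e * g - 2 * e ^ 2) <= rgamma (1 + e)).
{ apply (is_lim_seq_le _ _ (exp (e * g - 2 * e ^ 2)) (rgamma (1 + e))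
          (fun n => proj1 (gauss_one_bounds e n he)) (hexp _) hlim). }
assert (hhi : rgamma (1 + e) <= exp (e * g - 0)).
{ refine (is_lim_seq_le _ _ (rgamma (1 + e)) (exp (e * g - 0)) _ hlim (hexp _)).
  intros n; rewrite Rminus_0_r; apply (gauss_one_bounds e n he). }
rewrite Rminus_0_r in hhi.
apply Rabs_le_between in he.
assert (h1 : e * g <= 1) by nra.
pose proof (exp_le_quadratic _ h1).
pose proof (exp_ineq1_le (e * g - 2 * e ^ 2)).
pose proof (pow2_ge_0 e).
assert (g ^ 2 <= 9 / 4) by nra.
assert ((e * g) ^ 2 <= 9 / 4 * e ^ 2)
  by (rewrite Rpow_mult_distr, Rmult_comm; apply Rmult_le_compat_r; lra).
apply Rabs_le; split; lra.
Qed.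

Lemma rgamma_1 : rgamma 1 = 1.
Proof.
destruct rgamma_one_quadratic as [g hg].
specialize (hg 0).
rewrite Rabs_R0, Rplus_0_r in hg.
pose proof (Rabs_pos (rgamma 1 - 1 - g * 0)) as hp.
assert (h0 : Rabs (rgamma 1 - 1 - g * 0) = 0) by lra.
apply Rabs_eq_0 in h0; lra.
Qed.

Lemma rgamma_0 : rgamma 0 = 0.
Proof. rewrite rgamma_rec; ring. Qed.

(** The expansion at [1] is carried to all nonnegative integers by the functional equation.
    Uniformity in [m] is lost, but only geometrically, and the factorials of the Bessel series
    absorb [8 ^ m]. *)
Lemma rgamma_quadratic :
  exists K, 0 <= K /\ exists D : nat -> R, forall (m : nat) (e : R),
    Rabs e <= 1 / 2 ->
    Rabs (D m) <= K * 8 ^ m /\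
    Rabs (rgamma (INR m + e) - rgamma (INR m) - D m * e) <= K * 8 ^ m * e ^ 2.
Proof.
destruct rgamma_one_quadratic as [g hg].
set (K := 9 / 4 + Rabs g).
pose proof (Rabs_pos g) as hgp.
(* [D m] is the derivative of [rgamma] at [m]: it is [1] at [0] because
   [rgamma e = e * rgamma (1 + e)], and the recursion differentiates
   [rgamma (z + 1) = rgamma z / z]. *)
set (D := fix D m := match m with
   | O => 1
   | S O => g
   | S m' => D m' / INR m' - rgamma (INR m') * / INR m' * / INR m' end).
exists K; split; [unfold K; lra|].
exists D.
assert (base0 : forall e, Rabs e <= 1 / 2 ->
  Rabs (D 0%nat) <= K * 8 ^ 0 /\
  Rabs (rgamma (INR 0 + e) - rgamma (INR 0) - D 0%nat * e) <= K * 8 ^ 0 * e ^ 2).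
{ intros e he; simpl; rewrite rgamma_0, Rabs_R1; split; [unfold K; lra|].
  rewrite Rplus_0_l, rgamma_rec, (Rplus_comm e 1).
  replace (e * rgamma (1 + e) - 0 - 1 * e)
    with (e * ((rgamma (1 + e) - 1 - g * e) + g * e)) by ring.
  rewrite Rabs_mult.
  specialize (hg e he).
  assert (h1 : Rabs (rgamma (1 + e) - 1 - g * e + g * e)
            <= 9 / 4 * e ^ 2 + Rabs g * Rabs e).
  { eapply Rle_trans; [apply Rabs_triang|].
    rewrite (Rabs_mult g e). lra. }
  rewrite <- (pow2_abs e) in *.
  pose proof (Rabs_pos e).
  unfold K. 
  assert (Rabs e * Rabs (rgamma (1 + e) - 1 - g * e + g * e)
    <= Rabs e * (9 / 4 * Rabs e ^ 2 + Rabs g * Rabs e))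
    by (apply Rmult_le_compat_l; assumption).
  assert (0 <= Rabs e ^ 2 * (1 - Rabs e))
    by positivity.
  replace (e * (e * 1)) with (Rabs e ^ 2) by (rewrite pow2_abs; ring).
  lra. }
assert (step : forall m e, Rabs e <= 1 / 2 ->
  Rabs (rgamma (INR (S m))) <= 1 /\
  Rabs (D (S m)) <= K * 8 ^ S m /\
  Rabs (rgamma (INR (S m) + e) - rgamma (INR (S m)) - D (S m) * e)
    <= K * 8 ^ S m * e ^ 2).
{ intros m; induction m as [|m IH]; intros e he.
  - simpl; rewrite rgamma_1, Rabs_R1.
    specialize (hg e he).
    unfold K; repeat split; try lra. nra.
  - specialize (IH e he); destruct IH as [hA [hDb hr]].
    set (n := INR (S m)) in *.
    assert (hn : 1 <= n) by (unfold n; rewrite S_INR; pose proof (pos_INR m); lra).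
    replace (INR (S (S m))) with (n + 1) by (unfold n; rewrite (S_INR (S m)); ring).
    change (D (S (S m))) with (D (S m) / n - rgamma n * / n * / n).
    apply Rabs_le_between in he.
    assert (hx1 : rgamma (n + e) = (n + e) * rgamma (n + 1 + e)).
    { rewrite (rgamma_rec (n + e)); do 2 f_equal; ring. }
    assert (hx2 : rgamma n = n * rgamma (n + 1)) by apply rgamma_rec.
    set (A := rgamma n) in *; set (B := rgamma (n + 1)) in *.
    set (x := rgamma (n + 1 + e)) in *; set (d := D (S m)) in *.
    set (r := rgamma (n + e) - A - d * e) in *.
    assert (hi : 0 < / n <= 1).
    { split; [positivity|].
      rewrite <- Rinv_1; apply Rinv_le_contravar; lra. }
    assert (hie : 0 < / (n + e) <= 2).
    { split; [positivity|].
      replace 2 with (/ (1 / 2)) by field; apply Rinv_le_contravar; lra. }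
    assert (hBA : B = A * / n) by (rewrite hx2; field; lra).
    assert (h8 : 1 <= 8 ^ S m) by (apply pow_R1_Rle; lra).
    assert (hK9 : 9 / 4 <= K) by (unfold K; lra).
    change (8 ^ S (S m)) with (8 * 8 ^ S m).
    assert (hAK : 1 <= K * 8 ^ S m) by nra.
    split; [|split].
    + rewrite hBA, Rabs_mult, (Rabs_right (/ n)) by lra.
      pose proof (Rabs_pos A); nra.
    + unfold Rminus; eapply Rle_trans; [apply Rabs_triang|].
      rewrite Rabs_Ropp; unfold Rdiv; rewrite !Rabs_mult, (Rabs_right (/ n)) by lra.
      pose proof (Rabs_pos A); pose proof (Rabs_pos d).
      assert (Rabs d * / n <= Rabs d) by nra.
      assert (Rabs A * / n <= Rabs A) by nra.
      assert (Rabs A * / n * / n <= Rabs A) by nra.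
      lra.
    (* The new remainder consists of three terms, each at most [K * 8 ^ S m * e ^ 2], times
       [/ (n + e) <= 2]; this costs a factor [6], below [8]. *)
    + assert (heq : x - B - (d / n - A * / n * / n) * e
        = (A * / n * / n * e ^ 2 - d * e ^ 2 * / n + r) * / (n + e)).
      { unfold r; rewrite hx1, hBA; field; split; lra. }
      rewrite heq, Rabs_mult, (Rabs_right (/ (n + e))) by lra.
      assert (he2 : 0 <= e ^ 2) by positivity.
      assert (hs : Rabs (A * / n * / n * e ^ 2 - d * e ^ 2 * / n + r)
         <= 3 * (K * 8 ^ S m * e ^ 2)).
      { eapply Rle_trans; [apply Rabs_triang|].
        assert (Rabs (A * / n * / n * e ^ 2 - d * e ^ 2 * / n)
           <= Rabs A * e ^ 2 + Rabs d * e ^ 2).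
        { unfold Rminus; eapply Rle_trans; [apply Rabs_triang|].
          rewrite Rabs_Ropp, !Rabs_mult, (Rabs_right (/ n)) by lra.
          rewrite (Rabs_right (e ^ 2)) by lra.
          pose proof (Rabs_pos A); pose proof (Rabs_pos d).
          assert (Rabs A * / n * / n <= Rabs A)
            by (assert (Rabs A * / n <= Rabs A) by nra; nra).
          assert (0 <= Rabs d * e ^ 2) by nra.
          nra. }
        assert (Rabs A * e ^ 2 <= K * 8 ^ S m * e ^ 2)
          by (apply Rmult_le_compat_r; lra).
        assert (Rabs d * e ^ 2 <= K * 8 ^ S m * e ^ 2)
          by (apply Rmult_le_compat_r; lra).
        lra. }
      assert (0 <= K * 8 ^ S m * e ^ 2) by nra.
      nra. }
intros [|m] e he; [apply base0, he|].
destruct (step m e he) as [_ h]; exact h.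
Qed.

(** * Wallis integrals and the reciprocal Gamma function at one half *)

Lemma ex_RInt_sin_pow (m : nat) : ex_RInt (fun x => sin x ^ m) 0 (PI / 2).
Proof.
apply (ex_RInt_continuous (V := R_CompleteNormedModule)).
intros x _; apply (ex_derive_continuous (V := R_NormedModule)).
auto_derive; exact I.
Qed.

(** The difference of the two integrands is the derivative of [cos x * sin x ^ (n + 1)], which
    vanishes at both ends. *)
Lemma sin_pow_integral_rec (n : nat) :
  (INR n + 2) * RInt (fun x => sin x ^ (n + 2)) 0 (PI / 2) =
  (INR n + 1) * RInt (fun x => sin x ^ n) 0 (PI / 2).
Proof.
pose proof ex_RInt_sin_pow as hex.
assert (h : is_RInt (fun x => (INR n + 1) * sin x ^ n
                              - (INR n + 2) * sin x ^ (n + 2)) 0 (PI / 2) 0).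
{ replace 0 with (minus (cos (PI / 2) * sin (PI / 2) ^ (n + 1))
                    (cos 0 * sin 0 ^ (n + 1))) at 2.
  2:{ rewrite cos_PI2, sin_0, Nat.add_1_r; unfold minus, plus, opp; simpl; ring. }
  apply (is_RInt_derive (V := R_CompleteNormedModule)
           (fun x => cos x * sin x ^ (n + 1))).
  - intros x _; auto_derive; [exact I|].
    replace (Init.Nat.pred (n + 1)) with n by lia.
    rewrite !pow_add, plus_INR; simpl (INR 1); simpl (_ ^ 1); simpl (_ ^ 2).
    pose proof (sin2_cos2 x) as hsc; unfold Rsqr in hsc.
    replace (sin x * (sin x * 1)) with (1 - cos x * cos x) by lra.
    assert (sin x ^ n * (sin x * sin x) = sin x ^ n * (1 - cos x * cos x))
      by (f_equal; lra).
    nra.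
  - intros x _; apply (ex_derive_continuous (V := R_NormedModule)).
    auto_derive; repeat split. }
apply (is_RInt_unique (V := R_CompleteNormedModule)) in h.
rewrite (RInt_minus (V := R_CompleteNormedModule)
           (fun x => (INR n + 1) * sin x ^ n)
           (fun x => (INR n + 2) * sin x ^ (n + 2))) in h.
2:{ apply (ex_RInt_scal (V := R_NormedModule)), hex. }
2:{ apply (ex_RInt_scal (V := R_NormedModule)), hex. }
rewrite !(RInt_scal (V := R_CompleteNormedModule)) in h by apply hex.
unfold minus, plus, opp, scal in h; simpl in h; unfold mult in h; simpl in h.
lra.
Qed.

(** Wallis: with [I n] the integral of [sin ^ n] over [0, PI/2], the product
    [(n+1) I_n I_(n+1)] is constant and [I] is nonincreasing. *)
Lemma rgamma_half : rgamma (1 / 2) ^ 2 = / PI.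
Proof.
set (I := fun n : nat => RInt (fun x => sin x ^ n) 0 (PI / 2)).
pose proof PI_RGT_0 as hpi.
assert (hrec : forall n, (INR n + 2) * I (n + 2)%nat = (INR n + 1) * I n)
  by (intros; apply sin_pow_integral_rec).
pose proof ex_RInt_sin_pow as hex.
assert (I0 : I 0%nat = PI / 2).
{ unfold I; rewrite (RInt_ext _ (fun _ => 1)) by (intros; reflexivity).
  rewrite RInt_const; unfold scal; simpl; unfold mult; simpl; lra. }
assert (I1 : I 1%nat = 1).
{ unfold I; rewrite (RInt_ext _ sin) by (intros; apply pow_1).
  apply (is_RInt_unique (V := R_CompleteNormedModule)).
  replace 1 with (minus (- cos (PI / 2)) (- cos 0)) at 1
    by (rewrite cos_PI2, cos_0; unfold minus, plus, opp; simpl; ring).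
  apply (is_RInt_derive (V := R_CompleteNormedModule) (fun x => - cos x)).
  - intros x _; auto_derive; [exact Logic.I|ring].
  - intros x _; apply (ex_derive_continuous (V := R_NormedModule)).
    auto_derive; exact Logic.I. }
assert (hdec : forall n, I (S n) <= I n).
{ intros n; apply RInt_le; [lra|apply hex|apply hex|].
  intros x hx.
  assert (h0 : 0 <= sin x) by (apply sin_ge_0; lra).
  pose proof (SIN_bound x); simpl.
  pose proof (pow_le _ n h0); nra. }
assert (hprod : forall n, (INR n + 1) * (I n * I (S n)) = PI / 2).
{ induction n as [|n IH].
  - rewrite I0, I1; simpl; ring.
  - rewrite <- IH; rewrite S_INR.
    replace (S (S n)) with (n + 2)%nat by lia.
    transitivity (I (S n) * ((INR n + 2) * I (n + 2)%nat)); [ring|].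
    rewrite hrec; ring. }
(* The half-integer product over the factorial satisfies the same recursion as the Wallis integrals
   of even index, hence equals one of them up to an explicit factor. *)
assert (hgauss : forall n,
  gauss (1 / 2) (S n) =
  2 / PI * I (2 * (n + 2))%nat * (INR n + 2) * / Rpower (INR n + 1) (1 / 2)).
{ assert (hp : forall n, prod_f_R0 (fun j => 1 / 2 + INR j) n / INR (fact n) =
     2 / PI * I (2 * (n + 1))%nat * (INR n + 1)).
  { induction n as [|n IH].
    - simpl (2 * (0 + 1))%nat. pose proof (hrec 0%nat) as h.
      simpl in h. rewrite I0 in h. simpl.
      replace (I 2%nat) with (PI / 4) by lra. field. lra.
    - change (prod_f_R0 (fun j => 1 / 2 + INR j) (S n))
        with (prod_f_R0 (fun j => 1 / 2 + INR j) n * (1 / 2 + INR (S n))).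
      rewrite fact_simpl, mult_INR.
      pose proof (INR_fact_pos n); pose proof (pos_INR n).
      transitivity (prod_f_R0 (fun j => 1 / 2 + INR j) n / INR (fact n)
                    * ((1 / 2 + INR (S n)) / INR (S n)));
        [rewrite S_INR; field; lra|].
      rewrite IH.
      pose proof (hrec (2 * (n + 1))%nat) as h.
      replace (2 * (n + 1) + 2)%nat with (2 * (S n + 1))%nat in h by lia.
      rewrite mult_INR, plus_INR in h; simpl (INR 2) in h; simpl (INR 1) in h.
      rewrite S_INR.
      assert (h' : I (2 * (S n + 1))%nat
         = (2 * (INR n + 1) + 1) * I (2 * (n + 1))%nat / (2 * (INR n + 1) + 2)).
      { apply Rmult_eq_reg_l with (2 * (INR n + 1) + 2); [|lra].
        transitivity ((2 * (INR n + 1) + 1) * I (2 * (n + 1))%nat);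
          [lra|field; lra]. }
      rewrite h'; field; lra. }
  intros n; unfold gauss.
  pose proof (hp (S n)) as h.
  pose proof (INR_fact_pos (S n)).
  replace (S n + 1)%nat with (n + 2)%nat in h by lia.
  rewrite S_INR in *.
  pose proof (Rpower_pos (INR n + 1) (1 / 2)).
  replace (INR n + 1 + 1) with (INR n + 2) in h by ring.
  rewrite <- h; field; split; lra. }
assert (hsq : forall n, gauss (1 / 2) (S n) ^ 2 =
  4 / PI ^ 2 * I (2 * (n + 2))%nat ^ 2 * ((INR n + 2) ^ 2 / (INR n + 1))).
{ intros n; rewrite hgauss; pose proof (pos_INR n).
  assert (h : Rpower (INR n + 1) (1 / 2) ^ 2 = INR n + 1).
  { simpl; rewrite Rmult_1_r, <- Rpower_plus.
    replace (1 / 2 + 1 / 2) with 1 by field; apply Rpower_1; lra. }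
  pose proof (Rpower_pos (INR n + 1) (1 / 2)).
  replace ((2 / PI * I (2 * (n + 2))%nat * (INR n + 2)
             * / Rpower (INR n + 1) (1 / 2)) ^ 2)
    with (4 / PI ^ 2 * I (2 * (n + 2))%nat ^ 2
             * ((INR n + 2) ^ 2 / Rpower (INR n + 1) (1 / 2) ^ 2))
    by (field; lra).
  rewrite h; reflexivity. }
assert (hIpos : forall n, 0 <= I n).
{ intros n; apply RInt_ge_0; [lra|apply hex|].
  intros x hx; apply pow_le, sin_ge_0; lra. }
assert (hlim : forall c, is_lim_seq
  (fun n => / PI * ((INR n + 2) ^ 2 / ((INR n + 1) * (INR n + c)))) (/ PI)).
{ intros c.
  replace (Finite (/ PI)) with (Finite (/ PI * (1 * 1))) by (f_equal; ring).
  apply is_lim_seq_mult'; [apply is_lim_seq_const|].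
  apply is_lim_seq_ext_loc
    with (fun n => ((INR n + 2) / (INR n + 1)) * ((INR n + 2) / (INR n + c))).
  - destruct (eventually_INR_plus_pos c) as [N hN].
    exists N; intros n hn; specialize (hN n hn); pose proof (pos_INR n).
    field; lra.
  - apply is_lim_seq_mult'; apply is_lim_seq_INR_ratio. }
assert (h1 : is_lim_seq (fun n => gauss (1 / 2) (S n) ^ 2) (/ PI)).
{ apply is_lim_seq_le_le with
   (fun n => / PI * ((INR n + 2) ^ 2 / ((INR n + 1) * (INR n + 5 / 2))))
   (fun n => / PI * ((INR n + 2) ^ 2 / ((INR n + 1) * (INR n + 2))));
   [|apply hlim|apply hlim].
  intros n; rewrite hsq; pose proof (pos_INR n).
  set (N := (2 * (n + 2))%nat).
  assert (hN : INR N = 2 * (INR n + 2))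
    by (unfold N; rewrite mult_INR, plus_INR; simpl; ring).
  (* Monotonicity squeezes [I N ^ 2] between [I N * I (N + 1)] and [I (N - 1) * I N], both known
     exactly from [hprod]. *)
  assert (ha : I N ^ 2 >= PI / 4 / (INR n + 5 / 2)).
  { assert (I N * I (S N) = PI / 4 / (INR n + 5 / 2)).
    { pose proof (hprod N) as h; rewrite hN in h.
      replace (PI / 4) with (1 / 2 * (PI / 2)) by field; rewrite <- h; field; lra. }
    pose proof (hdec N); pose proof (hIpos N); pose proof (hIpos (S N)); nra. }
  assert (hb : I N ^ 2 <= PI / 4 / (INR n + 2)).
  { assert (hP : N = S (2 * n + 3)) by (unfold N; lia).
    assert (I (2 * n + 3)%nat * I N = PI / 4 / (INR n + 2)).
    { pose proof (hprod (2 * n + 3)%nat) as h; rewrite <- hP in h.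
      rewrite plus_INR, mult_INR in h; simpl (INR 2) in h; simpl (INR 3) in h.
      replace (PI / 4) with (1 / 2 * (PI / 2)) by field; rewrite <- h; field; lra. }
    pose proof (hdec (2 * n + 3)%nat) as hd; rewrite <- hP in hd.
    pose proof (hIpos N); nra. }
  assert (hf : 0 < 4 / PI ^ 2 * ((INR n + 2) ^ 2 / (INR n + 1)))
    by positivity.
  split.
  - replace (/ PI * ((INR n + 2) ^ 2 / ((INR n + 1) * (INR n + 5 / 2))))
      with (4 / PI ^ 2 * ((INR n + 2) ^ 2 / (INR n + 1))
              * (PI / 4 / (INR n + 5 / 2))) by (field; repeat split; lra).
    nra.
  - replace (/ PI * ((INR n + 2) ^ 2 / ((INR n + 1) * (INR n + 2))))
      with (4 / PI ^ 2 * ((INR n + 2) ^ 2 / (INR n + 1))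
              * (PI / 4 / (INR n + 2))) by (field; repeat split; lra).
    nra. }
assert (h2 : is_lim_seq (fun n => gauss (1 / 2) (S n) ^ 2) (rgamma (1 / 2) ^ 2)).
{ pose proof (proj1 (is_lim_seq_incr_1 _ _) (is_lim_gauss (1 / 2))) as h.
  simpl; apply is_lim_seq_mult'; [exact h|].
  apply is_lim_seq_mult'; [exact h|apply is_lim_seq_const]. }
apply is_lim_seq_unique in h1; apply is_lim_seq_unique in h2.
rewrite h1 in h2; injection h2; auto.
Qed.

(** * Bessel functions of the first kind *)

(** Coefficients of the entire function of [t = (x / 2) ^ 2] (a Bessel-Clifford function) that
    remains when [(x / 2) ^ s] is stripped from [J_s]. It makes sense at every real order and at
    [t = 0], where constants can be evaluated. *)
Definition bessel_coef (s : R) (m : nat) : R :=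
  (-1) ^ m / INR (fact m) * rgamma (s + INR m + 1).

Lemma besselJ_pseries (s x : R) :
  besselJ s x = Rpower (x / 2) s * PSeries (bessel_coef s) ((x / 2) ^ 2).
Proof.
unfold besselJ, PSeries; f_equal; apply Series_ext; intros m.
unfold bessel_coef; rewrite pow_mult; reflexivity.
Qed.

Lemma pow_over_fact_le_exp (y : R) (n : nat) :
  0 <= y -> y ^ n / INR (fact n) <= exp y.
Proof.
intros hy.
assert (h : forall n x, 0 <= x -> x ^ n / INR (fact n) <= exp x).
{ clear n y hy; induction n as [|n IH]; intros x hx.
  - simpl; pose proof (exp_ineq1_le x); lra.
  - enough (0 - 0 <= exp x - x ^ S n / INR (fact (S n))) by lra.
    apply Rle_trans with (exp 0 - 0 ^ S n / INR (fact (S n))).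
    { rewrite exp_0; simpl (0 ^ S n); rewrite Rmult_0_l; unfold Rdiv; lra. }
    apply (nondecreasing_of_derive
             (fun x => exp x - x ^ S n / INR (fact (S n)))
             (fun x => exp x - x ^ n / INR (fact n))); [exact hx| |].
    + intros u _.
      assert (hc : INR (fact (S n)) = (INR n + 1) * INR (fact n))
        by (rewrite fact_simpl, mult_INR, S_INR; ring).
      pose proof (INR_fact_pos n); pose proof (pos_INR n).
      apply (is_derive_ext (fun x => exp x - x ^ S n / ((INR n + 1) * INR (fact n)))).
      { intros y; rewrite hc; reflexivity. }
      auto_derive; [exact Logic.I|].
      change (match n with O => 1 | S _ => INR n + 1 end) with (INR (S n)).
      rewrite S_INR; field; lra.
    + intros u hu; specialize (IH u (proj1 hu)); lra. }
apply h, hy.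
Qed.

(** At every radius [r] the terms are bounded by [K * exp (C * Rabs r)]. *)
Lemma CV_radius_of_factorial_bound (a : nat -> R) (K C : R) :
  0 <= C -> (forall n, Rabs (a n) <= K * C ^ n / INR (fact n)) ->
  CV_radius a = p_infty.
Proof.
intros hC ha.
destruct (CV_radius_bounded a) as [hub _].
assert (hb : forall r : R, Rbar_le r (CV_radius a)).
{ intros r; apply hub; exists (K * exp (C * Rabs r)); intros n.
  rewrite Rabs_mult, <- RPow_abs.
  pose proof (Rabs_pos r) as hr.
  pose proof (pow_over_fact_le_exp (C * Rabs r) n (Rmult_le_pos _ _ hC hr)) as he.
  rewrite Rpow_mult_distr in he.
  assert (hK : 0 <= K).
  { specialize (ha O); simpl in ha; pose proof (Rabs_pos (a O)); lra. }
  apply Rle_trans with (K * C ^ n / INR (fact n) * Rabs r ^ n).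
  - apply Rmult_le_compat_r; [positivity|apply ha].
  - replace (K * C ^ n / INR (fact n) * Rabs r ^ n)
      with (K * (C ^ n * Rabs r ^ n / INR (fact n)))
      by (pose proof (INR_fact_pos n); field; lra).
    apply Rmult_le_compat_l; assumption. }
destruct (CV_radius a) as [r| |]; [|reflexivity|].
- specialize (hb (r + 1)); simpl in hb; lra.
- specialize (hb 0); contradiction.
Qed.

Lemma CV_radius_bessel (s : R) : CV_radius (bessel_coef s) = p_infty.
Proof.
destruct (rgamma_shift_bounded (s + 1)) as [K hK].
apply (CV_radius_of_factorial_bound _ K 1); [lra|]; intros n.
unfold bessel_coef, Rdiv.
rewrite !Rabs_mult, pow_1_abs, pow1.
pose proof (INR_fact_pos n).
rewrite Rabs_right by positivity.
replace (s + INR n + 1) with (s + 1 + INR n) by ring.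
rewrite Rmult_1_l, Rmult_1_r, Rmult_comm.
apply Rmult_le_compat_r; [positivity|apply hK].
Qed.

Lemma bessel_coef_derive (s : R) (m : nat) :
  PS_derive (bessel_coef s) m = - bessel_coef (s + 1) m.
Proof.
unfold PS_derive, bessel_coef.
rewrite fact_simpl, mult_INR, S_INR.
replace (s + (INR m + 1) + 1) with (s + 1 + INR m + 1) by ring.
pose proof (INR_fact_pos m); pose proof (pos_INR m).
simpl ((-1) ^ S m); field; lra.
Qed.

Lemma is_derive_bessel_pseries (s t : R) :
  is_derive (PSeries (bessel_coef s)) t (- PSeries (bessel_coef (s + 1)) t).
Proof.
replace (- PSeries (bessel_coef (s + 1)) t)
  with (PSeries (PS_derive (bessel_coef s)) t).
- apply is_derive_PSeries; rewrite CV_radius_bessel; exact I.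
- rewrite <- PSeries_opp; apply PSeries_ext; intros m.
  rewrite bessel_coef_derive; reflexivity.
Qed.

Lemma ex_pseries_bessel (s t : R) : ex_pseries (bessel_coef s) t.
Proof. apply CV_radius_inside; rewrite CV_radius_bessel; exact I. Qed.

(** Coefficientwise, [rgamma_rec] turns the order [s - 1] into the factor [s + m]; the part [m] is
    the index shift of [bessel_coef_derive]. *)
Lemma bessel_pseries_rec (s t : R) :
  PSeries (bessel_coef (s - 1)) t =
  s * PSeries (bessel_coef s) t - t * PSeries (bessel_coef (s + 1)) t.
Proof.
rewrite <- PSeries_scal, <- PSeries_incr_1, <- PSeries_minus.
- apply PSeries_ext; intros m.
  assert (h : bessel_coef (s - 1) m = (s + INR m) * bessel_coef s m).
  { unfold bessel_coef; rewrite (rgamma_rec (s - 1 + INR m + 1)).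
    replace (s - 1 + INR m + 1 + 1) with (s + INR m + 1) by ring.
    replace (s - 1 + INR m + 1) with (s + INR m) by ring; ring. }
  rewrite h; unfold PS_minus, PS_plus, PS_opp, PS_scal, PS_incr_1.
  destruct m as [|m]; unfold plus, opp, scal, zero; simpl; unfold mult; simpl.
  + ring.
  + pose proof (bessel_coef_derive s m) as hd; unfold PS_derive in hd.
    change (match m with O => 1 | S _ => INR m + 1 end) with (INR (S m)).
    lra.
- apply (ex_pseries_scal s); [apply Rmult_comm|apply ex_pseries_bessel].
- apply ex_pseries_incr_1, ex_pseries_bessel.
Qed.

Lemma Rpower_succ (y s : R) : 0 < y -> Rpower y (s + 1) = y * Rpower y s.
Proof. intros hy; rewrite Rpower_plus, Rpower_1 by exact hy; ring. Qed.

Lemma is_derive_besselJ (s x : R) :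
  0 < x -> is_derive (besselJ s) x (s / x * besselJ s x - besselJ (s + 1) x).
Proof.
intros hx.
apply (is_derive_ext (fun x => exp (s * ln (x / 2))
                               * PSeries (bessel_coef s) ((x / 2) ^ 2))).
{ intros t; rewrite besselJ_pseries; reflexivity. }
rewrite !besselJ_pseries, Rpower_succ by lra.
evar_last.
- apply is_derive_Rmult.
  + auto_derive; [lra|reflexivity].
  + apply (is_derive_Rcomp (PSeries (bessel_coef s)) (fun x => (x / 2) ^ 2)).
    * apply is_derive_bessel_pseries.
    * auto_derive; [exact I|reflexivity].
- unfold Rpower; change (x * / 2) with (x / 2).
  set (E := exp (s * ln (x / 2))); field; lra.
Qed.

Lemma besselJ_rec (s x : R) :
  0 < x -> besselJ (s - 1) x + besselJ (s + 1) x = 2 * s / x * besselJ s x.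
Proof.
intros hx; rewrite !besselJ_pseries, bessel_pseries_rec.
replace (Rpower (x / 2) (s + 1))
  with (x / 2 * (x / 2) * Rpower (x / 2) (s - 1)).
2:{ rewrite Rmult_assoc, <- !Rpower_succ by lra; f_equal; ring. }
replace (Rpower (x / 2) s) with (x / 2 * Rpower (x / 2) (s - 1)).
2:{ rewrite <- Rpower_succ by lra; f_equal; ring. }
field; lra.
Qed.

Lemma besselJ_opp_one (x : R) : 0 < x -> besselJ (- (1)) x = - besselJ 1 x.
Proof.
intros hx; pose proof (besselJ_rec 0 x hx) as h.
replace (0 - 1) with (- (1)) in h by ring; rewrite Rplus_0_l in h.
replace (2 * 0 / x * besselJ 0 x) with 0 in h by (unfold Rdiv; ring); lra.
Qed.

(** The hypothesis on [n + 1] puts all Gamma arguments of the series at nonnegative integers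
    [j + m], where [rgamma_quadratic] applies. The quadratic remainders are then summed against
    [8 ^ m / m!]. *)
Lemma is_derive_besselJ_order (n x : R) :
  0 < x -> (exists j : nat, n + 1 = INR j) ->
  ex_derive (fun s => besselJ s x) n.
Proof.
intros hx [j hj].
destruct rgamma_quadratic as [K [hK [D hD]]].
set (t := (x / 2) ^ 2).
set (C := K * 8 ^ j).
assert (h8 : forall k, 0 <= 8 ^ k) by (intros; positivity).
assert (hC : 0 <= C) by (apply Rmult_le_pos; [exact hK|apply h8]).
set (dc := fun m => (-1) ^ m / INR (fact m) * D (j + m)%nat).
assert (hcoef : forall m e, Rabs e <= 1 / 2 ->
  Rabs (bessel_coef (n + e) m - bessel_coef n m - dc m * e)
    <= e ^ 2 * (C * 8 ^ m / INR (fact m)) /\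
  Rabs (dc m) <= C * 8 ^ m / INR (fact m)).
{ intros m e he; destruct (hD (j + m)%nat e he) as [h1 h2].
  pose proof (INR_fact_pos m) as hf.
  assert (hs : Rabs ((-1) ^ m / INR (fact m)) = / INR (fact m)).
  { unfold Rdiv; rewrite Rabs_mult, pow_1_abs.
    rewrite Rabs_right by positivity; ring. }
  rewrite pow_add in h1, h2.
  split.
  - unfold bessel_coef, dc.
    replace (n + e + INR m + 1) with (INR (j + m) + e)
      by (rewrite plus_INR, <- hj; ring).
    replace (n + INR m + 1) with (INR (j + m)) by (rewrite plus_INR, <- hj; ring).
    replace ((-1) ^ m / INR (fact m) * rgamma (INR (j + m) + e)
             - (-1) ^ m / INR (fact m) * rgamma (INR (j + m))
             - (-1) ^ m / INR (fact m) * D (j + m)%nat * e)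
      with ((-1) ^ m / INR (fact m) * (rgamma (INR (j + m) + e)
              - rgamma (INR (j + m)) - D (j + m)%nat * e)) by ring.
    rewrite Rabs_mult, hs.
    replace (e ^ 2 * (C * 8 ^ m / INR (fact m)))
      with (/ INR (fact m) * (K * (8 ^ j * 8 ^ m) * e ^ 2))
      by (unfold C; field; lra).
    apply Rmult_le_compat_l; [positivity|exact h2].
  - unfold dc; rewrite Rabs_mult, hs.
    replace (C * 8 ^ m / INR (fact m))
      with (/ INR (fact m) * (K * (8 ^ j * 8 ^ m))) by (unfold C; field; lra).
    apply Rmult_le_compat_l; [positivity|exact h1]. }
assert (hrad : CV_radius dc = p_infty).
{ apply (CV_radius_of_factorial_bound _ C 8); [lra|]; intros m.
  apply (hcoef m 0); rewrite Rabs_R0; lra. }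
assert (ht : 0 <= t) by (apply pow2_ge_0).
set (b := fun m => C * 8 ^ m / INR (fact m)).
assert (hbrad : CV_radius b = p_infty).
{ apply (CV_radius_of_factorial_bound _ C 8); [lra|]; intros m.
  unfold b; rewrite Rabs_right; [lra|].
  apply Rle_ge, Rmult_le_pos; [positivity|].
  left; apply Rinv_0_lt_compat, INR_fact_pos. }
assert (hP : is_derive (fun s => PSeries (bessel_coef s) t) n (PSeries dc t)).
{ apply (is_derive_of_quadratic_bound _ _ _ (PSeries b t) (1 / 2)); [lra|].
  intros e he.
  assert (hdiff : PSeries (bessel_coef (n + e)) t - PSeries (bessel_coef n) t
                  - PSeries dc t * e =
     PSeries (PS_minus (PS_minus (bessel_coef (n + e)) (bessel_coef n))
                (PS_scal e dc)) t).
  { rewrite !PSeries_minus, PSeries_scal; [ring| | | |].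
    - apply ex_pseries_bessel.
    - apply ex_pseries_bessel.
    - apply ex_pseries_minus; apply ex_pseries_bessel.
    - apply ex_pseries_scal; [apply Rmult_comm|].
      apply CV_radius_inside; rewrite hrad; exact I. }
  rewrite hdiff; unfold PSeries.
  rewrite (Rmult_comm (Series _)), <- Series_scal_l.
  assert (hle : forall m,
    Rabs (PS_minus (PS_minus (bessel_coef (n + e)) (bessel_coef n))
                (PS_scal e dc) m * t ^ m) <= e ^ 2 * (b m * t ^ m)).
  { intros m; rewrite Rabs_mult.
    rewrite (Rabs_right (t ^ m)) by positivity.
    rewrite <- Rmult_assoc; apply Rmult_le_compat_r; [positivity|].
    unfold PS_minus, PS_plus, PS_opp, PS_scal, plus, opp, scal; simpl.
    unfold mult; simpl.
    replace (bessel_coef (n + e) m + - bessel_coef n m + - (e * dc m))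
      with (bessel_coef (n + e) m - bessel_coef n m - dc m * e) by ring.
    apply (hcoef m e he). }
  assert (hexb : ex_series (fun m => e ^ 2 * (b m * t ^ m))).
  { apply (ex_series_scal_l (e ^ 2) (fun m => b m * t ^ m)).
    assert (hx' : ex_series (fun m => Rabs (b m * t ^ m)))
      by (apply CV_disk_inside; rewrite hbrad; exact I).
    apply ex_series_Rabs in hx'; exact hx'. }
  apply Rle_trans with (Series (fun m => Rabs
    (PS_minus (PS_minus (bessel_coef (n + e)) (bessel_coef n))
                (PS_scal e dc) m * t ^ m))).
  - apply Series_Rabs.
    apply (ex_series_le (V := R_CompleteNormedModule)) with (2 := hexb).
    intros m; unfold norm; simpl; unfold abs; simpl; rewrite Rabs_Rabsolu.
    apply hle.
  - apply Series_le; [|exact hexb].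
    intros m; split; [apply Rabs_pos|apply hle]. }
apply (ex_derive_ext (fun s => exp (s * ln (x / 2)) * PSeries (bessel_coef s) t)).
{ intros s; rewrite besselJ_pseries; reflexivity. }
apply (ex_derive_mult (fun s => exp (s * ln (x / 2)))).
- auto_derive; exact I.
- exists (PSeries dc t); exact hP.
Qed.

(** * Bessel functions of the second kind *)

Lemma is_derive_besselJ_succ (s x : R) :
  0 < x ->
  is_derive (besselJ (s + 1)) x (besselJ s x - (s + 1) / x * besselJ (s + 1) x).
Proof.
intros hx; pose proof (is_derive_besselJ (s + 1) x hx) as h.
pose proof (besselJ_rec (s + 1) x hx) as hr.
replace (s + 1 - 1) with s in hr by ring.
replace (besselJ s x - (s + 1) / x * besselJ (s + 1) x)
  with ((s + 1) / x * besselJ (s + 1) x - besselJ (s + 1 + 1) x); [exact h|].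
replace (besselJ s x)
  with (2 * (s + 1) / x * besselJ (s + 1) x - besselJ (s + 1 + 1) x) by lra.
field; lra.
Qed.

(** The shift by [PI] flips [sin] and [cos] together. The resulting sign in front of [J_(-s-1)]
    compensates the one in the recurrences of [J_(-s)], so the quotient obeys the same relations as
    [J_s]. *)
Lemma besselY_quotient_succ (s x : R) :
  besselY_quotient (s + 1) x =
  (besselJ (s + 1) x * cos (s * PI) + besselJ (- s - 1) x) / sin (s * PI).
Proof.
unfold besselY_quotient.
replace ((s + 1) * PI) with (s * PI + PI) by ring.
rewrite neg_sin, neg_cos; replace (- (s + 1)) with (- s - 1) by ring.
unfold Rdiv; rewrite Rinv_opp; ring.
Qed.

Lemma is_derive_besselY_quotient (s x : R) :
  0 < x -> sin (s * PI) <> 0 ->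
  is_derive (besselY_quotient s) x
    (s / x * besselY_quotient s x - besselY_quotient (s + 1) x).
Proof.
intros hx hs; rewrite besselY_quotient_succ.
pose proof (besselJ_rec (- s) x hx) as hr.
pose proof (is_derive_besselJ s x hx) as h1.
pose proof (is_derive_besselJ (- s) x hx) as h2.
unfold besselY_quotient.
evar_last.
- apply is_derive_Rmult; [|apply is_derive_Rconst].
  apply is_derive_Rminus;
    [|exact h2].
  apply is_derive_Rmult;
    [exact h1|apply is_derive_Rconst].
- simpl.
  replace (besselJ (- s - 1) x)
    with (2 * - s / x * besselJ (- s) x - besselJ (- s + 1) x) by lra.
  field; lra.
Qed.

Lemma besselY_quotient_rec (s x : R) :
  0 < x -> sin (s * PI) <> 0 ->
  besselY_quotient s x + besselY_quotient (s + 1 + 1) x =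
  2 * (s + 1) / x * besselY_quotient (s + 1) x.
Proof.
intros hx hs; rewrite !besselY_quotient_succ; unfold besselY_quotient.
replace ((s + 1) * PI) with (s * PI + PI) by ring.
rewrite neg_sin, neg_cos.
pose proof (besselJ_rec (s + 1) x hx) as h1.
pose proof (besselJ_rec (- s - 1) x hx) as h2.
replace (s + 1 - 1) with s in h1 by ring.
replace (- s - 1 + 1) with (- s) in h2 by ring.
replace (- (s + 1) - 1) with (- s - 1 - 1) by ring.
replace (besselJ s x)
  with (2 * (s + 1) / x * besselJ (s + 1) x - besselJ (s + 1 + 1) x) by lra.
replace (besselJ (- s) x)
  with (2 * (- s - 1) / x * besselJ (- s - 1) x - besselJ (- s - 1 - 1) x) by lra.
field; repeat split; lra.
Qed.

Lemma is_derive_besselY_quotient_succ (s x : R) :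
  0 < x -> sin (s * PI) <> 0 ->
  is_derive (besselY_quotient (s + 1)) x
    (besselY_quotient s x - (s + 1) / x * besselY_quotient (s + 1) x).
Proof.
intros hx hs.
assert (hs' : sin ((s + 1) * PI) <> 0).
{ replace ((s + 1) * PI) with (s * PI + PI) by ring; rewrite neg_sin; lra. }
pose proof (is_derive_besselY_quotient (s + 1) x hx hs') as h.
pose proof (besselY_quotient_rec s x hx hs) as hr.
replace (besselY_quotient s x)
  with (2 * (s + 1) / x * besselY_quotient (s + 1) x
        - besselY_quotient (s + 1 + 1) x) by lra.
replace (2 * (s + 1) / x * besselY_quotient (s + 1) x
        - besselY_quotient (s + 1 + 1) x
        - (s + 1) / x * besselY_quotient (s + 1) x)
  with ((s + 1) / x * besselY_quotient (s + 1) x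
        - besselY_quotient (s + 1 + 1) x) by (field; lra).
exact h.
Qed.

(** Up to the factor [2 / x], the left side is a function [Q] of [t = (x / 2) ^ 2] whose derivative
    vanishes by the recurrence, so its value is read off at [t = 0]. *)
Lemma besselJ_cross_product (s x : R) :
  0 < x ->
  besselJ (s + 1) x * besselJ (- s) x + besselJ s x * besselJ (- s - 1) x =
  2 / x * (rgamma (s + 1) * rgamma (- s)).
Proof.
intros hx.
set (Q := fun t => PSeries (bessel_coef s) t * PSeries (bessel_coef (- s - 1)) t
   + t * (PSeries (bessel_coef (s + 1)) t * PSeries (bessel_coef (- s)) t)).
assert (hQ : forall t, is_derive Q t 0).
{ intros t; unfold Q.
  pose proof (bessel_pseries_rec (s + 1) t) as r1.
  pose proof (bessel_pseries_rec (- s) t) as r2.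
  replace (s + 1 - 1) with s in r1 by ring.
  pose proof (is_derive_bessel_pseries s t) as d1.
  pose proof (is_derive_bessel_pseries (- s - 1) t) as d2.
  pose proof (is_derive_bessel_pseries (s + 1) t) as d3.
  pose proof (is_derive_bessel_pseries (- s) t) as d4.
  replace (- s - 1 + 1) with (- s) in d2 by ring.
  evar_last.
  - apply is_derive_Rplus.
    + apply is_derive_Rmult; eassumption.
    + apply is_derive_Rmult;
        [apply (is_derive_id (K := R_AbsRing))|].
      apply is_derive_Rmult; eassumption.
  - unfold plus, one; simpl; rewrite r1, r2; ring. }
assert (hc : Q 0 = Q ((x / 2) ^ 2)).
{ apply constant_of_derive; [positivity|intros; apply hQ]. }
assert (h0 : Q 0 = rgamma (s + 1) * rgamma (- s)).
{ unfold Q; rewrite !PSeries_0; unfold bessel_coef; simpl.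
  replace (s + 0 + 1) with (s + 1) by ring.
  replace (- s - 1 + 0 + 1) with (- s) by ring. field. }
rewrite <- h0, hc; unfold Q; rewrite !besselJ_pseries.
set (t := (x / 2) ^ 2).
assert (hp : Rpower (x / 2) (- s) = / Rpower (x / 2) s) by apply Rpower_Ropp.
assert (hp1 : Rpower (x / 2) (- s - 1) = / (x / 2 * Rpower (x / 2) s)).
{ replace (- s - 1) with (- (s + 1)) by ring.
  rewrite Rpower_Ropp, Rpower_succ by lra; reflexivity. }
rewrite hp1, hp, Rpower_succ by lra.
pose proof (Rpower_pos (x / 2) s).
generalize (PSeries (bessel_coef s) t) (PSeries (bessel_coef (- s - 1)) t)
  (PSeries (bessel_coef (s + 1)) t) (PSeries (bessel_coef (- s)) t).
intros; unfold t; field; lra.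
Qed.

(** Euler's reflection formula would reduce the right side to [2 / (PI * x)]; below this is done at
    half-integers, and in the limit [s -> 0]. *)
Lemma besselY_quotient_wronskian (s x : R) :
  0 < x -> sin (s * PI) <> 0 ->
  besselJ (s + 1) x * besselY_quotient s x
  - besselJ s x * besselY_quotient (s + 1) x =
  - (2 / x) * (rgamma (s + 1) * rgamma (- s) / sin (s * PI)).
Proof.
intros hx hs; rewrite besselY_quotient_succ.
pose proof (besselJ_cross_product s x hx) as h.
transitivity (- (besselJ (s + 1) x * besselJ (- s) x
                 + besselJ s x * besselJ (- s - 1) x) / sin (s * PI)).
- unfold besselY_quotient; field; exact hs.
- rewrite h; field; lra.
Qed.

Lemma sin_nat_PI_plus (n : nat) (y : R) :
  sin (INR n * PI + y) = (-1) ^ n * sin y /\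
  cos (INR n * PI + y) = (-1) ^ n * cos y.
Proof.
induction n as [|n [IHs IHc]].
- simpl; replace (0 * PI + y) with y by ring; lra.
- rewrite S_INR.
  replace ((INR n + 1) * PI + y) with (INR n * PI + y + PI) by ring.
  rewrite neg_sin, neg_cos, IHs, IHc; simpl; lra.
Qed.

(** The case [n = 0] is the value of [rgamma (1 / 2) ^ 2]; raising the order by one changes the sign
    of both sides. *)
Lemma rgamma_reflection_half (n : nat) :
  rgamma (INR n - 1 / 2 + 1) * rgamma (- (INR n - 1 / 2)) =
  - sin ((INR n - 1 / 2) * PI) / PI.
Proof.
induction n as [|n IH].
- simpl; replace (0 - 1 / 2 + 1) with (1 / 2) by field.
  replace (- (0 - 1 / 2)) with (1 / 2) by field.
  replace ((0 - 1 / 2) * PI) with (- (PI / 2)) by field.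
  rewrite sin_neg, sin_PI2; pose proof rgamma_half; pose proof PI_RGT_0.
  replace (- -1 / PI) with (/ PI) by (field; lra); lra.
- rewrite S_INR.
  replace ((INR n + 1 - 1 / 2) * PI) with ((INR n - 1 / 2) * PI + PI) by field.
  rewrite neg_sin.
  replace (INR n + 1 - 1 / 2 + 1) with (INR n - 1 / 2 + 1 + 1) by ring.
  replace (- - sin ((INR n - 1 / 2) * PI) / PI)
    with (- (- sin ((INR n - 1 / 2) * PI) / PI))
    by (pose proof PI_RGT_0; field; lra).
  rewrite <- IH, (rgamma_rec (INR n - 1 / 2 + 1)).
  rewrite (rgamma_rec (- (INR n + 1 - 1 / 2))).
  replace (- (INR n + 1 - 1 / 2) + 1) with (- (INR n - 1 / 2)) by ring.
  field.
Qed.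

Lemma sin_half_integer (n : nat) : sin ((INR n - 1 / 2) * PI) <> 0.
Proof.
replace ((INR n - 1 / 2) * PI) with (INR n * PI + - (PI / 2)) by field.
rewrite (proj1 (sin_nat_PI_plus n _)), sin_neg, sin_PI2.
apply Rmult_integral_contrapositive; split; [apply pow_nonzero; lra|lra].
Qed.

(** L'Hopital's rule with differentiability at the single point [a]: the difference quotients
    converge separately. *)
Lemma is_lim_quotient_of_derive (f g : R -> R) (a l m : R) :
  f a = 0 -> g a = 0 -> is_derive f a l -> is_derive g a m -> m <> 0 ->
  is_lim (fun x => f x / g x) a (l / m).
Proof.
intros hf hg df dg hm.
assert (hq : forall h k, h a = 0 -> is_derive h a k ->
  is_lim (fun x => h x / (x - a)) a k).
{ intros h k h0 dh; apply is_lim_spec; intros eps.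
  apply is_derive_Reals in dh; destruct (dh eps (cond_pos eps)) as [d hd].
  exists d; intros y hy hya.
  assert (hya' : y - a <> 0) by (intros h'; apply hya, Rminus_diag_uniq, h').
  specialize (hd (y - a) hya' hy).
  rewrite Rplus_minus in hd.
  rewrite h0, Rminus_0_r in hd; exact hd. }
apply (is_lim_ext_loc (fun x => (f x / (x - a)) / (g x / (x - a)))).
- exists (mkposreal 1 Rlt_0_1); intros y _ hy.
  (* If [g y = 0], both sides are [0] by the convention for the inverse of zero. *)
  destruct (Req_dec (g y) 0) as [h0|h0].
  + rewrite h0; unfold Rdiv; rewrite Rmult_0_l, Rinv_0; ring.
  + field; split; lra.
- apply (is_lim_div (fun x => f x / (x - a)) (fun x => g x / (x - a)) a l m).
  + apply hq; assumption.
  + apply hq; assumption.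
  + intros h; injection h; exact hm.
  + reflexivity.
Qed.

(** Derivatives in the order are required at [n] and at [- n], and both orders plus one must be
    natural numbers. This admits [n = 0] and [n = 1], the seeds of the recurrence. *)
Lemma ex_lim_besselY_quotient_base (n x : R) (c : R) :
  0 < x -> c <> 0 -> sin (n * PI) = 0 -> cos (n * PI) = c ->
  besselJ n x * c = besselJ (- n) x ->
  (exists j : nat, n + 1 = INR j) -> (exists j : nat, - n + 1 = INR j) ->
  exists L : R, is_lim (fun s => besselY_quotient s x) n L.
Proof.
intros hx hc hs hcos hJ h1 h2.
destruct (is_derive_besselJ_order n x hx h1) as [l1 hl1].
destruct (is_derive_besselJ_order (- n) x hx h2) as [l2 hl2].
exists ((l1 * cos (n * PI) + besselJ n x * (- sin (n * PI) * PI) + l2)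
        / (PI * cos (n * PI))).
apply (is_lim_quotient_of_derive
  (fun s => besselJ s x * cos (s * PI) - besselJ (- s) x)
  (fun s => sin (s * PI))).
- rewrite hcos, hJ; ring.
- exact hs.
- evar_last.
  + apply is_derive_Rminus.
    * apply is_derive_Rmult;
        [exact hl1|].
      auto_derive; [exact I|reflexivity].
    * apply (is_derive_Rcomp (fun s => besselJ s x) Ropp); [exact hl2|].
      auto_derive; [exact I|reflexivity].
  + unfold minus, plus, opp; simpl; ring.
- auto_derive; [exact I|ring].
- rewrite hcos; pose proof PI_RGT_0; apply Rmult_integral_contrapositive; lra.
Qed.

Lemma is_lim_inv_succ : is_lim_seq (fun m => / (INR m + 1)) 0.
Proof.
replace (Finite 0) with (Rbar_inv p_infty) by reflexivity.
apply is_lim_seq_inv; [|discriminate].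
apply is_lim_seq_INR_plus.
Qed.

Lemma inv_succ_bounds (m : nat) : (1 <= m)%nat -> 0 < / (INR m + 1) <= 1 / 2.
Proof.
intros hm; apply le_INR in hm; simpl in hm; split.
- positivity.
- replace (1 / 2) with (/ 2) by field; apply Rinv_le_contravar; lra.
Qed.

Lemma sin_near_integer (n : nat) (e : R) :
  0 < e <= 1 / 2 -> sin ((INR n + e) * PI) <> 0.
Proof.
intros he; rewrite Rmult_plus_distr_r, (proj1 (sin_nat_PI_plus n _)).
pose proof PI_RGT_0.
apply Rmult_integral_contrapositive; split; [apply pow_nonzero; lra|].
apply Rgt_not_eq, sin_gt_0; nra.
Qed.

(** [Lim] at a finite point is by definition the limit along [n + 1 / (m + 1)], so convergence along
    this one sequence determines [besselY], and the recurrence of the quotients propagates it. *)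
Lemma is_lim_besselY_integer (n : nat) (x : R) :
  0 < x ->
  is_lim_seq (fun m => besselY_quotient (INR n + / (INR m + 1)) x)
    (besselY (INR n) x).
Proof.
intros hx.
assert (hsin : sin (INR n * PI) = 0).
{ rewrite <- (Rplus_0_r (INR n * PI)), (proj1 (sin_nat_PI_plus n 0)), sin_0; ring. }
enough (hL : exists L : R,
  is_lim_seq (fun m => besselY_quotient (INR n + / (INR m + 1)) x) L).
{ unfold besselY; destruct (Req_EM_T (sin (INR n * PI)) 0) as [_|h];
    [|contradiction].
  apply (Lim_seq_correct' (fun m => besselY_quotient (INR n + / (INR m + 1)) x)).
  destruct hL as [L hL]; exists L; exact hL. }
assert (hseq : forall k L : R, is_lim (fun s => besselY_quotient s x) k L ->
  is_lim_seq (fun m => besselY_quotient (k + / (INR m + 1)) x) L).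
{ intros k L hk.
  apply (is_lim_comp_seq (fun s => besselY_quotient s x) _ k L hk).
  - exists 1%nat; intros m hm h; injection h as h.
    pose proof (inv_succ_bounds m hm); lra.
  - replace (Finite k) with (Finite (k + 0)) by (f_equal; ring).
    apply is_lim_seq_plus'; [apply is_lim_seq_const|apply is_lim_inv_succ]. }
clear hsin.
(* Two consecutive orders are carried through the induction because the recurrence has three
   terms. *)
enough (h : (exists L : R,
    is_lim_seq (fun m => besselY_quotient (INR n + / (INR m + 1)) x) L) /\
  (exists L : R,
    is_lim_seq (fun m => besselY_quotient (INR (S n) + / (INR m + 1)) x) L))
  by apply h.
induction n as [|n [[L0 h0] [L1 h1]]].
- split.
  + destruct (ex_lim_besselY_quotient_base 0 x 1) as [L hL]; try lra.
    * rewrite Rmult_0_l; apply sin_0.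
    * rewrite Rmult_0_l; apply cos_0.
    * rewrite Ropp_0; ring.
    * exists 1%nat; simpl; ring.
    * exists 1%nat; simpl; ring.
    * exists L; apply hseq, hL.
  + destruct (ex_lim_besselY_quotient_base 1 x (-1)) as [L hL]; try lra.
    * rewrite Rmult_1_l; apply sin_PI.
    * rewrite Rmult_1_l; apply cos_PI.
    * rewrite besselJ_opp_one by exact hx; ring.
    * exists 2%nat; simpl; ring.
    * exists 0%nat; simpl; ring.
    * exists L; apply hseq, hL.
- split; [exists L1; exact h1|].
  exists (2 * (INR n + 0 + 1) / x * L1 - L0).
  apply is_lim_seq_ext_loc with (fun m =>
    2 * (INR n + / (INR m + 1) + 1) * / x
      * besselY_quotient (INR (S n) + / (INR m + 1)) x
    - besselY_quotient (INR n + / (INR m + 1)) x).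
  + exists 1%nat; intros m hm.
    pose proof (besselY_quotient_rec (INR n + / (INR m + 1)) x hx
      (sin_near_integer n _ (inv_succ_bounds m hm))) as hr.
    rewrite !S_INR.
    replace (INR n + 1 + / (INR m + 1)) with (INR n + / (INR m + 1) + 1) by ring.
    replace (INR n + 1 + 1 + / (INR m + 1))
      with (INR n + / (INR m + 1) + 1 + 1) by ring.
    unfold Rdiv in hr; lra.
  + apply is_lim_seq_minus'; [|exact h0].
    apply is_lim_seq_mult'; [|exact h1].
    apply is_lim_seq_mult'; [|apply is_lim_seq_const].
    apply is_lim_seq_mult'; [apply is_lim_seq_const|].
    apply is_lim_seq_plus'; [|apply is_lim_seq_const].
    apply is_lim_seq_plus'; [apply is_lim_seq_const|apply is_lim_inv_succ].
Qed.

Lemma besselY_integer_rec (n : nat) (x : R) :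
  0 < x ->
  besselY (INR n) x + besselY (INR n + 1 + 1) x =
  2 * (INR n + 1) / x * besselY (INR n + 1) x.
Proof.
intros hx.
pose proof (is_lim_besselY_integer n x hx) as h0.
pose proof (is_lim_besselY_integer (S n) x hx) as h1.
pose proof (is_lim_besselY_integer (S (S n)) x hx) as h2.
rewrite !S_INR in *.
assert (ha : is_lim_seq (fun m => besselY_quotient (INR n + / (INR m + 1)) x
  + besselY_quotient (INR n + 1 + 1 + / (INR m + 1)) x)
  (besselY (INR n) x + besselY (INR n + 1 + 1) x))
  by (apply is_lim_seq_plus'; assumption).
assert (hb : is_lim_seq (fun m => besselY_quotient (INR n + / (INR m + 1)) x
  + besselY_quotient (INR n + 1 + 1 + / (INR m + 1)) x)
  (2 * (INR n + 0 + 1) * / x * besselY (INR n + 1) x)).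
{ apply is_lim_seq_ext_loc with (fun m =>
    2 * (INR n + / (INR m + 1) + 1) * / x
      * besselY_quotient (INR n + 1 + / (INR m + 1)) x).
  - exists 1%nat; intros m hm.
    pose proof (besselY_quotient_rec (INR n + / (INR m + 1)) x hx
      (sin_near_integer n _ (inv_succ_bounds m hm))) as hr.
    replace (INR n + 1 + / (INR m + 1)) with (INR n + / (INR m + 1) + 1) by ring.
    replace (INR n + 1 + 1 + / (INR m + 1))
      with (INR n + / (INR m + 1) + 1 + 1) by ring.
    unfold Rdiv in hr; lra.
  - apply is_lim_seq_mult'; [|exact h1].
    apply is_lim_seq_mult'; [|apply is_lim_seq_const].
    apply is_lim_seq_mult'; [apply is_lim_seq_const|].
    apply is_lim_seq_plus'; [|apply is_lim_seq_const].
    apply is_lim_seq_plus'; [apply is_lim_seq_const|apply is_lim_inv_succ]. }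
apply is_lim_seq_unique in ha; apply is_lim_seq_unique in hb.
rewrite ha in hb; injection hb as hb; rewrite hb; unfold Rdiv; ring.
Qed.

(** Along [e -> 0] the constant is [rgamma (1 + e) * rgamma (1 - e) * (e / sin (e * PI))], since
    [rgamma (- e) = - e * rgamma (1 - e)]; it tends to [1 / PI]. *)
Lemma besselY_wronskian_zero (x : R) :
  0 < x ->
  besselJ 1 x * besselY 0 x - besselJ 0 x * besselY 1 x = 2 / (PI * x).
Proof.
intros hx; pose proof PI_RGT_0 as hpi.
assert (hJ : forall k l, (exists j : nat, k + 1 = INR j) -> l = k ->
  is_lim_seq (fun m => besselJ (k + / (INR m + 1)) x) (besselJ l x)).
{ intros k l hk ->.
  apply (is_lim_seq_continuous (fun s => besselJ s x)
           (fun m => k + / (INR m + 1))).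
  - destruct (is_derive_besselJ_order k x hx hk) as [l' hl'].
    apply (is_derive_continuity (fun s => besselJ s x) k l' hl').
  - replace (Finite k) with (Finite (k + 0)) by (f_equal; ring).
    apply is_lim_seq_plus'; [apply is_lim_seq_const|apply is_lim_inv_succ]. }
pose proof (is_lim_besselY_integer 0 x hx) as h0.
pose proof (is_lim_besselY_integer 1 x hx) as h1.
simpl INR in h0, h1.
assert (ha : is_lim_seq (fun m =>
   besselJ (1 + / (INR m + 1)) x * besselY_quotient (0 + / (INR m + 1)) x
   - besselJ (0 + / (INR m + 1)) x * besselY_quotient (1 + / (INR m + 1)) x)
   (besselJ 1 x * besselY 0 x - besselJ 0 x * besselY 1 x)).
{ apply is_lim_seq_minus'; apply is_lim_seq_mult'; try assumption;
    apply hJ; try reflexivity; [exists 2%nat|exists 1%nat]; simpl; ring. }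
destruct rgamma_one_quadratic as [g hg].
assert (hgc : continuity_pt rgamma 1).
{ apply (is_derive_continuity rgamma 1 g).
  apply (is_derive_of_quadratic_bound rgamma 1 g (9 / 4) (1 / 2)); [lra|].
  intros e he; rewrite rgamma_1; apply hg, he. }
assert (hr1 : forall u, is_lim_seq u 1 -> is_lim_seq (fun m => rgamma (u m)) 1).
{ intros u hu; pose proof (is_lim_seq_continuous rgamma u 1 hgc hu) as h.
  rewrite rgamma_1 in h; exact h. }
assert (hb : is_lim_seq (fun m =>
   besselJ (1 + / (INR m + 1)) x * besselY_quotient (0 + / (INR m + 1)) x
   - besselJ (0 + / (INR m + 1)) x * besselY_quotient (1 + / (INR m + 1)) x)
   (2 / x * (1 * 1 * / (PI * 1)))).
{ apply is_lim_seq_ext_loc with (fun m =>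
    2 / x * (rgamma (1 + / (INR m + 1)) * rgamma (1 - / (INR m + 1))
             * (/ (INR m + 1) / sin (/ (INR m + 1) * PI)))).
  - exists 1%nat; intros m hm.
    set (e := / (INR m + 1)).
    pose proof (sin_near_integer 0 e (inv_succ_bounds m hm)) as hs.
    simpl INR in hs; rewrite Rplus_0_l in *.
    rewrite (Rplus_comm 1 e), (besselY_quotient_wronskian e x hx hs).
    rewrite (rgamma_rec (- e)).
    replace (- e + 1) with (1 - e) by ring.
    field; split; lra.
  - assert (hsinc : is_lim (fun s => s / sin (s * PI)) 0 (1 / (PI * 1))).
    { apply (is_lim_quotient_of_derive (fun s => s) (fun s => sin (s * PI))).
      - reflexivity.
      - rewrite Rmult_0_l; apply sin_0.
      - apply (is_derive_id (K := R_AbsRing)).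
      - auto_derive; [exact I|rewrite Rmult_0_l, cos_0; ring].
      - lra. }
    apply is_lim_seq_mult'; [apply is_lim_seq_const|].
    apply is_lim_seq_mult'; [apply is_lim_seq_mult'|].
    + apply hr1.
      replace (Finite 1) with (Finite (1 + 0)) by (f_equal; ring).
      apply is_lim_seq_plus'; [apply is_lim_seq_const|apply is_lim_inv_succ].
    + apply hr1.
      replace (Finite 1) with (Finite (1 - 0)) by (f_equal; ring).
      apply is_lim_seq_minus'; [apply is_lim_seq_const|apply is_lim_inv_succ].
    + replace (/ (PI * 1)) with (1 / (PI * 1)) by (field; lra).
      apply (is_lim_comp_seq (fun s => s / sin (s * PI)) _ 0 _ hsinc).
      * exists 1%nat; intros m hm h; injection h as h.
        pose proof (inv_succ_bounds m hm); lra.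
      * apply is_lim_inv_succ. }
apply is_lim_seq_unique in ha; apply is_lim_seq_unique in hb.
rewrite ha in hb; injection hb as hb; rewrite hb; field; lra.
Qed.

(** * The first-order Bessel system and its stability under limits of the order *)

(** A uniform bound on second derivatives gives the remainder [M * e ^ 2] by two uses of the mean
    value theorem, and that inequality passes to the limit. The derivatives [h m] need to converge
    only at [x]. *)
Lemma is_derive_of_pointwise_limit (f h h' : nat -> R -> R) (F : R -> R)
    (x l r M : R) :
  0 < r ->
  (forall y, Rabs (y - x) <= r -> is_lim_seq (fun m => f m y) (F y)) ->
  is_lim_seq (fun m => h m x) l ->
  eventually (fun m => forall y, Rabs (y - x) <= r ->
    is_derive (f m) y (h m y) /\ is_derive (h m) y (h' m y) /\
    Rabs (h' m y) <= M) ->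
  is_derive F x l.
Proof.
intros hr hf hl [N hN].
apply (is_derive_of_quadratic_bound F x l M r hr); intros e he.
assert (hlim : is_lim_seq (fun m => Rabs (f m (x + e) - f m x - h m x * e))
                 (Rabs (F (x + e) - F x - l * e))).
{ apply (is_lim_seq_abs _ (Finite (F (x + e) - F x - l * e))).
  apply is_lim_seq_minus'; [apply is_lim_seq_minus'|].
  - apply hf; replace (x + e - x) with e by ring; exact he.
  - apply hf; rewrite Rminus_diag, Rabs_R0; lra.
  - apply is_lim_seq_mult'; [exact hl|apply is_lim_seq_const]. }
refine (is_lim_seq_le_loc _ (fun _ => M * e ^ 2) (Finite _) (M * e ^ 2) _ hlim
          (is_lim_seq_const _)).
exists N; intros m hm; specialize (hN m hm).
assert (hin : forall y, Rmin x (x + e) <= y <= Rmax x (x + e) ->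
  Rabs (y - x) <= Rabs e).
{ intros y; unfold Rmin, Rmax; destruct (Rle_dec x (x + e)); intros hy.
  - rewrite !Rabs_right by lra; lra.
  - rewrite !Rabs_left1 by lra; lra. }
destruct (MVT_gen (f m) x (x + e) (h m)) as [c [hc heq]].
- intros y hy; apply hN; apply Rle_trans with (2 := he); apply hin; lra.
- intros y hy; apply (is_derive_continuity _ _ (h m y)), hN.
  apply Rle_trans with (2 := he); apply hin; lra.
- pose proof (hin c hc) as hcx.
  destruct (MVT_gen (h m) x c (h' m)) as [c' [hc' heq']].
  + intros y hy; apply hN; apply Rle_trans with (2 := he).
    apply hin; revert hy hc; unfold Rmin, Rmax; repeat destruct Rle_dec; lra.
  + intros y hy; apply (is_derive_continuity _ _ (h' m y)), hN.
    apply Rle_trans with (2 := he).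
    apply hin; revert hy hc; unfold Rmin, Rmax; repeat destruct Rle_dec; lra.
  + assert (hM : Rabs (h' m c') <= M).
    { apply hN; apply Rle_trans with (2 := he).
      apply hin; revert hc' hc; unfold Rmin, Rmax; repeat destruct Rle_dec; lra. }
    rewrite heq.
    replace (h m c * (x + e - x) - h m x * e) with (h' m c' * (c - x) * e)
      by (rewrite <- heq'; ring).
    rewrite !Rabs_mult, <- (pow2_abs e).
    pose proof (Rabs_pos (h' m c')); pose proof (Rabs_pos (c - x)).
    pose proof (Rabs_pos e).
    replace (M * Rabs e ^ 2) with (M * Rabs e * Rabs e) by ring.
    apply Rmult_le_compat_r; [assumption|].
    apply Rmult_le_compat; assumption.
Qed.

(** The two derivative recurrences of [(Z_s, Z_(s+1))]: Bessel's equation in a form shared by [J],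
    [Y] and the quotients. *)
Definition bessel_system (s : R) (u v : R -> R) : Prop :=
  forall x, 0 < x ->
    is_derive u x (s / x * u x - v x) /\
    is_derive v x (u x - (s + 1) / x * v x).

(** The cross terms cancel in the derivative of [E = u ^ 2 + v ^ 2], and for [0 <= s <= 1] it lies
    between [- 4 * E / y] and [4 * E / y]. Hence [E * y ^ 4] increases and [E / y ^ 4] decreases;
    [16 = 2 ^ 4] since [y] and [x] differ by a factor at most [2]. *)
Lemma bessel_system_energy (s : R) (u v : R -> R) (x y : R) :
  0 <= s <= 1 -> bessel_system s u v -> 0 < x -> x / 2 <= y <= 3 / 2 * x ->
  u y ^ 2 + v y ^ 2 <= 16 * (u x ^ 2 + v x ^ 2).
Proof.
intros hs huv hx hy.
set (E := fun y => u y ^ 2 + v y ^ 2).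
set (E' := fun y => 2 * (s * u y ^ 2 - (s + 1) * v y ^ 2) / y).
assert (hE : forall y, 0 < y -> is_derive E y (E' y)).
{ intros z hz; destruct (huv z hz) as [hu hv]; unfold E.
  apply (is_derive_ext (fun y => u y * u y + v y * v y)).
  { intros; simpl; ring. }
  evar_last.
  - apply is_derive_Rplus.
    + apply is_derive_Rmult; exact hu.
    + apply is_derive_Rmult; exact hv.
  - unfold E'; field; lra. }
assert (hE0 : forall z, 0 <= E z)
  by (intros z; unfold E; pose proof (pow2_ge_0 (u z));
      pose proof (pow2_ge_0 (v z)); lra).
change (E y <= 16 * E x).
destruct (Rle_dec y x) as [h|h].
- assert (hm : E y * y ^ 4 <= E x * x ^ 4).
  { apply (nondecreasing_of_derive (fun z => E z * z ^ 4)
      (fun z => E' z * z ^ 4 + E z * (4 * z ^ 3))); [exact h| |].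
    - intros z hz; apply is_derive_Rmult;
        [apply hE; lra|].
      auto_derive; [exact I|simpl; ring].
    - intros z hz.
      replace (E' z * z ^ 4 + E z * (4 * z ^ 3))
        with ((2 * (s + 2) * u z ^ 2 + 2 * (1 - s) * v z ^ 2) * z ^ 3)
        by (unfold E', E; field; lra).
      pose proof (pow2_ge_0 (u z)); pose proof (pow2_ge_0 (v z)).
      apply Rmult_le_pos; [nra|positivity]. }
  assert (h4 : x ^ 4 <= 16 * y ^ 4).
  { replace (16 * y ^ 4) with ((2 * y) ^ 4) by ring; apply pow_incr; lra. }
  assert (hy4 : 0 < y ^ 4) by positivity.
  pose proof (hE0 x).
  apply Rmult_le_reg_r with (y ^ 4); [exact hy4|]; nra.
- assert (hm : E y * / y ^ 4 <= E x * / x ^ 4).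
  { apply (nonincreasing_of_derive (fun z => E z * / z ^ 4)
      (fun z => E' z * / z ^ 4 + E z * (- 4 / z ^ 5))); [lra| |].
    - intros z hz; apply (is_derive_Rmult E (fun z => / z ^ 4));
        [apply hE; lra|].
      assert (hz0 : 0 < z) by lra.
      auto_derive; [positivity|].
      simpl; field; lra.
    - intros z hz.
      replace (E' z * / z ^ 4 + E z * (- 4 / z ^ 5))
        with (- ((2 * (2 - s) * u z ^ 2 + 2 * (s + 3) * v z ^ 2) * / z ^ 5))
        by (unfold E', E; field; lra).
      pose proof (pow2_ge_0 (u z)); pose proof (pow2_ge_0 (v z)).
      assert (0 <= (2 * (2 - s) * u z ^ 2 + 2 * (s + 3) * v z ^ 2) * / z ^ 5).
      { apply Rmult_le_pos; [nra|].
        positivity. }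
      lra. }
  assert (h4 : y ^ 4 <= 16 * x ^ 4).
  { replace (16 * x ^ 4) with ((2 * x) ^ 4) by ring; apply pow_incr; lra. }
  assert (hy4 : 0 < y ^ 4) by positivity.
  assert (hx4 : 0 < x ^ 4) by positivity.
  pose proof (hE0 x).
  assert (h1 : E y <= E x * / x ^ 4 * y ^ 4).
  { apply Rmult_le_reg_r with (/ y ^ 4); [positivity|].
    rewrite (Rmult_assoc _ (y ^ 4)), Rinv_r, Rmult_1_r by lra; exact hm. }
  apply Rle_trans with (1 := h1).
  rewrite Rmult_assoc, (Rmult_comm 16); apply Rmult_le_compat_l; [apply hE0|].
  apply Rmult_le_reg_l with (x ^ 4); [exact hx4|].
  rewrite <- Rmult_assoc, Rinv_r, Rmult_1_l by lra; lra.
Qed.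

Lemma bessel_system_second_derivatives (s : R) (u v : R -> R) (x : R) :
  0 < x -> bessel_system s u v ->
  is_derive (fun y => s / y * u y - v y) x
    (- s / x ^ 2 * u x + s / x * (s / x * u x - v x)
     - (u x - (s + 1) / x * v x)) /\
  is_derive (fun y => u y - (s + 1) / y * v y) x
    (s / x * u x - v x
     - (- (s + 1) / x ^ 2 * v x + (s + 1) / x * (u x - (s + 1) / x * v x))).
Proof.
intros hx huv; destruct (huv x hx) as [hu hv].
assert (hq : forall c, is_derive (fun y => c / y) x (- c / x ^ 2)).
{ intros c; auto_derive; [lra|field; lra]. }
split.
- apply is_derive_Rminus;
    [|exact hv].
  apply is_derive_Rmult; [apply hq|exact hu].
- apply is_derive_Rminus;
    [exact hu|].
  apply is_derive_Rmult; [apply hq|exact hv].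
Qed.

Lemma Rabs_le_of_sqr_sum (a b B : R) :
  a ^ 2 + b ^ 2 <= B -> Rabs a <= 1 + B /\ Rabs b <= 1 + B.
Proof.
intros h; pose proof (pow2_ge_0 a); pose proof (pow2_ge_0 b).
split; apply Rabs_le; split; nra.
Qed.

(** Convergence at [x] bounds the energy there, [bessel_system_energy] spreads the bound over a
    neighbourhood, and the system turns it into the bound on second derivatives that
    [is_derive_of_pointwise_limit] asks for. *)
Lemma bessel_system_limit (s : nat -> R) (u v : nat -> R -> R) (U V : R -> R) :
  is_lim_seq s 0 ->
  eventually (fun m => 0 <= s m <= 1 /\ bessel_system (s m) (u m) (v m)) ->
  (forall x, 0 < x -> is_lim_seq (fun m => u m x) (U x)) ->
  (forall x, 0 < x -> is_lim_seq (fun m => v m x) (V x)) ->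
  bessel_system 0 U V.
Proof.
intros hs hsys hu hv x hx.
pose proof (hu x hx) as hux; pose proof (hv x hx) as hvx.
set (B := U x ^ 2 + V x ^ 2 + 1).
assert (hB : eventually (fun m => u m x ^ 2 + v m x ^ 2 < B)).
{ assert (hl : is_lim_seq (fun m => u m x ^ 2 + v m x ^ 2) (U x ^ 2 + V x ^ 2)).
  { simpl; apply is_lim_seq_plus'; repeat apply is_lim_seq_mult';
      try assumption; apply is_lim_seq_const. }
  apply is_lim_seq_spec in hl; destruct (hl (mkposreal 1 Rlt_0_1)) as [N hN].
  exists N; intros m hm; specialize (hN m hm); simpl in hN.
  apply Rabs_lt_between in hN; unfold B; simpl; lra. }
(* For [Rabs (y - x) <= x / 2], [C] bounds both components, through [Rabs a <= 1 + a ^ 2], and [Q]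
   bounds [/ y]. *)
set (C := 1 + 16 * B); set (Q := 2 / x).
assert (hQ : 0 <= Q) by (left; apply Rdiv_lt_0_compat; lra).
assert (hev : eventually (fun m => 0 <= s m <= 1 /\
  bessel_system (s m) (u m) (v m) /\
  forall y, Rabs (y - x) <= x / 2 ->
    0 < / y <= Q /\ Rabs (u m y) <= C /\ Rabs (v m y) <= C)).
{ destruct hB as [N1 hN1]; destruct hsys as [N2 hN2].
  exists (N1 + N2)%nat; intros m hm.
  assert (hm1 : (N1 <= m)%nat) by lia; assert (hm2 : (N2 <= m)%nat) by lia.
  specialize (hN1 m hm1); destruct (hN2 m hm2) as [h1 h2].
  split; [exact h1|split; [exact h2|]].
  intros y hy; apply Rabs_le_between in hy.
  split.
  - split; [positivity|].
    unfold Q; replace (2 / x) with (/ (x / 2)) by (field; lra).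
    apply Rinv_le_contravar; lra.
  - apply Rabs_le_of_sqr_sum.
    apply Rle_trans with (16 * (u m x ^ 2 + v m x ^ 2)); [|lra].
    apply (bessel_system_energy (s m)); try assumption; lra. }
assert (hC : 0 <= C).
{ unfold C, B; pose proof (pow2_ge_0 (U x)); pose proof (pow2_ge_0 (V x)); lra. }
set (u' := fun m y => s m / y * u m y - v m y).
set (v' := fun m y => u m y - (s m + 1) / y * v m y).
set (u'' := fun m y => - s m / y ^ 2 * u m y + s m / y * u' m y - v' m y).
set (v'' := fun m y =>
  u' m y - (- (s m + 1) / y ^ 2 * v m y + (s m + 1) / y * v' m y)).
set (K := C + 2 * Q * C).
set (M := Q ^ 2 * C + Q * K + K + 2 * Q ^ 2 * C + 2 * Q * K).
assert (hbound : forall m y, 0 <= s m <= 1 -> 0 < / y <= Q ->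
  Rabs (u m y) <= C -> Rabs (v m y) <= C ->
  Rabs (u'' m y) <= M /\ Rabs (v'' m y) <= M).
{ intros m y h1 h2 h3 h4.
  assert (hsy : Rabs (s m / y) <= Q).
  { unfold Rdiv; rewrite Rabs_mult, !Rabs_right by lra; nra. }
  assert (hs1y : Rabs ((s m + 1) / y) <= 2 * Q).
  { unfold Rdiv; rewrite Rabs_mult, !Rabs_right by lra; nra. }
  assert (hy2 : 0 <= / y ^ 2 <= Q ^ 2).
  { rewrite <- pow_inv; split; [positivity|apply pow_incr; lra]. }
  assert (hsy2 : Rabs (- s m / y ^ 2) <= Q ^ 2).
  { unfold Rdiv; rewrite Rabs_mult, Rabs_Ropp, !Rabs_right by lra; nra. }
  assert (hs1y2 : Rabs (- (s m + 1) / y ^ 2) <= 2 * Q ^ 2).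
  { unfold Rdiv; rewrite Rabs_mult, Rabs_Ropp, !Rabs_right by lra; nra. }
  assert (hmul : forall a b A B', Rabs a <= A -> Rabs b <= B' ->
    Rabs (a * b) <= A * B').
  { intros a b A B' ha hb; rewrite Rabs_mult.
    apply Rmult_le_compat; auto using Rabs_pos. }
  assert (hadd : forall a b A B', Rabs a <= A -> Rabs b <= B' ->
    Rabs (a + b) <= A + B').
  { intros a b A B' ha hb; eapply Rle_trans; [apply Rabs_triang|lra]. }
  assert (hsub : forall a b A B', Rabs a <= A -> Rabs b <= B' ->
    Rabs (a - b) <= A + B').
  { intros a b A B' ha hb; apply hadd; [exact ha|rewrite Rabs_Ropp; exact hb]. }
  assert (hQ2 : 0 <= Q ^ 2 * C) by positivity.
  assert (hQC : 0 <= Q * C) by positivity.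
  assert (hK1 : Rabs (u' m y) <= K).
  { eapply Rle_trans; [apply hsub; [apply hmul; eassumption|eassumption]|].
    unfold K; lra. }
  assert (hK2 : Rabs (v' m y) <= K).
  { eapply Rle_trans; [apply hsub; [eassumption|apply hmul; eassumption]|].
    unfold K; lra. }
  assert (hK : 0 <= K) by (unfold K; lra).
  assert (hQK : 0 <= Q * K) by positivity.
  split.
  - eapply Rle_trans.
    + apply hsub; [apply hadd; apply hmul; eassumption|eassumption].
    + unfold M; lra.
  - eapply Rle_trans.
    + apply hsub; [eassumption|apply hadd; apply hmul; eassumption].
    + unfold M; lra. }
assert (hlim : forall (f f' f'' : nat -> R -> R) (F : R -> R) (l : R),
  (forall y, 0 < y -> is_lim_seq (fun m => f m y) (F y)) ->
  is_lim_seq (fun m => f' m x) l ->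
  (forall m y, 0 < y -> bessel_system (s m) (u m) (v m) ->
     is_derive (f m) y (f' m y) /\ is_derive (f' m) y (f'' m y)) ->
  (forall m y, Rabs (u'' m y) <= M /\ Rabs (v'' m y) <= M ->
     Rabs (f'' m y) <= M) ->
  is_derive F x l).
{ intros f f' f'' F l hf hf' hd hM.
  apply (is_derive_of_pointwise_limit f f' f'' F x l (x / 2) M); [lra| |exact hf'|].
  - intros y hy; apply Rabs_le_between in hy; apply hf; lra.
  - destruct hev as [N hN]; exists N; intros m hm y hy.
    destruct (hN m hm) as [h1 [h2 h3]]; destruct (h3 y hy) as [h4 [h5 h6]].
    assert (hy0 : 0 < y) by (apply Rabs_le_between in hy; lra).
    split; [apply hd; assumption|split; [apply hd; assumption|]].
    apply hM, hbound; assumption. }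
split.
- apply (hlim u u' u'' U); [exact hu| | |intros m y h; apply h].
  + apply is_lim_seq_minus'; [|exact hvx].
    apply is_lim_seq_mult'; [|exact hux].
    apply is_lim_seq_mult'; [exact hs|apply is_lim_seq_const].
  + intros m y hy h; split; [apply (h y hy)|].
    apply (bessel_system_second_derivatives (s m) (u m) (v m) y hy h).
- apply (hlim v v' v'' V); [exact hv| | |intros m y h; apply h].
  + apply is_lim_seq_minus'; [exact hux|].
    apply is_lim_seq_mult'; [|exact hvx].
    apply is_lim_seq_mult'; [|apply is_lim_seq_const].
    apply is_lim_seq_plus'; [exact hs|apply is_lim_seq_const].
  + intros m y hy h; split; [apply (h y hy)|].
    apply (bessel_system_second_derivatives (s m) (u m) (v m) y hy h).
Qed.

Lemma bessel_system_J (s : R) : bessel_system s (besselJ s) (besselJ (s + 1)).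
Proof.
intros x hx; split; [apply is_derive_besselJ|apply is_derive_besselJ_succ];
  exact hx.
Qed.

Lemma bessel_system_Y_zero : bessel_system 0 (besselY 0) (besselY 1).
Proof.
apply (bessel_system_limit (fun m => / (INR m + 1))
  (fun m => besselY_quotient (/ (INR m + 1)))
  (fun m => besselY_quotient (1 + / (INR m + 1)))).
- apply is_lim_inv_succ.
- exists 1%nat; intros m hm; pose proof (inv_succ_bounds m hm) as he.
  split; [lra|]; intros x hx.
  pose proof (sin_near_integer 0 _ he) as hs; simpl INR in hs.
  rewrite Rplus_0_l in hs; rewrite (Rplus_comm 1).
  split; [apply is_derive_besselY_quotient
         |apply is_derive_besselY_quotient_succ]; assumption.
- intros x hx; pose proof (is_lim_besselY_integer 0 x hx) as h; simpl INR in h.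
  apply (is_lim_seq_ext _ _ _ (fun m => f_equal (fun s => besselY_quotient s x)
           (Rplus_0_l (/ (INR m + 1)))) h).
- intros x hx; apply (is_lim_besselY_integer 1 x hx).
Qed.

Lemma bessel_system_succ (s : R) (u v w : R -> R) :
  bessel_system s u v ->
  (forall x, 0 < x -> u x + w x = 2 * (s + 1) / x * v x) ->
  bessel_system (s + 1) v w.
Proof.
intros huv hrec x hx; destruct (huv x hx) as [hu hv].
assert (hw : w x = 2 * (s + 1) / x * v x - u x) by (pose proof (hrec x hx); lra).
split.
- rewrite hw; replace ((s + 1) / x * v x - (2 * (s + 1) / x * v x - u x))
    with (u x - (s + 1) / x * v x) by (field; lra); exact hv.
- apply (is_derive_ext_loc (fun x => 2 * (s + 1) / x * v x - u x)).
  { exists (mkposreal x hx); intros y hy.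
    unfold ball in hy; simpl in hy; unfold AbsRing_ball, abs, minus, plus, opp in hy;
      simpl in hy; apply Rabs_lt_between in hy.
    assert (hy0 : 0 < y) by lra; pose proof (hrec y hy0).
    apply Rminus_diag_uniq; lra. }
  evar_last.
  + apply is_derive_Rminus;
      [|exact hu].
    apply is_derive_Rmult; [|exact hv].
    auto_derive; [lra|reflexivity].
  + rewrite hw; field; lra.
Qed.

Lemma bessel_system_Y_integer (n : nat) :
  bessel_system (INR n) (besselY (INR n)) (besselY (INR n + 1)) /\
  forall x, 0 < x ->
    besselJ (INR n + 1) x * besselY (INR n) x
    - besselJ (INR n) x * besselY (INR n + 1) x = 2 / (PI * x).
Proof.
induction n as [|n [IH1 IH2]].
- simpl INR; rewrite Rplus_0_l; split.
  + apply bessel_system_Y_zero.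
  + apply besselY_wronskian_zero.
- rewrite S_INR; split.
  + apply (bessel_system_succ (INR n) (besselY (INR n))); [exact IH1|].
    intros x hx; apply besselY_integer_rec, hx.
  + intros x hx; rewrite <- (IH2 x hx).
    pose proof (besselY_integer_rec n x hx) as hY.
    pose proof (besselJ_rec (INR n + 1) x hx) as hJ.
    replace (INR n + 1 - 1) with (INR n) in hJ by ring.
    replace (besselY (INR n) x)
      with (2 * (INR n + 1) / x * besselY (INR n + 1) x
            - besselY (INR n + 1 + 1) x) by lra.
    replace (besselJ (INR n) x)
      with (2 * (INR n + 1) / x * besselJ (INR n + 1) x
            - besselJ (INR n + 1 + 1) x) by lra.
    ring.
Qed.

Lemma besselY_nonint (s x : R) :
  sin (s * PI) <> 0 -> besselY s x = besselY_quotient s x.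
Proof.
intros hs; unfold besselY; destruct (Req_EM_T (sin (s * PI)) 0);
  [contradiction|reflexivity].
Qed.

Lemma bessel_system_ext (s : R) (u v u' v' : R -> R) :
  (forall x, u x = u' x) -> (forall x, v x = v' x) ->
  bessel_system s u v -> bessel_system s u' v'.
Proof.
intros hu hv h x hx; destruct (h x hx) as [h1 h2].
rewrite <- hu, <- hv; split.
- apply (is_derive_ext u); assumption.
- apply (is_derive_ext v); assumption.
Qed.

Lemma bessel_system_Y_half (n : nat) :
  let s := INR n - 1 / 2 in
  bessel_system s (besselY s) (besselY (s + 1)) /\
  forall x, 0 < x ->
    besselJ (s + 1) x * besselY s x - besselJ s x * besselY (s + 1) x
    = 2 / (PI * x).
Proof.
intros s.
assert (hs : sin (s * PI) <> 0) by apply sin_half_integer.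
assert (hs' : sin ((s + 1) * PI) <> 0).
{ unfold s; replace (INR n - 1 / 2 + 1) with (INR (S n) - 1 / 2)
    by (rewrite S_INR; ring); apply sin_half_integer. }
split.
- apply (bessel_system_ext s (besselY_quotient s) (besselY_quotient (s + 1))).
  + intros x; rewrite besselY_nonint by exact hs; reflexivity.
  + intros x; rewrite besselY_nonint by exact hs'; reflexivity.
  + intros x hx; split; [apply is_derive_besselY_quotient
      |apply is_derive_besselY_quotient_succ]; assumption.
- intros x hx; rewrite !besselY_nonint by assumption.
  rewrite besselY_quotient_wronskian by assumption.
  unfold s in *; rewrite rgamma_reflection_half.
  pose proof PI_RGT_0; field; repeat split; lra.
Qed.

(** The order is an integer for even [d] and a half-integer for odd [d], so the two preceding cases
    exhaust it. *)
Lemma bessel_system_Y_order (d l : nat) :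
  (2 <= d)%nat ->
  let s := INR l + nu d in
  bessel_system s (besselY s) (besselY (s + 1)) /\
  forall x, 0 < x ->
    besselJ (s + 1) x * besselY s x - besselJ s x * besselY (s + 1) x
    = 2 / (PI * x).
Proof.
intros hd s; unfold s, nu.
destruct (Nat.Even_or_Odd d) as [[p hp]|[p hp]].
- destruct p as [|p]; [lia|].
  replace (INR l + (INR d / 2 - 1)) with (INR (l + p))
    by (rewrite hp, mult_INR, plus_INR, (S_INR p); simpl (INR 2); field).
  apply bessel_system_Y_integer.
- replace (INR l + (INR d / 2 - 1)) with (INR (l + p) - 1 / 2)
    by (rewrite hp, !plus_INR, mult_INR; simpl; field).
  apply bessel_system_Y_half.
Qed.

(** * Sturm comparison *)

(** The zero is the supremum of the points up to which [f] is positive. *)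
Lemma first_zero (f : R -> R) (a b : R) :
  a <= b -> (forall x, a <= x <= b -> continuity_pt f x) ->
  0 < f a -> f b <= 0 ->
  exists c, a < c <= b /\ f c = 0 /\ forall x, a <= x < c -> 0 < f x.
Proof.
intros hab hf ha hb.
set (S := fun x => a <= x <= b /\ forall t, a <= t <= x -> 0 < f t).
assert (hSa : S a).
{ split; [lra|]; intros t ht; replace t with a by lra; exact ha. }
destruct (completeness S) as [c [hub hlub]].
- exists b; intros x hx; apply hx.
- exists a; exact hSa.
- assert (hac : a <= c) by (apply hub, hSa).
  assert (hcb : c <= b) by (apply hlub; intros x hx; apply hx).
  assert (hpos : forall x, a <= x < c -> 0 < f x).
  { intros x hx; destruct (Rlt_dec 0 (f x)) as [h|h]; [exact h|exfalso].
    assert (hcx : c <= x); [|lra].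
    apply hlub; intros y [hy1 hy2]; destruct (Rle_dec y x) as [h'|h']; [exact h'|].
    exfalso; apply h, hy2; lra. }
  assert (hloc : forall eps : posreal, exists d : posreal,
    forall y, Rabs (y - c) < d -> Rabs (f y - f c) < eps).
  { intros eps; destruct (proj1 (continuity_pt_locally f c)
      (hf c (conj hac hcb)) eps) as [d hd]; exists d; exact hd. }
  assert (hge : 0 <= f c).
  { destruct (Rle_dec 0 (f c)) as [h|h]; [exact h|exfalso].
    assert (hfc : 0 < - f c) by lra.
    destruct (hloc (mkposreal _ hfc)) as [d hd]; simpl in hd.
    assert (hlt : a < c).
    { destruct (Req_dec a c) as [e|e]; [rewrite <- e in h; lra|lra]. }
    set (y := Rmax a (c - d / 2)).
    assert (hy : a <= y < c /\ c - d / 2 <= y).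
    { unfold y; pose proof (cond_pos d); split; [split|].
      - apply Rmax_l.
      - apply Rmax_lub_lt; lra.
      - apply Rmax_r. }
    assert (hyd : Rabs (y - c) < d) by (apply Rabs_def1; lra).
    specialize (hd y hyd); apply Rabs_def2 in hd.
    pose proof (hpos y (proj1 hy)); lra. }
  assert (hle : f c <= 0).
  { destruct (Rle_dec (f c) 0) as [h|h]; [exact h|exfalso].
    assert (hfc : 0 < f c) by lra.
    assert (hlt : c < b).
    { destruct (Req_dec c b) as [e|e]; [rewrite e in h; lra|lra]. }
    destruct (hloc (mkposreal _ hfc)) as [d hd]; simpl in hd.
    pose proof (cond_pos d).
    set (y := Rmin b (c + d / 2)).
    assert (hy : c < y <= b /\ y <= c + d / 2).
    { unfold y; split; [split|].
      - apply Rmin_glb_lt; lra.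
      - apply Rmin_l.
      - apply Rmin_r. }
    assert (hSy : S y).
    { split; [lra|]; intros t ht; destruct (Rlt_dec t c) as [h'|h'].
      - apply hpos; lra.
      - assert (htd : Rabs (t - c) < d) by (apply Rabs_def1; lra).
        specialize (hd t htd); apply Rabs_def2 in hd; lra. }
    pose proof (hub y hSy); lra. }
  exists c; split; [|split; [lra|exact hpos]].
  split; [|exact hcb].
  destruct (Req_dec a c) as [e|e]; [rewrite <- e in hle; lra|lra].
Qed.

Lemma increasing_of_derive (f f' : R -> R) (a b : R) :
  a < b -> (forall x, a <= x <= b -> is_derive f x (f' x)) ->
  (forall x, a <= x <= b -> 0 < f' x) -> f a < f b.
Proof.
intros hab hf hf'.
destruct (MVT_gen f a b f') as [c [hc heq]];
  rewrite ?Rmin_left, ?Rmax_right in * by lra.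
- intros x hx; apply hf; lra.
- intros x hx; apply (is_derive_continuity f x (f' x)), hf, hx.
- specialize (hf' c hc); nra.
Qed.

(** [U] and [V] stand for the fluxes [p u'] and [p v']; [v] is a positive
    supersolution for the larger potential [Q]. *)
Lemma sturm_comparison (a b : R) (p q Q u U v V V' : R -> R) :
  a < b ->
  (forall r, a <= r <= b -> 0 < p r) ->
  (forall r, a <= r <= b -> is_derive u r (U r / p r) /\
                            is_derive U r (- q r * u r)) ->
  (forall r, a <= r <= b -> is_derive v r (V r / p r) /\ is_derive V r (V' r) /\
                            V' r <= - Q r * v r /\ 0 < v r) ->
  (forall r, a <= r <= b -> q r <= Q r) ->
  0 < u a -> V a * u a <= U a * v a ->
  (forall r, a <= r <= b -> 0 < u r) /\ V b * u b <= U b * v b /\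
  ((forall r, a <= r <= b -> q r < Q r) -> V b * u b < U b * v b).
Proof.
intros hab hp hu hv hq ha h0.
(* [W] is [p] times the Wronskian. As long as [u >= 0] its derivative is at least [(Q - q) * u * v],
   so it keeps its initial sign. *)
set (W := fun r => U r * v r - V r * u r).
set (W' := fun r => - q r * u r * v r - V' r * u r).
assert (hW : forall r, a <= r <= b -> is_derive W r (W' r)).
{ intros r hr; destruct (hu r hr) as [d1 d2]; destruct (hv r hr) as [d3 [d4 _]].
  evar_last.
  - apply is_derive_Rminus.
    + apply is_derive_Rmult; eassumption.
    + apply is_derive_Rmult; eassumption.
  - unfold W'; field.
    specialize (hp r hr); lra. }
assert (hW'lo : forall r, a <= r <= b -> 0 <= u r ->
  (Q r - q r) * (u r * v r) <= W' r).
{ intros r hr hur; unfold W'; destruct (hv r hr) as [_ [_ [h1 _]]]; nra. }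
assert (hmono : forall c, a <= c <= b -> (forall r, a <= r <= c -> 0 <= u r) ->
  0 <= W c).
{ intros c hc hpos; apply Rle_trans with (W a); [unfold W; lra|].
  apply (nondecreasing_of_derive W W'); [lra|intros; apply hW; lra|].
  intros r hr; assert (hrb : a <= r <= b) by lra.
  apply Rle_trans with (2 := hW'lo r hrb (hpos r hr)).
  specialize (hq r hrb); destruct (hv r hrb) as [_ [_ [_ h1]]].
  specialize (hpos r hr).
  positivity. }
assert (hpos : forall r, a <= r <= b -> 0 < u r).
{ intros r hr; destruct (Rlt_dec 0 (u r)) as [h|h]; [exact h|exfalso].
  destruct (first_zero u a r) as [c [hc [hc0 hcpos]]]; try lra.
  { intros x hx; apply (is_derive_continuity u x (U x / p x)), hu; lra. }
  assert (hnn : forall x, a <= x <= c -> 0 <= u x).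
  { intros x hx; destruct (Req_dec x c) as [->|e]; [lra|].
    left; apply hcpos; lra. }
  (* The derivative of [u / v] is [W / (p * v ^ 2)]. Up to a first zero [c] of [u] it is
     nonnegative, which contradicts [u a / v a > 0 = u c / v c]. *)
  assert (hr1 : u a / v a <= u c / v c).
  { apply (nondecreasing_of_derive (fun r => u r / v r)
             (fun r => W r / (p r * v r ^ 2))); [lra| |].
    - intros x hx; assert (hxb : a <= x <= b) by lra.
      destruct (hu x hxb) as [d1 _]; destruct (hv x hxb) as [d3 [_ [_ hvx]]].
      specialize (hp x hxb).
      evar_last.
      + apply (is_derive_div u v x _ _ d1 d3); lra.
      + unfold W; unfold mult; simpl.
        field; lra.
    - intros x hx; assert (hxb : a <= x <= b) by lra.
      destruct (hv x hxb) as [_ [_ [_ hvx]]]; specialize (hp x hxb).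
      apply Rmult_le_pos.
      + apply hmono; [exact hxb|intros t ht; apply hnn; lra].
      + positivity. }
  rewrite hc0 in hr1; unfold Rdiv in hr1 at 2; rewrite Rmult_0_l in hr1.
  assert (haa : a <= a <= b) by lra.
  destruct (hv a haa) as [_ [_ [_ hva]]].
  assert (0 < u a / v a) by positivity.
  lra. }
split; [exact hpos|split].
- assert (hbb : a <= b <= b) by lra.
  assert (0 <= W b)
    by (apply hmono; [exact hbb|intros r hr; left; apply hpos, hr]).
  unfold W in *; lra.
- intros hlt; assert (W a < W b); [|unfold W in *; lra].
  apply (increasing_of_derive W W'); [exact hab|exact hW|].
  intros r hr; destruct (hv r hr) as [_ [_ [_ hvr]]].
  pose proof (hpos r hr); specialize (hlt r hr).
  apply Rlt_le_trans with (2 := hW'lo r hr (Rlt_le _ _ (hpos r hr))).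
  positivity.
Qed.

(** * Radial modes *)

Definition radial (u : R -> R) (d : nat) (k r : R) : R :=
  Rpower r (- nu d) * u (k * r).

(** This is [r ^ (d - 1)] times the derivative of [radial u d k]: in the derivative recurrence of
    order [l + nu d], the part [nu d / r] is cancelled by differentiating [r ^ (- nu d)]. *)
Definition radial_flux (u v : R -> R) (d l : nat) (k r : R) : R :=
  r ^ (d - 1) * (Rpower r (- nu d) * (INR l / r * u (k * r) - k * v (k * r))).

(** Equal to [l * (l + d - 2)], the eigenvalue of the Laplacian on the sphere. *)
Definition centrifugal (d l : nat) : R := INR l * (INR l + 2 * nu d).

Definition potential (d l : nat) (k r : R) : R :=
  (k ^ 2 - centrifugal d l / r ^ 2) * r ^ (d - 1).

Lemma radial_derives (u v : R -> R) (d l : nat) (k r : R) :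
  (2 <= d)%nat -> bessel_system (INR l + nu d) u v -> 0 < k -> 0 < r ->
  is_derive (radial u d k) r (radial_flux u v d l k r / r ^ (d - 1)) /\
  is_derive (radial_flux u v d l k) r (- potential d l k r * radial u d k r).
Proof.
intros hd huv hk hr.
assert (hkr : 0 < k * r) by positivity.
destruct (huv (k * r) hkr) as [hu hv].
destruct d as [|[|e]]; [lia|lia|].
assert (hnu : nu (S (S e)) = INR e / 2) by (unfold nu; rewrite !S_INR; field).
assert (hP : is_derive (fun r => Rpower r (- nu (S (S e)))) r
               (- nu (S (S e)) / r * Rpower r (- nu (S (S e))))).
{ unfold Rpower; auto_derive; [exact hr|field; lra]. }
assert (hid : is_derive (fun r => k * r) r k) by (auto_derive; [exact I|ring]).
assert (hu' : is_derive (fun r => u (k * r)) r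
   (k * ((INR l + nu (S (S e))) / (k * r) * u (k * r) - v (k * r))))
  by (apply (is_derive_Rcomp u (fun r => k * r)); assumption).
assert (hv' : is_derive (fun r => v (k * r)) r
   (k * (u (k * r) - (INR l + nu (S (S e)) + 1) / (k * r) * v (k * r))))
  by (apply (is_derive_Rcomp v (fun r => k * r)); assumption).
assert (hre : 0 < r ^ e) by positivity.
unfold radial, radial_flux, potential, centrifugal.
replace (S (S e) - 1)%nat with (S e) by lia.
split.
- evar_last.
  + apply is_derive_Rmult; eassumption.
  + simpl; field; repeat split; lra.
- evar_last.
  + apply is_derive_Rmult.
    * apply (is_derive_pow (fun r => r) (S e) r 1).
      apply (is_derive_id (K := R_AbsRing)).
    * apply is_derive_Rmult; [exact hP|].
      apply is_derive_Rminus.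
      -- apply (is_derive_Rmult (fun r => INR l / r) (fun r => u (k * r)) r
                 (- INR l / r ^ 2)); [|exact hu'].
         auto_derive; [lra|field; lra].
      -- apply is_derive_Rmult;
           [apply is_derive_Rconst|exact hv'].
  + simpl Init.Nat.pred; rewrite S_INR, hnu.
    simpl; field; repeat split; lra.
Qed.

(** The combination of [Y] and [J] annihilated by the boundary form at [R1]. *)
Definition mode (d l : nat) (R1 a1 k r : R) : R :=
  B1 besselJ d l R1 a1 k * radial (besselY (INR l + nu d)) d k r
  - B1 besselY d l R1 a1 k * radial (besselJ (INR l + nu d)) d k r.

Definition mode_flux (d l : nat) (R1 a1 k r : R) : R :=
  B1 besselJ d l R1 a1 k
    * radial_flux (besselY (INR l + nu d)) (besselY (INR l + nu d + 1)) d l k r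
  - B1 besselY d l R1 a1 k
    * radial_flux (besselJ (INR l + nu d)) (besselJ (INR l + nu d + 1)) d l k r.

Lemma is_derive_mode (d l : nat) (R1 a1 k r : R) :
  (2 <= d)%nat -> 0 < k -> 0 < r ->
  is_derive (mode d l R1 a1 k) r (mode_flux d l R1 a1 k r / r ^ (d - 1)) /\
  is_derive (mode_flux d l R1 a1 k) r
    (- potential d l k r * mode d l R1 a1 k r).
Proof.
intros hd hk hr.
destruct (bessel_system_Y_order d l hd) as [hY _].
destruct (radial_derives _ _ d l k r hd hY hk hr) as [y1 y2].
destruct (radial_derives _ _ d l k r hd (bessel_system_J (INR l + nu d)) hk hr)
  as [j1 j2].
assert (hc : forall (f g : R -> R) (a b x y : R), is_derive f r x ->
  is_derive g r y -> is_derive (fun r => a * f r - b * g r) r (a * x - b * y)).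
{ intros f g a b x y hf hg.
  apply is_derive_Rminus; apply is_derive_scal; assumption. }
pose proof (pow_lt r (d - 1) hr).
split.
- replace (mode_flux d l R1 a1 k r / r ^ (d - 1)) with
    (B1 besselJ d l R1 a1 k * (radial_flux (besselY (INR l + nu d))
        (besselY (INR l + nu d + 1)) d l k r / r ^ (d - 1))
     - B1 besselY d l R1 a1 k * (radial_flux (besselJ (INR l + nu d))
        (besselJ (INR l + nu d + 1)) d l k r / r ^ (d - 1)))
    by (unfold mode_flux; field; lra).
  apply hc; assumption.
- replace (- potential d l k r * mode d l R1 a1 k r) with
    (B1 besselJ d l R1 a1 k
       * (- potential d l k r * radial (besselY (INR l + nu d)) d k r)
     - B1 besselY d l R1 a1 k
       * (- potential d l k r * radial (besselJ (INR l + nu d)) d k r))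
    by (unfold mode; ring).
  apply hc; assumption.
Qed.

Lemma B1_radial (Z : R -> R -> R) (d l : nat) (r a k : R) :
  0 < r ->
  B1 Z d l r a k = a * radial (Z (INR l + nu d)) d k r
    - radial_flux (Z (INR l + nu d)) (Z (INR l + nu d + 1)) d l k r / r ^ (d - 1).
Proof.
intros hr; unfold B1, radial, radial_flux; pose proof (pow_lt r (d - 1) hr).
field; lra.
Qed.

Lemma B2_radial (Z : R -> R -> R) (d l : nat) (r a k : R) :
  0 < r ->
  B2 Z d l r a k = a * radial (Z (INR l + nu d)) d k r
    + radial_flux (Z (INR l + nu d)) (Z (INR l + nu d + 1)) d l k r / r ^ (d - 1).
Proof.
intros hr; unfold B2, radial, radial_flux; pose proof (pow_lt r (d - 1) hr).
field; lra.
Qed.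

Lemma Delta_mode (d l : nat) (R1 R2 a1 a2 k : R) :
  0 < R2 ->
  Delta_l d l R1 R2 a1 a2 k =
  a2 * mode d l R1 a1 k R2 + mode_flux d l R1 a1 k R2 / R2 ^ (d - 1).
Proof.
intros hr; unfold Delta_l; rewrite !(B2_radial _ d l R2) by exact hr.
unfold mode, mode_flux; pose proof (pow_lt R2 (d - 1) hr); field; lra.
Qed.

(** The weights [r ^ (d - 1)] and [r ^ (- 2 * nu d)] multiply to [r], which cancels the
    [1 / (k * r)] of the Bessel Wronskian. The result depends on neither [k], [r], [d] nor [l]. *)
Lemma radial_wronskian (d l : nat) (k r : R) :
  (2 <= d)%nat -> 0 < k -> 0 < r ->
  let s := INR l + nu d in
  radial (besselJ s) d k r * radial_flux (besselY s) (besselY (s + 1)) d l k r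
  - radial_flux (besselJ s) (besselJ (s + 1)) d l k r * radial (besselY s) d k r
  = 2 / PI.
Proof.
intros hd hk hr s; unfold radial, radial_flux.
assert (hkr : 0 < k * r) by positivity.
pose proof (proj2 (bessel_system_Y_order d l hd) (k * r) hkr) as hw.
fold s in hw.
assert (hP : r ^ (d - 1) * (Rpower r (- nu d) * Rpower r (- nu d)) = r).
{ rewrite <- Rpower_plus.
  replace (r ^ (d - 1)) with (Rpower r (INR (d - 1)))
    by (apply Rpower_pow, hr).
  rewrite <- Rpower_plus, minus_INR by lia.
  replace (INR d - INR 1 + (- nu d + - nu d)) with 1
    by (unfold nu; simpl; field).
  apply Rpower_1, hr. }
transitivity (r ^ (d - 1) * (Rpower r (- nu d) * Rpower r (- nu d)) * k
  * (besselJ (s + 1) (k * r) * besselY s (k * r)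
     - besselJ s (k * r) * besselY (s + 1) (k * r))); [ring|].
rewrite hP, hw; pose proof PI_RGT_0; field; repeat split; lra.
Qed.

Lemma mode_initial (d l : nat) (R1 a1 k : R) :
  (2 <= d)%nat -> 0 < k -> 0 < R1 ->
  mode d l R1 a1 k R1 = 2 / PI / R1 ^ (d - 1) /\
  mode_flux d l R1 a1 k R1 = 2 / PI * a1.
Proof.
intros hd hk hr; unfold mode, mode_flux.
rewrite !(B1_radial _ d l R1) by exact hr.
rewrite <- (radial_wronskian d l k R1 hd hk hr).
pose proof (pow_lt R1 (d - 1) hr); split; field; lra.
Qed.

(** Since the Wronskian is nonzero, a double zero would force both coefficients of the mode to
    vanish, against its positive value at [R1]. *)
Lemma mode_no_double_zero (d l : nat) (R1 a1 k r : R) :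
  (2 <= d)%nat -> 0 < k -> 0 < R1 -> 0 < r ->
  mode d l R1 a1 k r = 0 -> mode_flux d l R1 a1 k r <> 0.
Proof.
intros hd hk hR1 hr h0 h1.
destruct (mode_initial d l R1 a1 k hd hk hR1) as [hi _].
unfold mode in h0; unfold mode_flux in h1.
pose proof (radial_wronskian d l k r hd hk hr) as hw; simpl in hw.
set (al := B1 besselJ d l R1 a1 k) in *; set (be := B1 besselY d l R1 a1 k) in *.
set (FY := radial (besselY (INR l + nu d)) d k r) in *.
set (FJ := radial (besselJ (INR l + nu d)) d k r) in *.
set (GY := radial_flux (besselY (INR l + nu d)) _ d l k r) in *.
set (GJ := radial_flux (besselJ (INR l + nu d)) _ d l k r) in *.
assert (hpi : 0 < 2 / PI) by (apply Rdiv_lt_0_compat; [lra|apply PI_RGT_0]).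
assert (ha : al * (2 / PI) = 0).
{ rewrite <- hw; replace (al * (FJ * GY - GJ * FY))
    with (FJ * (al * GY - be * GJ) - GJ * (al * FY - be * FJ)) by ring.
  rewrite h0, h1; ring. }
assert (hb : be * (2 / PI) = 0).
{ rewrite <- hw; replace (be * (FJ * GY - GJ * FY))
    with (FY * (al * GY - be * GJ) - GY * (al * FY - be * FJ)) by ring.
  rewrite h0, h1; ring. }
apply Rmult_integral in ha; apply Rmult_integral in hb.
destruct ha as [ha|ha]; [|lra]; destruct hb as [hb|hb]; [|lra].
unfold mode in hi; fold al be in hi; rewrite ha, hb in hi.
assert (0 < 2 / PI / R1 ^ (d - 1))
  by positivity.
lra.
Qed.

(** * Joint continuity of the modes in the radius and the wave number *)

Lemma continuity_2d_radial (u : R -> R) (d : nat) (r k : R) :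
  (forall x, 0 < x -> continuity_pt u x) -> 0 < k -> 0 < r ->
  continuity_2d_pt (fun r k => radial u d k r) r k.
Proof.
intros hu hk hr; apply continuity_2d_pt_mult.
- apply (continuity_1d_2d_pt_comp (fun r => Rpower r (- nu d)) (fun r _ => r)).
  + apply (is_derive_continuity _ r (- nu d * / r * exp (- nu d * ln r))).
    unfold Rpower; auto_derive; [exact hr|ring].
  + apply continuity_2d_pt_id1.
- apply (continuity_1d_2d_pt_comp u (fun r k => k * r)).
  + apply hu, Rmult_lt_0_compat; assumption.
  + apply continuity_2d_pt_mult;
      [apply continuity_2d_pt_id2|apply continuity_2d_pt_id1].
Qed.

Lemma bessel_system_continuity (s : R) (u v : R -> R) (x : R) :
  bessel_system s u v -> 0 < x -> continuity_pt u x /\ continuity_pt v x.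
Proof.
intros huv hx; destruct (huv x hx) as [h1 h2].
split; eapply is_derive_continuity; eassumption.
Qed.

Lemma continuity_2d_radial_flux (s : R) (u v : R -> R) (d l : nat) (r k : R) :
  bessel_system s u v -> 0 < k -> 0 < r ->
  continuity_2d_pt (fun r k => radial_flux u v d l k r) r k.
Proof.
intros huv hk hr.
apply (continuity_2d_pt_ext (fun r k => r ^ (d - 1)
  * (INR l * / r * radial u d k r - k * radial v d k r))).
{ intros; unfold radial_flux, radial, Rdiv; ring. }
apply continuity_2d_pt_mult.
- apply (continuity_1d_2d_pt_comp (fun r => r ^ (d - 1)) (fun r _ => r)).
  + apply derivable_continuous_pt, derivable_pt_pow.
  + apply continuity_2d_pt_id1.
- apply continuity_2d_pt_minus; apply continuity_2d_pt_mult.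
  + apply continuity_2d_pt_mult; [apply continuity_2d_pt_const|].
    apply continuity_2d_pt_inv; [apply continuity_2d_pt_id1|lra].
  + apply continuity_2d_radial; try assumption.
    intros x hx; apply (bessel_system_continuity s u v x huv hx).
  + apply continuity_2d_pt_id2.
  + apply continuity_2d_radial; try assumption.
    intros x hx; apply (bessel_system_continuity s u v x huv hx).
Qed.

Lemma continuity_2d_section (f : R -> R -> R) (x y : R) :
  continuity_2d_pt f x y -> continuity_pt (f x) y.
Proof.
intros hf; apply continuity_pt_locally; intros eps.
destruct (hf eps) as [d hd]; exists d; intros z hz; apply hd; [|exact hz].
rewrite Rminus_diag, Rabs_R0; apply cond_pos.
Qed.

Lemma continuity_B1 (Z : R -> R -> R) (d l : nat) (R1 a1 k : R) :
  bessel_system (INR l + nu d) (Z (INR l + nu d)) (Z (INR l + nu d + 1)) ->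
  0 < R1 -> 0 < k -> continuity_pt (B1 Z d l R1 a1) k.
Proof.
intros hZ hR1 hk.
apply (continuity_pt_ext (fun k => a1 * radial (Z (INR l + nu d)) d k R1
    - radial_flux (Z (INR l + nu d)) (Z (INR l + nu d + 1)) d l k R1
      * / R1 ^ (d - 1))).
{ intros x; rewrite B1_radial by exact hR1; reflexivity. }
apply (continuity_2d_section (fun r k => a1 * radial (Z (INR l + nu d)) d k r
    - radial_flux (Z (INR l + nu d)) (Z (INR l + nu d + 1)) d l k r
      * / R1 ^ (d - 1)) R1 k).
apply continuity_2d_pt_minus; apply continuity_2d_pt_mult;
  try apply continuity_2d_pt_const.
- apply continuity_2d_radial; try assumption.
  intros x hx; apply (bessel_system_continuity _ _ _ x hZ hx).
- eapply continuity_2d_radial_flux; eassumption.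
Qed.

Lemma continuity_2d_mode (d l : nat) (R1 a1 k r : R) :
  (2 <= d)%nat -> 0 < R1 -> 0 < k -> 0 < r ->
  continuity_2d_pt (fun r k => mode d l R1 a1 k r) r k /\
  continuity_2d_pt (fun r k => mode_flux d l R1 a1 k r) r k.
Proof.
intros hd hR1 hk hr.
destruct (bessel_system_Y_order d l hd) as [hY _].
pose proof (bessel_system_J (INR l + nu d)) as hJ.
assert (hB : forall Z, bessel_system (INR l + nu d) (Z (INR l + nu d))
    (Z (INR l + nu d + 1)) ->
  continuity_2d_pt (fun _ k => B1 Z d l R1 a1 k) r k).
{ intros Z hZ; apply (continuity_1d_2d_pt_comp (B1 Z d l R1 a1) (fun _ k => k)).
  - apply continuity_B1; assumption.
  - apply continuity_2d_pt_id2. }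
assert (hF : forall u v, bessel_system (INR l + nu d) u v ->
  continuity_2d_pt (fun r k => radial u d k r) r k).
{ intros u v huv; apply continuity_2d_radial; try assumption.
  intros x hx; apply (bessel_system_continuity _ _ _ x huv hx). }
split; apply continuity_2d_pt_minus; apply continuity_2d_pt_mult;
  try (apply hB; assumption);
  try (eapply hF; eassumption); eapply continuity_2d_radial_flux; eassumption.
Qed.

Lemma continuity_Delta (d l : nat) (R1 R2 a1 a2 k : R) :
  (2 <= d)%nat -> 0 < R1 -> 0 < R2 -> 0 < k ->
  continuity_pt (Delta_l d l R1 R2 a1 a2) k.
Proof.
intros hd hR1 hR2 hk.
destruct (continuity_2d_mode d l R1 a1 k R2 hd hR1 hk hR2) as [h1 h2].
apply (continuity_pt_ext (fun k =>
  a2 * mode d l R1 a1 k R2 + mode_flux d l R1 a1 k R2 * / R2 ^ (d - 1))).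
{ intros x; rewrite Delta_mode by exact hR2; reflexivity. }
apply (continuity_2d_section (fun r k =>
  a2 * mode d l R1 a1 k r + mode_flux d l R1 a1 k r * / R2 ^ (d - 1)) R2 k).
apply continuity_2d_pt_plus; apply continuity_2d_pt_mult;
  try apply continuity_2d_pt_const; assumption.
Qed.

(** * The transparent interval *)

(** Positivity of the mode belongs to the definition because comparison uses the mode at [k] as a
    positive supersolution; the sign of the determinant at one [k] alone could not be passed to
    smaller [k]. *)
Definition transparent (d l : nat) (R1 R2 a1 a2 k : R) : Prop :=
  (forall r, R1 <= r <= R2 -> 0 < mode d l R1 a1 k r) /\
  0 < Delta_l d l R1 R2 a1 a2 k.

Lemma mode_flux_initial (d l : nat) (R1 a1 k : R) :
  (2 <= d)%nat -> 0 < k -> 0 < R1 ->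
  mode_flux d l R1 a1 k R1 = a1 * R1 ^ (d - 1) * mode d l R1 a1 k R1 /\
  0 < mode d l R1 a1 k R1.
Proof.
intros hd hk hr; destruct (mode_initial d l R1 a1 k hd hk hr) as [h1 h2].
pose proof (pow_lt R1 (d - 1) hr); pose proof PI_RGT_0.
split; [rewrite h1, h2; field; lra|].
rewrite h1; positivity.
Qed.

(** The boundary condition at [R1] depends on neither [k] nor the angular order, so the two modes
    have equal logarithmic derivatives there and the initial inequality of the comparison is an
    equality. *)
Lemma mode_comparison (d l m : nat) (R1 R2 a1 k k' : R) :
  (2 <= d)%nat -> 0 < R1 -> R1 < R2 -> 0 < k' -> 0 < k ->
  (forall r, R1 <= r <= R2 -> potential d m k' r <= potential d l k r) ->
  (forall r, R1 <= r <= R2 -> 0 < mode d l R1 a1 k r) ->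
  (forall r, R1 <= r <= R2 -> 0 < mode d m R1 a1 k' r) /\
  mode_flux d l R1 a1 k R2 * mode d m R1 a1 k' R2
    <= mode_flux d m R1 a1 k' R2 * mode d l R1 a1 k R2 /\
  ((forall r, R1 <= r <= R2 -> potential d m k' r < potential d l k r) ->
   mode_flux d l R1 a1 k R2 * mode d m R1 a1 k' R2
    < mode_flux d m R1 a1 k' R2 * mode d l R1 a1 k R2).
Proof.
intros hd hR1 hR hk' hk hq hpos.
destruct (mode_flux_initial d l R1 a1 k hd hk hR1) as [i1 i2].
destruct (mode_flux_initial d m R1 a1 k' hd hk' hR1) as [i3 i4].
apply (sturm_comparison R1 R2 (fun r => r ^ (d - 1)) (potential d m k')
  (potential d l k) (mode d m R1 a1 k') (mode_flux d m R1 a1 k')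
  (mode d l R1 a1 k) (mode_flux d l R1 a1 k)
  (fun r => - potential d l k r * mode d l R1 a1 k r)).
- exact hR.
- intros r hr; positivity.
- intros r hr; apply is_derive_mode; [exact hd|exact hk'|lra].
- intros r hr; assert (hr0 : 0 < r) by lra.
  destruct (is_derive_mode d l R1 a1 k r hd hk hr0) as [h1 h2].
  split; [exact h1|split; [exact h2|split; [lra|apply hpos, hr]]].
- exact hq.
- exact i4.
- rewrite i1, i3; apply Req_le; ring.
Qed.

(** The boundary form divided by the mode is [a2] plus the logarithmic derivative, so an ordering of
    fluxes relative to the modes orders the signs of the determinants. *)
Lemma Delta_pos_of_flux (R2 a2 p u U v V : R) :
  0 < p -> 0 < u -> 0 < v -> V * u <= U * v ->
  (0 < a2 * v + V / p -> 0 < a2 * u + U / p) /\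
  (V * u < U * v -> a2 * v + V / p = 0 -> 0 < a2 * u + U / p).
Proof.
intros hp hu hv hle.
assert (hq : (a2 * u + U / p) * v = (a2 * v + V / p) * u + (U * v - V * u) / p)
  by (field; lra).
split.
- intros h; apply Rmult_lt_reg_r with v; [exact hv|].
  rewrite hq, Rmult_0_l.
  assert (0 <= (U * v - V * u) / p)
    by positivity.
  assert (0 < (a2 * v + V / p) * u) by positivity.
  lra.
- intros hlt h0; apply Rmult_lt_reg_r with v; [exact hv|].
  rewrite hq, h0, !Rmult_0_l, Rplus_0_l.
  positivity.
Qed.

Lemma potential_mono_k (d l : nat) (k k' r : R) :
  0 < r -> 0 <= k' <= k -> potential d l k' r <= potential d l k r.
Proof.
intros hr hk; unfold potential; apply Rmult_le_compat_r.
- positivity.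
- apply Rplus_le_compat_r, pow_incr, hk.
Qed.

Lemma nu_nonneg (d : nat) : (2 <= d)%nat -> 0 <= nu d.
Proof. intros hd; apply le_INR in hd; unfold nu; simpl in hd; lra. Qed.

Lemma centrifugal_nonneg (d l : nat) : (2 <= d)%nat -> 0 <= centrifugal d l.
Proof.
intros hd; unfold centrifugal; pose proof (nu_nonneg d hd); pose proof (pos_INR l).
positivity.
Qed.

Lemma potential_mono_l (d l m : nat) (k r : R) :
  (2 <= d)%nat -> 0 < r -> (l < m)%nat -> potential d m k r < potential d l k r.
Proof.
intros hd hr hlm; unfold potential; apply Rmult_lt_compat_r;
  [positivity|].
apply Rplus_lt_compat_l, Ropp_lt_contravar, Rmult_lt_compat_r.
- positivity.
- unfold centrifugal; pose proof (nu_nonneg d hd); pose proof (pos_INR l).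
  apply lt_INR in hlm; nra.
Qed.

Lemma transparent_below (d l : nat) (R1 R2 a1 a2 k k' : R) :
  (2 <= d)%nat -> 0 < R1 -> R1 < R2 -> 0 < k' <= k ->
  transparent d l R1 R2 a1 a2 k -> transparent d l R1 R2 a1 a2 k'.
Proof.
intros hd hR1 hR hk [hpos hD].
assert (hk0 : 0 < k) by lra; assert (hR2 : 0 < R2) by lra.
destruct (mode_comparison d l l R1 R2 a1 k k' hd hR1 hR (proj1 hk) hk0)
  as [h1 [h2 _]].
- intros r hr; apply potential_mono_k; lra.
- exact hpos.
- split; [exact h1|].
  rewrite Delta_mode in hD |- * by exact hR2.
  assert (hin : R1 <= R2 <= R2) by lra.
  apply (proj1 (Delta_pos_of_flux R2 a2 _ _ _ _ _ (pow_lt R2 (d - 1) hR2)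
           (h1 R2 hin) (hpos R2 hin) h2)); exact hD.
Qed.

(** Compare with the positive supersolution [M - r ^ 2]. *)
Lemma transparent_small (d l : nat) (R1 R2 a1 a2 : R) :
  (2 <= d)%nat -> 0 < R1 -> R1 < R2 -> 0 < a1 -> 0 < a2 ->
  exists k, 0 < k /\ transparent d l R1 R2 a1 a2 k.
Proof.
intros hd hR1 hR ha1 ha2.
assert (hR2 : 0 < R2) by lra.
assert (hc : 0 < R2 / a2) by positivity.
(* Chosen so that the boundary form of [M - r ^ 2] at [R2] equals
   [a2 * (M - R2 ^ 2) - 2 * R2 = a2 > 0]. With [k = / M] one gets [k ^ 2 * M <= 1 <= 2 * d], the
   supersolution condition. *)
set (M := R2 ^ 2 + 2 * (R2 / a2) + 1).
pose proof (pow2_ge_0 R2).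
assert (hM : 1 <= M) by (unfold M; lra).
set (k := / M).
assert (hk : 0 < k) by (apply Rinv_0_lt_compat; lra).
assert (hk2 : k ^ 2 * M <= 1).
{ unfold k; replace ((/ M) ^ 2 * M) with (/ M) by (field; lra).
  rewrite <- Rinv_1; apply Rinv_le_contravar; lra. }
exists k; split; [exact hk|].
destruct (mode_flux_initial d l R1 a1 k hd hk hR1) as [i1 i2].
assert (hchi : forall r, R1 <= r <= R2 -> 0 < M - r ^ 2).
{ intros r hr; unfold M; assert (r ^ 2 <= R2 ^ 2) by (apply pow_incr; lra); lra. }
destruct (sturm_comparison R1 R2 (fun r => r ^ (d - 1)) (potential d l k)
  (potential d l k) (mode d l R1 a1 k) (mode_flux d l R1 a1 k)
  (fun r => M - r ^ 2) (fun r => - 2 * r ^ d)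
  (fun r => - 2 * (INR d * r ^ (d - 1)))) as [h1 [h2 _]].
- exact hR.
- intros r hr; positivity.
- intros r hr; apply is_derive_mode; [exact hd|exact hk|lra].
- intros r hr; assert (hr0 : 0 < r) by lra.
  pose proof (pow_lt r (d - 1) hr0) as hp; split; [|split; [|split]].
  + replace (r ^ d) with (r ^ (d - 1) * r)
      by (replace d with (S (d - 1)) at 2 by lia;
          simpl; ring).
    auto_derive; [exact I|field; lra].
  + auto_derive; [exact I|]; replace (Init.Nat.pred d) with (d - 1)%nat by lia; ring.
  + specialize (hchi r hr); unfold potential.
    replace (- ((k ^ 2 - centrifugal d l / r ^ 2) * r ^ (d - 1)) * (M - r ^ 2))
      with ((centrifugal d l / r ^ 2 * (M - r ^ 2) - k ^ 2 * (M - r ^ 2))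
              * r ^ (d - 1)) by ring.
    rewrite <- Rmult_assoc; apply Rmult_le_compat_r; [lra|].
    assert (0 <= centrifugal d l / r ^ 2 * (M - r ^ 2)).
    { apply Rmult_le_pos; [|lra]; apply Rmult_le_pos;
        [apply centrifugal_nonneg, hd|positivity]. }
    assert (k ^ 2 * (M - r ^ 2) <= k ^ 2 * M)
      by (apply Rmult_le_compat_l; [positivity|pose proof (pow2_ge_0 r); lra]).
    apply le_INR in hd; simpl in hd; lra.
  + apply hchi, hr.
- intros r hr; apply Rle_refl.
- exact i2.
- assert (hin : R1 <= R1 <= R2) by lra; specialize (hchi R1 hin).
  pose proof (pow_lt R1 d hR1); pose proof (pow_lt R1 (d - 1) hR1).
  rewrite i1; apply Rle_trans with 0.
  + assert (0 < R1 ^ d * mode d l R1 a1 k R1) by positivity.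
    lra.
  + positivity.
- split; [exact h1|].
  rewrite Delta_mode by exact hR2.
  assert (hin : R1 <= R2 <= R2) by lra.
  apply (proj1 (Delta_pos_of_flux R2 a2 _ _ _ _ _ (pow_lt R2 (d - 1) hR2)
           (h1 R2 hin) (hchi R2 hin) h2)).
  pose proof (pow_lt R2 (d - 1) hR2).
  replace (R2 ^ d) with (R2 ^ (d - 1) * R2)
    by (replace d with (S (d - 1)) at 2 by lia; simpl; ring).
  unfold M; replace (a2 * (R2 ^ 2 + 2 * (R2 / a2) + 1 - R2 ^ 2)
    + -2 * (R2 ^ (d - 1) * R2) / R2 ^ (d - 1)) with a2 by (field; lra).
  exact ha2.
Qed.

(** * The Riccati variable, the first root and its dependence on the angular order *)

Lemma is_derive_riccati (d l : nat) (R1 a1 k r : R) :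
  (2 <= d)%nat -> 0 < k -> 0 < r -> 0 < mode d l R1 a1 k r ->
  is_derive (fun r => mode_flux d l R1 a1 k r / mode d l R1 a1 k r) r
    (- potential d l k r
     - (mode_flux d l R1 a1 k r / mode d l R1 a1 k r) ^ 2 / r ^ (d - 1)).
Proof.
intros hd hk hr hm.
destruct (is_derive_mode d l R1 a1 k r hd hk hr) as [h1 h2].
pose proof (pow_lt r (d - 1) hr).
evar_last.
- apply (is_derive_div _ _ r _ _ h2 h1); lra.
- field; lra.
Qed.

Lemma riccati_boundary (d l : nat) (R1 R2 a1 a2 k : R) :
  (2 <= d)%nat -> 0 < R1 -> R1 < R2 -> 0 < k ->
  (forall r, R1 <= r <= R2 -> 0 < mode d l R1 a1 k r) ->
  let v := fun r => mode_flux d l R1 a1 k r / mode d l R1 a1 k r in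
  v R1 = a1 * R1 ^ (d - 1) /\
  Delta_l d l R1 R2 a1 a2 k
    = (v R2 + a2 * R2 ^ (d - 1)) * (mode d l R1 a1 k R2 / R2 ^ (d - 1)).
Proof.
intros hd hR1 hR hk hpos v; unfold v.
destruct (mode_flux_initial d l R1 a1 k hd hk hR1) as [i1 i2].
assert (hin : R1 <= R2 <= R2) by lra; specialize (hpos R2 hin).
assert (hR2 : 0 < R2) by lra; pose proof (pow_lt R2 (d - 1) hR2).
split.
- rewrite i1; field; lra.
- rewrite Delta_mode by exact hR2; field; lra.
Qed.

(** The Riccati variable starts at [a1 * R1 ^ (d - 1)], must stay above [- a2 * R2 ^ (d - 1)] at
    [R2], and falls at rate at least [k ^ 2 * R1 ^ (d - 1) - L * c]. Here [c] bounds
    [r ^ (d - 1) / r ^ 2] in every dimension by treating numerator and denominator separately. *)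
Lemma transparent_bounded (d l : nat) (R1 R2 a1 a2 : R) :
  (2 <= d)%nat -> 0 < R1 -> R1 < R2 -> 0 < a1 -> 0 < a2 ->
  exists B, forall k, 0 < k -> transparent d l R1 R2 a1 a2 k -> k <= B.
Proof.
intros hd hR1 hR ha1 ha2.
assert (hR2 : 0 < R2) by lra.
set (c := R2 ^ (d - 1) / R1 ^ 2).
set (L := centrifugal d l).
set (K := a1 * R1 ^ (d - 1) + a2 * R2 ^ (d - 1) + L * c * (R2 - R1)).
set (m := R1 ^ (d - 1) * (R2 - R1)).
assert (hm : 0 < m)
  by (apply Rmult_lt_0_compat; [positivity|lra]).
exists (1 + K / m); intros k hk [hpos hD].
destruct (riccati_boundary d l R1 R2 a1 a2 k hd hR1 hR hk hpos) as [b1 b2].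
set (v := fun r => mode_flux d l R1 a1 k r / mode d l R1 a1 k r).
change (v R1 = a1 * R1 ^ (d - 1)) in b1.
change (mode_flux d l R1 a1 k R2 / mode d l R1 a1 k R2) with (v R2) in b2.
assert (hin : R1 <= R2 <= R2) by lra.
assert (hv2 : 0 < v R2 + a2 * R2 ^ (d - 1)).
{ rewrite b2 in hD.
  assert (0 < mode d l R1 a1 k R2 / R2 ^ (d - 1))
    by (apply Rdiv_lt_0_compat; [apply hpos, hin|positivity]).
  apply Rmult_lt_reg_r with (mode d l R1 a1 k R2 / R2 ^ (d - 1)); lra. }
assert (hL : 0 <= L) by (apply centrifugal_nonneg, hd).
assert (hmono : v R2 + (k ^ 2 * R1 ^ (d - 1) - L * c) * R2
             <= v R1 + (k ^ 2 * R1 ^ (d - 1) - L * c) * R1).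
{ apply (nonincreasing_of_derive
    (fun r => v r + (k ^ 2 * R1 ^ (d - 1) - L * c) * r)
    (fun r => (- potential d l k r - v r ^ 2 / r ^ (d - 1))
              + (k ^ 2 * R1 ^ (d - 1) - L * c))); [lra| |].
  - intros r hr; assert (hr0 : 0 < r) by lra.
    apply is_derive_Rplus.
    + apply is_derive_riccati; auto.
    + auto_derive; [exact I|ring].
  - intros r hr; assert (hr0 : 0 < r) by lra.
    pose proof (pow_lt r (d - 1) hr0) as hp.
    assert (0 <= v r ^ 2 / r ^ (d - 1))
      by positivity.
    assert (h1 : k ^ 2 * R1 ^ (d - 1) <= k ^ 2 * r ^ (d - 1))
      by (apply Rmult_le_compat_l; [positivity|apply pow_incr; lra]).
    assert (h2 : L * (r ^ (d - 1) / r ^ 2) <= L * c).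
    { apply Rmult_le_compat_l; [exact hL|]; unfold c.
      apply Rmult_le_compat; [lra|positivity| |].
      - apply pow_incr; lra.
      - apply Rinv_le_contravar; [positivity|apply pow_incr; lra]. }
    unfold potential; fold L.
    replace (- ((k ^ 2 - L / r ^ 2) * r ^ (d - 1)))
      with (L * (r ^ (d - 1) / r ^ 2) - k ^ 2 * r ^ (d - 1)) by (field; lra).
    lra. }
assert (hkm : k ^ 2 * m <= K).
{ rewrite b1 in hmono; unfold m, K; lra. }
assert (hKm : k ^ 2 <= K / m).
{ apply Rmult_le_reg_r with m; [exact hm|].
  unfold Rdiv; rewrite Rmult_assoc, Rinv_l, Rmult_1_r by lra; exact hkm. }
nra.
Qed.

Lemma derive_nonpos_of_zero_right (f : R -> R) (a b c : R) :
  a < b -> (forall x, a <= x <= b -> 0 <= f x) -> f b = 0 ->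
  is_derive f b c -> c <= 0.
Proof.
intros hab hf h0 hd; destruct (Rle_dec c 0) as [h|h]; [exact h|exfalso].
apply is_derive_Reals in hd; assert (hc : 0 < c) by lra.
destruct (hd c hc) as [e he]; pose proof (cond_pos e).
set (t := Rmin (e / 2) (b - a)).
assert (ht : 0 < t <= b - a /\ t <= e / 2).
{ unfold t; repeat split; [apply Rmin_glb_lt; lra|apply Rmin_r|apply Rmin_l]. }
assert (ht0 : - t <> 0) by lra.
assert (htabs : Rabs (- t) < e) by (rewrite Rabs_Ropp, Rabs_right; lra).
specialize (he (- t) ht0 htabs); apply Rabs_def2 in he.
assert (hx : a <= b + - t <= b) by lra; specialize (hf _ hx).
rewrite h0 in he.
replace ((f (b + - t) - 0) / - t) with (- (f (b + - t) / t)) in he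
  by (field; lra).
assert (0 <= f (b + - t) / t)
  by positivity.
lra.
Qed.

Lemma derive_nonneg_of_zero_left (f : R -> R) (a b c : R) :
  a < b -> (forall x, a <= x <= b -> 0 <= f x) -> f a = 0 ->
  is_derive f a c -> 0 <= c.
Proof.
intros hab hf h0 hd.
assert (h : - c <= 0); [|lra].
apply (derive_nonpos_of_zero_right (fun x => f (- x)) (- b) (- a)); [lra| | |].
- intros x hx; apply hf; lra.
- rewrite Ropp_involutive; exact h0.
- replace (- c) with (-1 * c) by ring.
  apply (is_derive_Rcomp f Ropp).
  + rewrite Ropp_involutive; exact hd.
  + auto_derive; [exact I|ring].
Qed.

Lemma nonneg_of_left_limit (f : R -> R) (x : R) :
  0 < x -> continuity_pt f x -> (forall y, 0 < y < x -> 0 < f y) -> 0 <= f x.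
Proof.
intros hx hf hpos; destruct (Rle_dec 0 (f x)) as [h|h]; [exact h|exfalso].
assert (hfx : 0 < - f x) by lra.
destruct (proj1 (continuity_pt_locally f x) hf (mkposreal _ hfx)) as [e he].
pose proof (cond_pos e).
set (t := Rmin (e / 2) (x / 2)).
assert (ht : 0 < t <= x / 2 /\ t <= e / 2).
{ unfold t; repeat split; [apply Rmin_glb_lt; lra|apply Rmin_r|apply Rmin_l]. }
assert (hb : Rabs (f (x - t) - f x) < - f x).
{ apply he; change (Rabs (x - t - x) < e).
  replace (x - t - x) with (- t) by ring; rewrite Rabs_Ropp, Rabs_right; lra. }
apply Rabs_def2 in hb.
assert (hy : 0 < x - t < x) by lra; pose proof (hpos _ hy); lra.
Qed.

(** The mode has a positive minimum on the compact interval, and its continuity in [k] is uniform in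
    [r]. *)
Lemma transparent_open (d l : nat) (R1 R2 a1 a2 k : R) :
  (2 <= d)%nat -> 0 < R1 -> R1 < R2 -> 0 < k ->
  transparent d l R1 R2 a1 a2 k ->
  exists k', k < k' /\ transparent d l R1 R2 a1 a2 k'.
Proof.
intros hd hR1 hR hk [hpos hD].
assert (hR2 : 0 < R2) by lra.
destruct (continuity_ab_min (mode d l R1 a1 k) R1 R2) as [x [hmin hx]]; [lra| |].
{ intros r hr; assert (hr0 : 0 < r) by lra.
  apply (is_derive_continuity _ r _
    (proj1 (is_derive_mode d l R1 a1 k r hd hk hr0))). }
pose proof (hpos x hx) as hx0.
destruct (uniform_continuity_2d_1d (fun r k => mode d l R1 a1 k r) R1 R2 k)
  with (eps := mkposreal _ hx0) as [e he].
{ intros r hr; apply continuity_2d_mode; auto; lra. }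
destruct (proj1 (continuity_pt_locally _ k)
  (continuity_Delta d l R1 R2 a1 a2 k hd hR1 hR2 hk) (mkposreal _ hD)) as [e' he'].
pose proof (cond_pos e); pose proof (cond_pos e').
set (t := Rmin (e / 2) (e' / 2)).
assert (ht : 0 < t /\ t <= e / 2 /\ t <= e' / 2).
{ unfold t; repeat split; [apply Rmin_glb_lt; lra|apply Rmin_l|apply Rmin_r]. }
exists (k + t); split; [lra|split].
- intros r hr.
  assert (h1 : k - e <= k <= k + e) by lra.
  assert (h2 : k - e <= k + t <= k + e) by lra.
  assert (h3 : Rabs (r - r) < e) by (rewrite Rminus_diag, Rabs_R0; lra).
  pose proof (he r k r (k + t) hr h1 hr h2 h3) as h; simpl in h.
  apply Rabs_def2 in h; specialize (hmin r hr); lra.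
- assert (h : Rabs (Delta_l d l R1 R2 a1 a2 (k + t) - Delta_l d l R1 R2 a1 a2 k)
    < Delta_l d l R1 R2 a1 a2 k).
  { apply he'; change (Rabs (k + t - k) < e').
    replace (k + t - k) with t by ring; rewrite Rabs_right; lra. }
  apply Rabs_def2 in h; lra.
Qed.

(** The root is the supremum of the transparent [k]. By continuity the mode and the determinant are
    nonnegative there; a zero of the mode would be double, so the mode stays positive, and a
    positive determinant would contradict [transparent_open]. *)
Lemma first_root_exists (d l : nat) (R1 R2 a1 a2 : R) :
  (2 <= d)%nat -> 0 < R1 -> R1 < R2 -> 0 < a1 -> 0 < a2 ->
  exists k, 0 < k /\ Delta_l d l R1 R2 a1 a2 k = 0 /\
    (forall r, R1 <= r <= R2 -> 0 < mode d l R1 a1 k r) /\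
    (forall k', 0 < k' < k -> transparent d l R1 R2 a1 a2 k').
Proof.
intros hd hR1 hR ha1 ha2.
assert (hR2 : 0 < R2) by lra.
set (S := fun k => 0 < k /\ transparent d l R1 R2 a1 a2 k).
destruct (transparent_small d l R1 R2 a1 a2 hd hR1 hR ha1 ha2) as [k0 hk0].
destruct (transparent_bounded d l R1 R2 a1 a2 hd hR1 hR ha1 ha2) as [B hB].
destruct (completeness S) as [k [hub hlub]].
- exists B; intros k [h1 h2]; apply hB; assumption.
- exists k0; exact hk0.
- assert (hk : 0 < k) by (apply Rlt_le_trans with k0; [apply hk0|apply hub, hk0]).
  assert (hbelow : forall k', 0 < k' < k -> transparent d l R1 R2 a1 a2 k').
  { intros k' hk'.
    destruct (Classical_Prop.classic (exists y, S y /\ k' < y)) as [[y [hy1 hy2]]|h].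
    - apply (transparent_below d l R1 R2 a1 a2 y k'); auto; [lra|apply hy1].
    - exfalso; assert (k <= k'); [|lra].
      apply hlub; intros y hy; destruct (Rle_dec y k') as [h'|h']; [exact h'|].
      exfalso; apply h; exists y; split; [exact hy|lra]. }
  assert (hD : 0 <= Delta_l d l R1 R2 a1 a2 k).
  { apply nonneg_of_left_limit; [exact hk|apply continuity_Delta; assumption|].
    intros y hy; apply (hbelow y hy). }
  assert (hnn : forall r, R1 <= r <= R2 -> 0 <= mode d l R1 a1 k r).
  { intros r hr; assert (hr0 : 0 < r) by lra.
    apply (nonneg_of_left_limit (fun k => mode d l R1 a1 k r)); [exact hk| |].
    - apply (continuity_2d_section (fun r k => mode d l R1 a1 k r)).
      apply continuity_2d_mode; assumption.
    - intros y hy; apply (hbelow y hy); exact hr. }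
  assert (hpos : forall r, R1 <= r <= R2 -> 0 < mode d l R1 a1 k r).
  { intros r hr; assert (hr0 : 0 < r) by lra.
    destruct (Req_dec (mode d l R1 a1 k r) 0) as [h0|h0];
      [exfalso|pose proof (hnn r hr); lra].
    pose proof (mode_no_double_zero d l R1 a1 k r hd hk hR1 hr0 h0) as hf.
    destruct (is_derive_mode d l R1 a1 k r hd hk hr0) as [h1 _].
    pose proof (pow_lt r (d - 1) hr0) as hp.
    assert (hR1r : R1 < r).
    { destruct (Req_dec R1 r) as [e|e]; [|lra].
      pose proof (proj2 (mode_flux_initial d l R1 a1 k hd hk hR1)).
      rewrite <- e in h0; lra. }
    assert (hle : mode_flux d l R1 a1 k r / r ^ (d - 1) <= 0).
    { apply (derive_nonpos_of_zero_right (mode d l R1 a1 k) R1 r); auto.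
      intros x hx; apply hnn; lra. }
    assert (hge : 0 <= mode_flux d l R1 a1 k r / r ^ (d - 1)).
    (* At the end [R2] no points to the right are available; there the inequality for the flux comes
       from the determinant being nonnegative while the mode vanishes. *)
    { destruct (Req_dec r R2) as [e|e].
      - rewrite Delta_mode in hD by exact hR2; rewrite <- e, h0 in hD; lra.
      - apply (derive_nonneg_of_zero_left (mode d l R1 a1 k) r R2); auto; [lra|].
        intros x hx; apply hnn; lra. }
    apply hf.
    replace (mode_flux d l R1 a1 k r)
      with (mode_flux d l R1 a1 k r / r ^ (d - 1) * r ^ (d - 1)) by (field; lra).
    replace (mode_flux d l R1 a1 k r / r ^ (d - 1)) with 0 by lra; ring. }
  exists k; split; [exact hk|split; [|split; assumption]].
  destruct (Req_dec (Delta_l d l R1 R2 a1 a2 k) 0) as [h|h]; [exact h|exfalso].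
  destruct (transparent_open d l R1 R2 a1 a2 k hd hR1 hR hk) as [k' [hk' ht]].
  { split; [exact hpos|lra]. }
  assert (k' <= k); [|lra].
  apply hub; split; [lra|exact ht].
Qed.

Lemma first_positive_root_unique (f : R -> R) (k : R) :
  0 < k -> f k = 0 -> (forall x, 0 < x < k -> f x <> 0) ->
  first_positive_root f = k.
Proof.
intros hk h0 hf; unfold first_positive_root.
rewrite (is_glb_Rbar_unique _ (Finite k)); [reflexivity|split].
- intros x [hx hx0]; simpl; destruct (Rle_dec k x) as [h|h]; [exact h|exfalso].
  apply (hf x); [lra|exact hx0].
- intros b hb; apply (hb k); split; assumption.
Qed.

Lemma kcl_spec (d l : nat) (R1 R2 a1 a2 : R) :
  (2 <= d)%nat -> 0 < R1 -> R1 < R2 -> 0 < a1 -> 0 < a2 ->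
  let k := kcl d R1 R2 a1 a2 l in
  0 < k /\ Delta_l d l R1 R2 a1 a2 k = 0 /\
  (forall r, R1 <= r <= R2 -> 0 < mode d l R1 a1 k r) /\
  (forall k', 0 < k' < k -> transparent d l R1 R2 a1 a2 k').
Proof.
intros hd hR1 hR ha1 ha2.
destruct (first_root_exists d l R1 R2 a1 a2 hd hR1 hR ha1 ha2)
  as [k [h1 [h2 [h3 h4]]]].
assert (hk : kcl d R1 R2 a1 a2 l = k).
{ apply first_positive_root_unique; [exact h1|exact h2|].
  intros x hx; destruct (h4 x hx) as [_ h]; lra. }
simpl; rewrite hk; auto.
Qed.

(** At the root [k] for [l], strict comparison makes the larger order [m] transparent. If [k' <= k],
    transparency would descend to the root [k'] for [m], where the determinant is zero. *)
Lemma kcl_increasing (d l m : nat) (R1 R2 a1 a2 : R) :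
  (2 <= d)%nat -> 0 < R1 -> R1 < R2 -> 0 < a1 -> 0 < a2 -> (l < m)%nat ->
  kcl d R1 R2 a1 a2 l < kcl d R1 R2 a1 a2 m.
Proof.
intros hd hR1 hR ha1 ha2 hlm.
assert (hR2 : 0 < R2) by lra.
destruct (kcl_spec d l R1 R2 a1 a2 hd hR1 hR ha1 ha2) as [l1 [l2 [l3 _]]].
destruct (kcl_spec d m R1 R2 a1 a2 hd hR1 hR ha1 ha2) as [m1 [m2 _]].
set (k := kcl d R1 R2 a1 a2 l) in *; set (k' := kcl d R1 R2 a1 a2 m) in *.
destruct (Rlt_dec k k') as [h|h]; [exact h|exfalso].
assert (hq : forall r, R1 <= r <= R2 -> potential d m k r < potential d l k r)
  by (intros r hr; apply potential_mono_l; auto; lra).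
destruct (mode_comparison d l m R1 R2 a1 k k hd hR1 hR l1 l1) as [c1 [c2 c3]].
- intros r hr; left; apply hq, hr.
- exact l3.
- assert (hin : R1 <= R2 <= R2) by lra.
  assert (ht : transparent d m R1 R2 a1 a2 k).
  { split; [exact c1|]; rewrite Delta_mode by exact hR2.
    apply (proj2 (Delta_pos_of_flux R2 a2 _ _ _ _ _ (pow_lt R2 (d - 1) hR2)
             (c1 R2 hin) (l3 R2 hin) c2)); [apply c3, hq|].
    rewrite <- Delta_mode by exact hR2; exact l2. }
  assert (hk' : 0 < k' <= k) by lra.
  destruct (transparent_below d m R1 R2 a1 a2 k k' hd hR1 hR hk' ht) as [_ hD].
  lra.
Qed.

Lemma kcl_zero_le (d l : nat) (R1 R2 a1 a2 : R) :
  (2 <= d)%nat -> 0 < R1 -> R1 < R2 -> 0 < a1 -> 0 < a2 ->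
  kcl d R1 R2 a1 a2 0 <= kcl d R1 R2 a1 a2 l.
Proof.
intros; destruct l as [|l]; [apply Rle_refl|left].
apply kcl_increasing; auto; lia.
Qed.

Lemma kc_eq_kcl_zero (d : nat) (R1 R2 a1 a2 : R) :
  (2 <= d)%nat -> 0 < R1 -> R1 < R2 -> 0 < a1 -> 0 < a2 ->
  kc d R1 R2 a1 a2 = kcl d R1 R2 a1 a2 0.
Proof.
intros; unfold kc.
rewrite (is_glb_Rbar_unique _ (Finite (kcl d R1 R2 a1 a2 0)));
  [reflexivity|split].
- intros x [l ->]; simpl; apply kcl_zero_le; assumption.
- intros b hb; apply (hb (kcl d R1 R2 a1 a2 0)); exists 0%nat; reflexivity.
Qed.

Lemma centrifugal_zero (d : nat) : centrifugal d 0 = 0.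
Proof. unfold centrifugal; simpl; ring. Qed.

(** With [V] the integral of [r ^ (d - 1)], the integrated Riccati equation is [k ^ 2 * V = N] minus
    the integral of [v ^ 2 / r ^ (d - 1)]. That correction is nonnegative, and since [v] decreases
    between the two boundary values, [Rabs v <= N] bounds it by a quadratic term. *)
Lemma kc_squared_bounds (d : nat) (R1 R2 a1 a2 : R) :
  (2 <= d)%nat -> 0 < R1 -> R1 < R2 -> 0 < a1 -> 0 < a2 ->
  let N := a1 * R1 ^ (d - 1) + a2 * R2 ^ (d - 1) in
  let V := (R2 ^ d - R1 ^ d) / INR d in
  N - N ^ 2 / R1 ^ (d - 1) * (R2 - R1) <= kc d R1 R2 a1 a2 ^ 2 * V <= N.
Proof.
intros hd hR1 hR ha1 ha2 N V.
assert (hR2 : 0 < R2) by lra.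
rewrite kc_eq_kcl_zero by assumption.
destruct (kcl_spec d 0 R1 R2 a1 a2 hd hR1 hR ha1 ha2) as [hk [hD [hpos _]]].
set (k := kcl d R1 R2 a1 a2 0) in *.
destruct (riccati_boundary d 0 R1 R2 a1 a2 k hd hR1 hR hk hpos) as [b1 b2].
set (v := fun r => mode_flux d 0 R1 a1 k r / mode d 0 R1 a1 k r).
change (v R1 = a1 * R1 ^ (d - 1)) in b1.
change (mode_flux d 0 R1 a1 k R2 / mode d 0 R1 a1 k R2) with (v R2) in b2.
assert (hin : R1 <= R2 <= R2) by lra.
pose proof (pow_lt R1 (d - 1) hR1) as hp1; pose proof (pow_lt R2 (d - 1) hR2) as hp2.
assert (hv2 : v R2 = - (a2 * R2 ^ (d - 1))).
{ rewrite hD in b2; symmetry in b2; apply Rmult_integral in b2.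
  destruct b2 as [b2|b2]; [lra|exfalso].
  assert (0 < mode d 0 R1 a1 k R2 / R2 ^ (d - 1))
    by (apply Rdiv_lt_0_compat; [apply hpos, hin|exact hp2]).
  lra. }
assert (hdn : 0 < INR d) by (apply lt_0_INR; lia).
assert (hpot : forall r, 0 < r -> potential d 0 k r = k ^ 2 * r ^ (d - 1)).
{ intros r hr; unfold potential; rewrite centrifugal_zero; field; lra. }
assert (hdv : forall r, R1 <= r <= R2 ->
  is_derive v r (- (k ^ 2 * r ^ (d - 1)) - v r ^ 2 / r ^ (d - 1))).
{ intros r hr; assert (hr0 : 0 < r) by lra.
  rewrite <- hpot by exact hr0; apply is_derive_riccati; auto. }
assert (hmono : forall r s, R1 <= r <= s -> s <= R2 -> v s <= v r).
{ intros r s hr hs; eapply nonincreasing_of_derive; [lra|intros; apply hdv; lra|].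
  intros x hx; simpl; assert (hx0 : 0 < x) by lra; pose proof (pow_lt x (d - 1) hx0).
  assert (0 <= v x ^ 2 / x ^ (d - 1))
    by positivity.
  assert (0 <= k ^ 2 * x ^ (d - 1)) by positivity.
  simpl in *; lra. }
assert (hn1 : 0 < a1 * R1 ^ (d - 1)) by positivity.
assert (hn2 : 0 < a2 * R2 ^ (d - 1)) by positivity.
assert (hsq : forall r, R1 <= r <= R2 ->
  0 <= v r ^ 2 / r ^ (d - 1) <= N ^ 2 / R1 ^ (d - 1)).
{ intros r hr; assert (hr0 : 0 < r) by lra; pose proof (pow_lt r (d - 1) hr0).
  assert (h1 : v r <= v R1) by (apply hmono; lra).
  assert (h2 : v R2 <= v r) by (apply hmono; lra).
  split.
  - positivity.
  - apply Rmult_le_compat; [positivity|positivity| |].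
    + unfold N; nra.
    + apply Rinv_le_contravar; [exact hp1|apply pow_incr; lra]. }
(* Adding the primitive of [k ^ 2 * r ^ (d - 1)] leaves the quadratic term alone in the derivative,
   so monotonicity replaces integration. *)
set (g := fun r => v r + k ^ 2 * r ^ d / INR d).
assert (hg : forall r, R1 <= r <= R2 -> is_derive g r (- (v r ^ 2 / r ^ (d - 1)))).
{ intros r hr; evar_last.
  - apply is_derive_Rplus.
    + apply hdv, hr.
    + auto_derive; [exact I|reflexivity].
  - replace (Init.Nat.pred d) with (d - 1)%nat by lia.
    field; split; [apply pow_nonzero; lra|lra]. }
assert (hgV : g R2 - g R1 = k ^ 2 * V - N).
{ unfold g; rewrite hv2; unfold V, N; change (v R1) with (v R1).
  rewrite b1; field; lra. }
split.
- assert (h : g R1 + N ^ 2 / R1 ^ (d - 1) * R1 <= g R2 + N ^ 2 / R1 ^ (d - 1) * R2).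
  { apply (nondecreasing_of_derive (fun r => g r + N ^ 2 / R1 ^ (d - 1) * r)
      (fun r => - (v r ^ 2 / r ^ (d - 1)) + N ^ 2 / R1 ^ (d - 1))); [lra| |].
    - intros r hr; apply is_derive_Rplus; [apply hg, hr|].
      generalize (N ^ 2 / R1 ^ (d - 1)); intros c.
      auto_derive; [exact I|ring].
    - intros r hr; specialize (hsq r hr); lra. }
  lra.
- assert (h : g R2 <= g R1).
  { apply (nonincreasing_of_derive g (fun r => - (v r ^ 2 / r ^ (d - 1))));
      [lra|exact hg|].
    intros r hr; specialize (hsq r hr); lra. }
  lra.
Qed.

(** * Small wave numbers *)

Lemma at_right_intro (P : R -> Prop) (e : R) :
  0 < e -> (forall k, 0 < k < e -> P k) -> at_right 0 P.
Proof.
intros he h; exists (mkposreal e he); intros k hk hk0; apply h.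
change (Rabs (k - 0) < e) in hk; rewrite Rminus_0_r in hk.
apply Rabs_def2 in hk; lra.
Qed.

Lemma at_right00_intro (P : R * R -> Prop) (e : R) :
  0 < e -> (forall a1 a2, 0 < a1 < e -> 0 < a2 < e -> P (a1, a2)) ->
  at_right00 P.
Proof.
intros he h.
apply (Filter_prod _ _ P (fun a => 0 < a < e) (fun a => 0 < a < e)).
- apply (at_right_intro _ e he); auto.
- apply (at_right_intro _ e he); auto.
- exact h.
Qed.

Lemma Rabs_le_of_derive_bound (f f' : R -> R) (a b G : R) :
  (forall x, a <= x <= b -> is_derive f x (f' x)) -> f a = 0 ->
  (forall x, a <= x <= b -> Rabs (f' x) <= G) ->
  forall x, a <= x <= b -> Rabs (f x) <= G * (b - a).
Proof.
intros hf h0 hG x hx.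
assert (hG0 : 0 <= G).
{ apply Rle_trans with (Rabs (f' x)); [apply Rabs_pos|apply hG, hx]. }
assert (h1 : f a - G * a <= f x + G * x - 2 * (G * a)).
{ enough (f a + G * a <= f x + G * x) by lra.
  apply (nondecreasing_of_derive (fun x => f x + G * x) (fun x => f' x + G));
    [lra| |].
  - intros y hy; apply is_derive_Rplus.
    + apply hf; lra.
    + auto_derive; [exact I|ring].
  - intros y hy; assert (hy' : a <= y <= b) by lra; specialize (hG y hy').
    apply Rabs_le_between in hG; lra. }
assert (h2 : f x - G * x <= f a - G * a).
{ apply (nonincreasing_of_derive (fun x => f x - G * x) (fun x => f' x - G));
    [lra| |].
  - intros y hy; apply is_derive_Rminus.
    + apply hf; lra.
    + auto_derive; [exact I|ring].
  - intros y hy; assert (hy' : a <= y <= b) by lra; specialize (hG y hy').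
    apply Rabs_le_between in hG; lra. }
rewrite h0 in *.
assert (G * (x - a) <= G * (b - a)) by (apply Rmult_le_compat_l; lra).
apply Rabs_le; lra.
Qed.

(** Two integrations from zero data; this estimates each stage of the perturbation in [k ^ 2]. *)
Lemma flux_bound (a b G : R) (n : nat) (e E g : R -> R) :
  0 < a -> a <= b ->
  (forall r, a <= r <= b -> is_derive e r (E r / r ^ n) /\ is_derive E r (g r)) ->
  e a = 0 -> E a = 0 -> (forall r, a <= r <= b -> Rabs (g r) <= G) ->
  forall r, a <= r <= b ->
    Rabs (E r) <= G * (b - a) /\ Rabs (e r) <= G * (b - a) / a ^ n * (b - a).
Proof.
intros ha hab hd he hE hg.
assert (hEb : forall r, a <= r <= b -> Rabs (E r) <= G * (b - a)).
{ apply (Rabs_le_of_derive_bound E g); auto; intros; apply hd; assumption. }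
intros r hr; split; [apply hEb, hr|].
apply (Rabs_le_of_derive_bound e (fun r => E r / r ^ n) a b); auto.
- intros x hx; apply hd, hx.
- intros x hx; assert (hx0 : 0 < x) by lra; pose proof (pow_lt x n hx0).
  unfold Rdiv; rewrite Rabs_mult, (Rabs_right (/ x ^ n))
    by positivity.
  apply Rmult_le_compat; [apply Rabs_pos| |apply hEb, hx|].
  + positivity.
  + apply Rinv_le_contravar; [positivity|apply pow_incr; lra].
Qed.

Lemma primitive_exists (f : R -> R) (a : R) :
  0 < a -> (forall r, 0 < r -> continuity_pt f r) ->
  exists F : R -> R, F a = 0 /\ forall r, 0 < r -> is_derive F r (f r).
Proof.
intros ha hf; exists (fun r => RInt f a r); split.
- apply (RInt_point (V := R_CompleteNormedModule)).
- intros r hr; apply (is_derive_RInt (V := R_NormedModule) f (RInt f a) a r).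
  + exists (mkposreal r hr); intros y hy.
    change (Rabs (y - r) < r) in hy; apply Rabs_def2 in hy.
    apply (RInt_correct (V := R_CompleteNormedModule)).
    apply (ex_RInt_continuous (V := R_CompleteNormedModule)).
    intros z hz; apply continuity_pt_filterlim, hf.
    apply Rlt_le_trans with (2 := proj1 hz); apply Rmin_glb_lt; lra.
  + apply continuity_pt_filterlim, hf, hr.
Qed.

(** Perturbation of the solution [w0] at [k = 0]. For [k] below the first root the mode is positive,
    so its flux decreases and [0 <= w <= w0]; this a priori bound makes the errors after zero and
    one correction of order [k ^ 2] and [k ^ 4]. The function [h] is a logarithm for [d = 2] and a
    power otherwise. *)
Lemma Delta_small_k (d : nat) (R1 R2 a1 a2 : R) (h : R -> R) :
  (2 <= d)%nat -> 0 < R1 -> R1 < R2 -> 0 < a1 -> 0 < a2 ->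
  (forall r, 0 < r -> is_derive h r (/ r ^ (d - 1))) -> h R1 = 0 ->
  exists A2, bigO (at_right 0)
    (fun k => Delta_l d 0 R1 R2 a1 a2 k
              - (2 / PI * (a1 / R2 ^ (d - 1) + a2 / R1 ^ (d - 1) + a1 * a2 * h R2)
                 + A2 * k ^ 2))
    (fun k => k ^ 4).
Proof.
intros hd hR1 hR ha1 ha2 hh h0.
assert (hR2 : 0 < R2) by lra.
pose proof PI_RGT_0 as hpi.
pose proof (pow_lt R1 (d - 1) hR1) as hp1; pose proof (pow_lt R2 (d - 1) hR2) as hp2.
set (c0 := 2 / PI / R1 ^ (d - 1)); set (W0 := 2 / PI * a1).
assert (hW0 : 0 < W0)
  by (apply Rmult_lt_0_compat; [positivity|exact ha1]).
set (w0 := fun r => c0 + W0 * h r).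
assert (dw0 : forall r, 0 < r -> is_derive w0 r (W0 / r ^ (d - 1))).
{ intros r hr; evar_last.
  - apply is_derive_Rplus.
    + apply is_derive_Rconst.
    + apply is_derive_scal, hh, hr.
  - unfold Rdiv; ring. }
assert (cpow : forall r, continuity_pt (fun r => r ^ (d - 1)) r)
  by (intros; apply derivable_continuous_pt, derivable_pt_pow).
assert (cw0 : forall r, 0 < r -> continuity_pt w0 r)
  by (intros r hr; apply (is_derive_continuity w0 r _ (dw0 r hr))).
destruct (primitive_exists (fun r => - (r ^ (d - 1) * w0 r)) R1 hR1)
  as [W1 [W1i dW1]].
{ intros r hr; apply continuity_pt_opp, (continuity_pt_mult (fun r => r ^ (d - 1)));
    auto. }
destruct (primitive_exists (fun r => W1 r / r ^ (d - 1)) R1 hR1) as [w1 [w1i dw1]].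
{ intros r hr; apply (continuity_pt_div W1 (fun r => r ^ (d - 1))); auto.
  - apply (is_derive_continuity W1 r _ (dW1 r hr)).
  - apply pow_nonzero; lra. }
(* The boundary form at [R2] of the first correction [w1]. *)
exists (a2 * w1 R2 + W1 R2 / R2 ^ (d - 1)).
set (M := w0 R2).
assert (hw0M : forall r, R1 <= r <= R2 -> w0 r <= M).
{ intros r hr; apply (nondecreasing_of_derive w0 (fun r => W0 / r ^ (d - 1)));
    [lra|intros x hx; apply dw0; lra|].
  intros x hx; positivity. }
set (del := R2 - R1).
set (P := R2 ^ (d - 1)).
(* [K1] and [K2] are what [flux_bound] returns for the sources [k ^ 2 * P * M] and
   [k ^ 2 * P * (k ^ 2 * K1)], with the powers of [k] removed. *)
set (K1 := P * M * del / R1 ^ (d - 1) * del).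
set (K2 := P * K1 * del).
exists (a2 * (K2 / R1 ^ (d - 1) * del) + K2 / P).
destruct (kcl_spec d 0 R1 R2 a1 a2 hd hR1 hR ha1 ha2) as [hkc [_ [_ hbelow]]].
apply (at_right_intro _ _ hkc); intros k hk.
destruct (hbelow k hk) as [hpos _].
assert (hk0 : 0 < k) by lra.
set (w := mode d 0 R1 a1 k) in *; set (W := mode_flux d 0 R1 a1 k).
assert (dw : forall r, 0 < r -> is_derive w r (W r / r ^ (d - 1)) /\
  is_derive W r (- (k ^ 2 * (r ^ (d - 1) * w r)))).
{ intros r hr; destruct (is_derive_mode d 0 R1 a1 k r hd hk0 hr) as [d1 d2].
  split; [exact d1|].
  replace (- (k ^ 2 * (r ^ (d - 1) * w r))) with (- potential d 0 k r * w r);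
    [exact d2|].
  unfold potential; rewrite centrifugal_zero; field; lra. }
destruct (mode_initial d 0 R1 a1 k hd hk0 hR1) as [wi Wi].
fold w in wi; fold W in Wi; fold c0 in wi; fold W0 in Wi.
assert (hk2 : 0 <= k ^ 2) by positivity.
assert (hWle : forall r, R1 <= r <= R2 -> W r <= W0).
{ intros r hr; rewrite <- Wi.
  apply (nonincreasing_of_derive W (fun r => - (k ^ 2 * (r ^ (d - 1) * w r))));
    [lra|intros x hx; apply dw; lra|].
  intros x hx; assert (hx' : R1 <= x <= R2) by lra; specialize (hpos x hx').
  assert (0 <= x ^ (d - 1)) by positivity.
  assert (0 <= k ^ 2 * (x ^ (d - 1) * w x)) by positivity.
  lra. }
assert (hwle : forall r, R1 <= r <= R2 -> 0 <= w r <= M).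
{ intros r hr; split; [left; apply hpos, hr|].
  apply Rle_trans with (w0 r); [|apply hw0M, hr].
  enough (w r - w0 r <= w R1 - w0 R1)
    by (rewrite wi in *; unfold w0 in *; rewrite h0 in *; lra).
  apply (nonincreasing_of_derive (fun r => w r - w0 r)
           (fun r => W r / r ^ (d - 1) - W0 / r ^ (d - 1))); [lra| |].
  - intros x hx; apply is_derive_Rminus;
      [apply dw|apply dw0]; lra.
  - intros x hx; assert (hx' : R1 <= x <= R2) by lra; specialize (hWle x hx').
    assert (hx0 : 0 < x) by lra.
    replace (W x / x ^ (d - 1) - W0 / x ^ (d - 1))
      with (- ((W0 - W x) / x ^ (d - 1)))
      by positivity.
    assert (0 <= (W0 - W x) / x ^ (d - 1))
      by positivity.
    lra. }
assert (hP : forall r, R1 <= r <= R2 -> 0 <= r ^ (d - 1) <= P)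
  by (intros r hr; split; [positivity|apply pow_incr; lra]).
assert (hstep1 : forall r, R1 <= r <= R2 -> Rabs (w r - w0 r) <= k ^ 2 * K1).
{ intros r hr.
  replace (k ^ 2 * K1) with (k ^ 2 * (P * M) * del / R1 ^ (d - 1) * del)
    by (unfold K1; field; lra).
  apply (flux_bound R1 R2 (k ^ 2 * (P * M)) (d - 1) (fun r => w r - w0 r)
    (fun r => W r - W0) (fun r => - (k ^ 2 * (r ^ (d - 1) * w r)))); auto; try lra.
  - intros x hx; assert (hx0 : 0 < x) by lra; split.
    + replace ((W x - W0) / x ^ (d - 1))
        with (W x / x ^ (d - 1) - W0 / x ^ (d - 1)) by (unfold Rdiv; ring).
      apply is_derive_Rminus; [apply dw|apply dw0]; lra.
    + evar_last.
      * apply is_derive_Rminus;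
          [apply dw, hx0|apply is_derive_Rconst].
      * ring.
  - unfold w0; rewrite h0, wi; ring.
  - intros x hx; rewrite Rabs_Ropp, !Rabs_mult.
    specialize (hP x hx); specialize (hwle x hx).
    rewrite !Rabs_right by lra.
    apply Rmult_le_compat_l; [exact hk2|apply Rmult_le_compat; lra]. }
assert (hstep2 : Rabs (W R2 - W0 - k ^ 2 * W1 R2) <= (k ^ 2) ^ 2 * K2 /\
  Rabs (w R2 - w0 R2 - k ^ 2 * w1 R2) <= (k ^ 2) ^ 2 * (K2 / R1 ^ (d - 1) * del)).
{ replace ((k ^ 2) ^ 2 * (K2 / R1 ^ (d - 1) * del))
    with (k ^ 2 * (P * (k ^ 2 * K1)) * del / R1 ^ (d - 1) * del)
    by (unfold K2; field; lra).
  replace ((k ^ 2) ^ 2 * K2) with (k ^ 2 * (P * (k ^ 2 * K1)) * del)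
    by (unfold K2; ring).
  apply (flux_bound R1 R2 (k ^ 2 * (P * (k ^ 2 * K1))) (d - 1)
    (fun r => w r - w0 r - k ^ 2 * w1 r) (fun r => W r - W0 - k ^ 2 * W1 r)
    (fun r => - (k ^ 2 * (r ^ (d - 1) * (w r - w0 r))))); auto; try lra.
  - intros x hx; assert (hx0 : 0 < x) by lra; split.
    + replace ((W x - W0 - k ^ 2 * W1 x) / x ^ (d - 1))
        with (W x / x ^ (d - 1) - W0 / x ^ (d - 1) - k ^ 2 * (W1 x / x ^ (d - 1)))
        by (unfold Rdiv; ring).
      apply is_derive_Rminus.
      * apply is_derive_Rminus;
          [apply dw|apply dw0]; lra.
      * apply is_derive_scal, dw1, hx0.
    + evar_last.
      * apply is_derive_Rminus.
        -- apply is_derive_Rminus;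
             [apply dw, hx0|apply is_derive_Rconst].
        -- apply is_derive_scal, dW1, hx0.
      * ring.
  - unfold w0; rewrite h0, wi, w1i; ring.
  - rewrite Wi, W1i; ring.
  - intros x hx; rewrite Rabs_Ropp, !Rabs_mult.
    specialize (hP x hx).
    rewrite (Rabs_right (k ^ 2)), (Rabs_right (x ^ (d - 1))) by lra.
    apply Rmult_le_compat_l; [exact hk2|apply Rmult_le_compat; try lra].
    + apply Rabs_pos.
    + apply hstep1, hx. }
destruct hstep2 as [s1 s2].
rewrite Delta_mode by exact hR2; fold w W.
fold P.
replace (a2 * w R2 + W R2 / P -
  (2 / PI * (a1 / P + a2 / R1 ^ (d - 1) + a1 * a2 * h R2) +
   (a2 * w1 R2 + W1 R2 / P) * k ^ 2))
  with (a2 * (w R2 - w0 R2 - k ^ 2 * w1 R2) + (W R2 - W0 - k ^ 2 * W1 R2) / P).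
2:{ unfold w0, c0, W0, P; field; lra. }
rewrite (Rabs_right (k ^ 4)) by positivity.
eapply Rle_trans; [apply Rabs_triang|].
unfold Rdiv at 1; rewrite !Rabs_mult.
assert (hiP : 0 < / P) by positivity.
rewrite (Rabs_right a2), (Rabs_right (/ P)) by lra.
replace (k ^ 4) with ((k ^ 2) ^ 2) by ring.
assert (a2 * Rabs (w R2 - w0 R2 - k ^ 2 * w1 R2)
  <= a2 * ((k ^ 2) ^ 2 * (K2 / R1 ^ (d - 1) * del)))
  by (apply Rmult_le_compat_l; lra).
assert (Rabs (W R2 - W0 - k ^ 2 * W1 R2) * / P <= (k ^ 2) ^ 2 * K2 * / P)
  by (apply Rmult_le_compat_r; lra).
unfold Rdiv in *; lra.
Qed.

(** * The leading coefficient in dimension at least three *)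

Lemma rgamma_order_neq0 (d : nat) : (3 <= d)%nat -> rgamma (nu d + 1) <> 0.
Proof.
assert (hstep : forall z, 0 < z -> rgamma z <> 0 -> rgamma (z + 1) <> 0).
{ intros z hz h0 h1; apply h0; rewrite rgamma_rec, h1; ring. }
assert (h : forall n, rgamma (INR n + 1) <> 0 /\ rgamma (INR n + 1 / 2) <> 0).
{ induction n as [|n [h1 h2]].
  - simpl; rewrite !Rplus_0_l, rgamma_1; split; [lra|].
    intros h; pose proof rgamma_half as hh; rewrite h in hh.
    pose proof (Rinv_0_lt_compat _ PI_RGT_0); simpl in hh; lra.
  - rewrite S_INR; pose proof (pos_INR n); split.
    + apply hstep; [lra|exact h1].
    + replace (INR n + 1 + 1 / 2) with (INR n + 1 / 2 + 1) by ring.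
      apply hstep; [lra|exact h2]. }
intros hd; unfold nu.
destruct (Nat.Even_or_Odd d) as [[p ->]|[p ->]].
- destruct p as [|p]; [lia|].
  replace (INR (2 * S p) / 2 - 1 + 1) with (INR p + 1)
    by (rewrite mult_INR, (S_INR p); simpl (INR 2); field).
  apply h.
- replace (INR (2 * p + 1) / 2 - 1 + 1) with (INR p + 1 / 2)
    by (rewrite plus_INR, mult_INR; simpl (INR 2); simpl (INR 1); field).
  apply h.
Qed.

Lemma nu_pos (d : nat) : (3 <= d)%nat -> 0 < nu d.
Proof. intros hd; apply le_INR in hd; unfold nu; simpl in hd; lra. Qed.

Definition radial_primitive (d : nat) (R1 r : R) : R :=
  (Rpower R1 (- 2 * nu d) - Rpower r (- 2 * nu d)) / (2 * nu d).

Lemma is_derive_radial_primitive (d : nat) (R1 r : R) :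
  (3 <= d)%nat -> 0 < r ->
  is_derive (radial_primitive d R1) r (/ r ^ (d - 1)).
Proof.
intros hd hr; pose proof (nu_pos d hd).
replace (/ r ^ (d - 1)) with (Rpower r (- 2 * nu d) * / r).
- unfold radial_primitive, Rpower.
  auto_derive; [exact hr|field; lra].
- rewrite <- Rpower_pow by exact hr.
  rewrite <- Rpower_Ropp.
  rewrite <- (Rpower_1 r) at 2 by exact hr.
  rewrite <- Rpower_Ropp, <- Rpower_plus; f_equal.
  rewrite minus_INR by lia; unfold nu; simpl (INR 1); field.
Qed.

Lemma radial_primitive_pos (d : nat) (R1 R2 : R) :
  (3 <= d)%nat -> 0 < R1 -> R1 < R2 -> 0 < radial_primitive d R1 R2.
Proof.
intros hd hR1 hR.
replace 0 with (radial_primitive d R1 R1)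
  by (unfold radial_primitive, Rdiv; ring).
apply (increasing_of_derive _ (fun r => / r ^ (d - 1))); [exact hR| |].
- intros r hr; apply is_derive_radial_primitive; [exact hd|lra].
- intros r hr; positivity.
Qed.

(** Matches the coefficient written with Bessel asymptotics to the one found by perturbation. By
    [rgamma_rec] the product of the leading constants is [- 1 / (PI * nu d)], and dividing by [nu d]
    turns the bracket into the radial primitive. *)
Lemma A0_eq (d : nat) (R1 R2 a1 a2 : R) :
  (3 <= d)%nat -> 0 < R1 -> 0 < R2 ->
  A0 d R1 R2 a1 a2 =
  2 / PI * (a1 / R2 ^ (d - 1) + a2 / R1 ^ (d - 1)
            + a1 * a2 * radial_primitive d R1 R2).
Proof.
intros hd hR1 hR2; pose proof (nu_pos d hd) as hnu; pose proof PI_RGT_0.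
assert (hlead : lead_J (nu d) * lead_Y (nu d) = - / (PI * nu d)).
{ unfold lead_J, lead_Y; rewrite (rgamma_rec (nu d)).
  pose proof (rgamma_order_neq0 d hd); pose proof (Rpower_pos 2 (nu d)).
  field; repeat split; lra. }
assert (hp : forall r, 0 < r -> Rpower r (- 2 * nu d - 1) = / r ^ (d - 1)).
{ intros r hr; rewrite <- Rpower_pow, <- Rpower_Ropp by exact hr; f_equal.
  rewrite minus_INR by lia; unfold nu; simpl (INR 1); field. }
unfold A0; rewrite hlead, !hp by assumption; unfold radial_primitive.
pose proof (pow_lt R1 (d - 1) hR1); pose proof (pow_lt R2 (d - 1) hR2).
field; lra.
Qed.

Lemma bigO_of_correction (f : R -> R) (c A : R) :
  bigO (at_right 0) (fun k => f k - (c + A * k ^ 2)) (fun k => k ^ 4) ->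
  bigO (at_right 0) (fun k => f k - c) (fun k => k ^ 2).
Proof.
intros [M [e he]]; exists (Rabs M + Rabs A).
apply (at_right_intro _ (Rmin e 1)).
- apply Rmin_glb_lt; [apply cond_pos|lra].
- intros k hk; pose proof (Rmin_l e 1); pose proof (Rmin_r e 1).
  assert (hb : Rabs (f k - (c + A * k ^ 2)) <= M * Rabs (k ^ 4)).
  { apply he; [|lra]; change (Rabs (k - 0) < e).
    rewrite Rminus_0_r, Rabs_right; lra. }
  replace (f k - c) with (f k - (c + A * k ^ 2) + A * k ^ 2) by ring.
  eapply Rle_trans; [apply Rabs_triang|].
  rewrite (Rabs_mult A).
  pose proof (pow2_ge_0 k); rewrite (Rabs_right (k ^ 2)) by lra.
  rewrite (Rabs_right (k ^ 4)) in hb by positivity.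
  pose proof (Rle_abs M); pose proof (Rabs_pos M).
  assert (k ^ 2 <= 1) by (rewrite <- (pow1 2); apply pow_incr; lra).
  assert (k ^ 4 <= k ^ 2).
  { replace (k ^ 4) with (k ^ 2 * k ^ 2) by ring; nra. }
  assert (M * k ^ 4 <= Rabs M * k ^ 2) by nra.
  lra.
Qed.

Lemma bigO_limit (f : R -> R) (c : R) :
  bigO (at_right 0) (fun k => f k - c) (fun k => k ^ 2) ->
  bigO (at_right 0) f (fun _ => 1) /\ filterlim f (at_right 0) (locally c).
Proof.
intros [M [e he]].
assert (hM : 0 < Rabs M + 1) by (pose proof (Rabs_pos M); lra).
assert (hb : forall k, 0 < k < e -> k <= 1 -> Rabs (f k - c) <= (Rabs M + 1) * k).
{ intros k hk hk1.
  assert (hb : Rabs (f k - c) <= M * Rabs (k ^ 2)).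
  { apply he; [|lra]; change (Rabs (k - 0) < e).
    rewrite Rminus_0_r, Rabs_right; lra. }
  rewrite (Rabs_right (k ^ 2)) in hb by positivity.
  apply Rle_trans with (1 := hb); pose proof (Rle_abs M).
  assert (k ^ 2 <= k) by nra; assert (0 <= k ^ 2) by positivity.
  pose proof (Rabs_pos M); nra. }
pose proof (cond_pos e); split.
- exists (Rabs M + 1 + Rabs c); apply (at_right_intro _ (Rmin e 1)).
  { apply Rmin_glb_lt; lra. }
  intros k hk; pose proof (Rmin_l e 1); pose proof (Rmin_r e 1).
  assert (h : Rabs (f k - c) <= (Rabs M + 1) * k) by (apply hb; lra).
  rewrite Rabs_R1, Rmult_1_r.
  replace (f k) with (f k - c + c) by ring.
  eapply Rle_trans; [apply Rabs_triang|]; nra.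
- intros P [eps heps].
  apply (at_right_intro _ (Rmin (Rmin e 1) (eps / (Rabs M + 1)))).
  { pose proof (cond_pos eps).
    repeat apply Rmin_glb_lt; try lra; positivity. }
  intros k hk; apply heps; change (Rabs (f k - c) < eps).
  pose proof (Rmin_l (Rmin e 1) (eps / (Rabs M + 1))).
  pose proof (Rmin_r (Rmin e 1) (eps / (Rabs M + 1))).
  pose proof (Rmin_l e 1); pose proof (Rmin_r e 1).
  assert (h : Rabs (f k - c) <= (Rabs M + 1) * k) by (apply hb; lra).
  apply Rle_lt_trans with (1 := h).
  apply Rlt_le_trans with ((Rabs M + 1) * (eps / (Rabs M + 1))).
  + apply Rmult_lt_compat_l; lra.
  + right; field; lra.
Qed.

(** * Leading asymptotics of the threshold *)

(** Division of [kc_squared_bounds] by [N] leaves a relative error at most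
    [(R2 - R1) / R1 ^ (d - 1) * N], and [N <= R2 ^ (d - 2) * (a1 * R1 + a2 * R2)]. *)
Lemma kc2_lead_bounds (d : nat) (R1 R2 a1 a2 : R) :
  (2 <= d)%nat -> 0 < R1 -> R1 < R2 -> 0 < a1 -> 0 < a2 ->
  0 < kc2_lead d R1 R2 a1 a2 /\
  kc d R1 R2 a1 a2 ^ 2 <= kc2_lead d R1 R2 a1 a2 /\
  Rabs (kc d R1 R2 a1 a2 ^ 2 / kc2_lead d R1 R2 a1 a2 - 1)
    <= (R2 - R1) / R1 ^ (d - 1) * R2 ^ (d - 2) * (a1 * R1 + a2 * R2).
Proof.
intros hd hR1 hR ha1 ha2.
assert (hR2 : 0 < R2) by lra.
pose proof (kc_squared_bounds d R1 R2 a1 a2 hd hR1 hR ha1 ha2) as hb.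
simpl in hb; unfold kc2_lead.
set (N := a1 * R1 ^ (d - 1) + a2 * R2 ^ (d - 1)) in *.
pose proof (pow_lt R1 (d - 1) hR1) as hp1; pose proof (pow_lt R2 (d - 1) hR2) as hp2.
assert (hN : 0 < N)
  by (apply Rplus_lt_0_compat; positivity).
assert (hdn : 0 < INR d) by (apply lt_0_INR; lia).
assert (hpow : R1 ^ d < R2 ^ d).
{ apply (increasing_of_derive (fun r => r ^ d) (fun r => INR d * r ^ (d - 1)));
    [exact hR| |].
  - intros r _; auto_derive; [exact I|].
    replace (Init.Nat.pred d) with (d - 1)%nat by lia; ring.
  - intros r hr; positivity. }
set (X := R2 ^ d - R1 ^ d) in *.
assert (hX : 0 < X) by (unfold X; lra).
change (kc d R1 R2 a1 a2 * (kc d R1 R2 a1 a2 * 1)) with (kc d R1 R2 a1 a2 ^ 2) in hb.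
set (y := kc d R1 R2 a1 a2 ^ 2) in *.
split; [|split].
- positivity.
- apply Rmult_le_reg_r with (X / INR d); [positivity|].
  replace (INR d * N / X * (X / INR d)) with N by (field; lra).
  apply hb.
- assert (hc : 0 <= (R2 - R1) / R1 ^ (d - 1))
    by positivity.
  assert (hN2 : N <= R2 ^ (d - 2) * (a1 * R1 + a2 * R2)).
  { assert (hS : forall r, r ^ (d - 1) = r ^ (d - 2) * r).
    { intros r; replace (d - 1)%nat with (S (d - 2)) by lia; simpl; ring. }
    unfold N; rewrite !hS.
    assert (R1 ^ (d - 2) <= R2 ^ (d - 2)) by (apply pow_incr; lra).
    assert (0 < a1 * R1) by positivity.
    nra. }
  replace (y / (INR d * N / X) - 1) with (- ((N - y * (X / INR d)) / N))
    by (field; lra).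
  rewrite Rabs_Ropp, Rabs_right.
  + apply Rle_trans with ((R2 - R1) / R1 ^ (d - 1) * N).
    * apply Rmult_le_reg_r with N; [exact hN|].
      replace ((N - y * (X / INR d)) / N * N) with (N - y * (X / INR d))
        by (field; lra).
      unfold Rdiv in *; lra.
    * rewrite (Rmult_assoc _ (R2 ^ (d - 2))); apply Rmult_le_compat_l; assumption.
  + positivity.
Qed.

(** * Dimension three *)

Lemma nonneg_of_derive_nonneg (f f' : R -> R) (x : R) :
  0 <= x -> f 0 = 0 -> (forall y, is_derive f y (f' y)) ->
  (forall y, 0 <= y -> 0 <= f' y) -> 0 <= f x.
Proof.
intros hx h0 hf hf'; rewrite <- h0.
apply (nondecreasing_of_derive f f'); auto; intros; apply hf'; lra.
Qed.

(** Starting from [cos <= 1], each inequality is the derivative of the next one, which holds with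
    equality at [0]. *)
Lemma sin_cos_taylor (x : R) :
  0 <= x ->
  1 - x ^ 2 / 2 + x ^ 4 / 24 - x ^ 6 / 720 <= cos x
    <= 1 - x ^ 2 / 2 + x ^ 4 / 24 /\
  x - x ^ 3 / 6 + x ^ 5 / 120 - x ^ 7 / 5040 <= sin x
    <= x - x ^ 3 / 6 + x ^ 5 / 120.
Proof.
intros hx.
assert (s1 : forall y, 0 <= y -> 0 <= y - sin y).
{ intros y hy; apply (nonneg_of_derive_nonneg (fun y => y - sin y)
    (fun y => 1 - cos y)); [exact hy|rewrite sin_0; ring| |].
  - intros z; auto_derive; [exact I|ring].
  - intros z _; pose proof (COS_bound z); lra. }
assert (c1 : forall y, 0 <= y -> 0 <= cos y - (1 - y ^ 2 / 2)).
{ intros y hy; apply (nonneg_of_derive_nonneg (fun y => cos y - (1 - y ^ 2 / 2))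
    (fun y => y - sin y)); [exact hy|rewrite cos_0; field| |exact s1].
  intros z; auto_derive; [exact I|field]. }
assert (s2 : forall y, 0 <= y -> 0 <= sin y - (y - y ^ 3 / 6)).
{ intros y hy; apply (nonneg_of_derive_nonneg (fun y => sin y - (y - y ^ 3 / 6))
    (fun y => cos y - (1 - y ^ 2 / 2))); [exact hy|rewrite sin_0; field| |exact c1].
  intros z; auto_derive; [exact I|field]. }
assert (c2 : forall y, 0 <= y -> 0 <= 1 - y ^ 2 / 2 + y ^ 4 / 24 - cos y).
{ intros y hy; apply (nonneg_of_derive_nonneg
    (fun y => 1 - y ^ 2 / 2 + y ^ 4 / 24 - cos y)
    (fun y => sin y - (y - y ^ 3 / 6))); [exact hy|rewrite cos_0; field| |exact s2].
  intros z; auto_derive; [exact I|field]. }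
assert (s3 : forall y, 0 <= y -> 0 <= y - y ^ 3 / 6 + y ^ 5 / 120 - sin y).
{ intros y hy; apply (nonneg_of_derive_nonneg
    (fun y => y - y ^ 3 / 6 + y ^ 5 / 120 - sin y)
    (fun y => 1 - y ^ 2 / 2 + y ^ 4 / 24 - cos y));
    [exact hy|rewrite sin_0; field| |exact c2].
  intros z; auto_derive; [exact I|field]. }
assert (c3 : forall y, 0 <= y ->
  0 <= cos y - (1 - y ^ 2 / 2 + y ^ 4 / 24 - y ^ 6 / 720)).
{ intros y hy; apply (nonneg_of_derive_nonneg
    (fun y => cos y - (1 - y ^ 2 / 2 + y ^ 4 / 24 - y ^ 6 / 720))
    (fun y => y - y ^ 3 / 6 + y ^ 5 / 120 - sin y));
    [exact hy|rewrite cos_0; field| |exact s3].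
  intros z; auto_derive; [exact I|field]. }
assert (s4 : forall y, 0 <= y ->
  0 <= sin y - (y - y ^ 3 / 6 + y ^ 5 / 120 - y ^ 7 / 5040)).
{ intros y hy; apply (nonneg_of_derive_nonneg
    (fun y => sin y - (y - y ^ 3 / 6 + y ^ 5 / 120 - y ^ 7 / 5040))
    (fun y => cos y - (1 - y ^ 2 / 2 + y ^ 4 / 24 - y ^ 6 / 720)));
    [exact hy|rewrite sin_0; field| |exact c3].
  intros z; auto_derive; [exact I|field]. }
specialize (c2 x hx); specialize (c3 x hx); specialize (s3 x hx);
  specialize (s4 x hx); lra.
Qed.

(** The energy [g ^ 2 + k ^ 2 * f ^ 2] is conserved. *)
Lemma harmonic_uniqueness (f g : R -> R) (k a b : R) :
  a <= b -> 0 < k ->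
  (forall r, a <= r <= b -> is_derive f r (g r) /\ is_derive g r (- (k ^ 2 * f r))) ->
  f a = 0 -> g a = 0 -> f b = 0 /\ g b = 0.
Proof.
intros hab hk hd hf hg.
set (E := fun r => g r * g r + k ^ 2 * (f r * f r)).
assert (hE : E a = E b).
{ apply constant_of_derive; [exact hab|]; intros r hr; destruct (hd r hr) as [d1 d2].
  evar_last.
  - apply is_derive_Rplus.
    + apply is_derive_Rmult; exact d2.
    + apply is_derive_scal, (is_derive_Rmult f f); exact d1.
  - ring. }
unfold E in hE; rewrite hf, hg in hE.
assert (hk2 : 0 < k ^ 2) by positivity.
assert (hg0 : g b * g b = 0) by nra.
assert (hf0 : k ^ 2 * (f b * f b) = 0) by nra.
split.
- apply Rmult_integral in hf0; destruct hf0 as [h|h]; [lra|].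
  apply Rmult_integral in h; tauto.
- apply Rmult_integral in hg0; tauto.
Qed.

(** With [phi] the mode normalised by [phi R1 = 1], the function [r * phi r]
    solves [f'' = - k ^ 2 f] with initial data [R1] and [1 + a1 R1]. *)
Definition trig_det (R1 R2 a1 a2 k : R) : R :=
  - R1 * (k * sin (k * (R2 - R1))) + (1 + a1 * R1) * cos (k * (R2 - R1))
  + (a2 - 1 / R2) * (R1 * cos (k * (R2 - R1))
                     + (1 + a1 * R1) * (sin (k * (R2 - R1)) / k)).

(** In dimension three [r * mode] has constant coefficients, so uniqueness identifies it with a
    multiple [c0] of the trigonometric solution having the same data at [R1]. *)
Lemma Delta_three (R1 R2 a1 a2 k : R) :
  0 < R1 -> R1 < R2 -> 0 < k ->
  Delta_l 3 0 R1 R2 a1 a2 k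
  = 2 / (PI * R1 ^ 2 * R2) * trig_det R1 R2 a1 a2 k.
Proof.
intros hR1 hR hk; assert (hR2 : 0 < R2) by lra; pose proof PI_RGT_0.
assert (hd : (2 <= 3)%nat) by lia.
set (c0 := 2 / PI / R1 ^ 2).
set (w := mode 3 0 R1 a1 k); set (W := mode_flux 3 0 R1 a1 k).
set (X := fun r => R1 * cos (k * (r - R1)) + (1 + a1 * R1) * (sin (k * (r - R1)) / k)).
set (X' := fun r => - R1 * (k * sin (k * (r - R1)))
                    + (1 + a1 * R1) * cos (k * (r - R1))).
destruct (mode_initial 3 0 R1 a1 k hd hk hR1) as [wi Wi].
fold w in wi; fold W in Wi; simpl (3 - 1)%nat in wi.
destruct (harmonic_uniqueness (fun r => r * w r - c0 * X r)
  (fun r => w r + W r / r - c0 * X' r) k R1 R2) as [e1 e2]; [lra|exact hk| | | |].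
- intros r hr; assert (hr0 : 0 < r) by lra.
  destruct (is_derive_mode 3 0 R1 a1 k r hd hk hr0) as [d1 d2].
  fold w W in d1, d2; simpl (3 - 1)%nat in d1.
  assert (dX : is_derive X r (X' r)).
  { unfold X, X'; auto_derive; [exact I|unfold Rminus; field; lra]. }
  assert (dX' : is_derive X' r (- (k ^ 2 * X r))).
  { unfold X, X'; auto_derive; [exact I|unfold Rminus; field; lra]. }
  split.
  + evar_last.
    * apply is_derive_Rminus.
      -- apply is_derive_Rmult;
           [apply (is_derive_id (K := R_AbsRing))|exact d1].
      -- apply is_derive_scal, dX.
    * unfold minus, plus, opp, one; simpl; field; lra.
  + evar_last.
    * apply is_derive_Rminus.
      -- apply is_derive_Rplus;
           [exact d1|].
         apply (is_derive_Rmult W (fun r => / r) r (- potential 3 0 k r * w r)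
                  (- / r ^ 2));
           [exact d2|].
         auto_derive; [lra|field; lra].
      -- apply is_derive_scal, dX'.
    * unfold potential; rewrite centrifugal_zero; simpl.
      field; lra.
- unfold X; rewrite wi, Rminus_diag, Rmult_0_r, cos_0, sin_0.
  unfold c0; field; lra.
- unfold X'; rewrite wi, Wi, Rminus_diag, Rmult_0_r, cos_0, sin_0.
  unfold c0; field; lra.
- rewrite Delta_mode by exact hR2; fold w W.
  unfold trig_det; fold (X R2).
  change (- R1 * (k * sin (k * (R2 - R1))) + (1 + a1 * R1) * cos (k * (R2 - R1)))
    with (X' R2).
  assert (h1 : w R2 = c0 * X R2 / R2).
  { apply Rmult_eq_reg_l with R2; [|lra].
    transitivity (c0 * X R2); [lra|field; lra]. }
  assert (h2 : W R2 = R2 * (c0 * X' R2 - w R2)).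
  { apply Rmult_eq_reg_r with (/ R2); [|apply Rinv_neq_0_compat; lra].
    transitivity (c0 * X' R2 - w R2); [unfold Rdiv in e2; lra|field; lra]. }
  simpl (3 - 1)%nat; rewrite h2, h1; unfold c0; field; lra.
Qed.

(** [td0], [td1] and [td2] are the Taylor coefficients of [trig_det] at [k ^ 0], [k ^ 2] and
    [k ^ 4]. *)
Definition td0 (R1 R2 a1 a2 : R) : R :=
  1 + a1 * R1 + (a2 - 1 / R2) * (R1 + (1 + a1 * R1) * (R2 - R1)).
Definition td1 (R1 R2 a1 a2 : R) : R :=
  - R1 * (R2 - R1) - (1 + a1 * R1) * (R2 - R1) ^ 2 / 2
  + (a2 - 1 / R2) * (- R1 * (R2 - R1) ^ 2 / 2 - (1 + a1 * R1) * (R2 - R1) ^ 3 / 6).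
Definition td2 (R1 R2 a1 a2 : R) : R :=
  R1 * (R2 - R1) ^ 3 / 6 + (1 + a1 * R1) * (R2 - R1) ^ 4 / 24
  + (a2 - 1 / R2) * (R1 * (R2 - R1) ^ 4 / 24 + (1 + a1 * R1) * (R2 - R1) ^ 5 / 120).

(** A majorant of the remainder divided by [k ^ 6], uniform for impedances up to [A] and [k <= 1];
    this uniformity is what the threshold expansion requires. *)
Definition td_rem (R1 R2 A : R) : R :=
  R1 * (R2 - R1) ^ 5 / 120 + R1 * (R2 - R1) ^ 7 / 5040
  + (1 + A * R1) * (R2 - R1) ^ 6 / 720
  + (A + 1 / R2) * (R1 * (R2 - R1) ^ 6 / 720
                    + (1 + A * R1) * (R2 - R1) ^ 7 / 5040).

Lemma trig_det_expansion (R1 R2 A a1 a2 k : R) :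
  0 < R1 -> R1 < R2 -> 0 < a1 <= A -> 0 < a2 <= A -> 0 < k <= 1 ->
  Rabs (trig_det R1 R2 a1 a2 k
        - (td0 R1 R2 a1 a2 + td1 R1 R2 a1 a2 * k ^ 2 + td2 R1 R2 a1 a2 * k ^ 4))
    <= td_rem R1 R2 A * k ^ 6.
Proof.
intros hR1 hR ha1 ha2 hk.
set (de := R2 - R1).
assert (hde : 0 < de) by (unfold de; lra).
assert (hx : 0 <= k * de) by positivity.
destruct (sin_cos_taylor (k * de) hx) as [hc hs].
set (ec := cos (k * de) - (1 - k ^ 2 * de ^ 2 / 2 + k ^ 4 * de ^ 4 / 24)).
set (es := sin (k * de) / k - (de - k ^ 2 * de ^ 3 / 6 + k ^ 4 * de ^ 5 / 120)).
assert (hk6 : 0 < k ^ 6) by positivity.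
assert (hec : Rabs ec <= k ^ 6 * (de ^ 6 / 720)).
{ unfold ec; apply Rabs_le; rewrite !Rpow_mult_distr in hc; lra. }
assert (hes : Rabs es <= k ^ 6 * (de ^ 7 / 5040)).
{ assert (he : k * es = sin (k * de)
     - (k * de - (k * de) ^ 3 / 6 + (k * de) ^ 5 / 120)) by (unfold es; field; lra).
  assert (h : - (k * (k ^ 6 * (de ^ 7 / 5040))) <= k * es <= 0).
  { rewrite he; replace (k * (k ^ 6 * (de ^ 7 / 5040))) with ((k * de) ^ 7 / 5040)
      by field; lra. }
  assert (0 < de ^ 7) by positivity.
  assert (0 <= k ^ 6 * (de ^ 7 / 5040)) by positivity.
  apply Rabs_le; split; [|apply Rle_trans with 0; [|assumption]];
    apply Rmult_le_reg_l with k; lra. }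
(* Because [k * sin] is [k ^ 2 * (sin / k)], the last retained term of [sin / k] contributes at
   order [k ^ 6] here and joins the remainder. *)
replace (trig_det R1 R2 a1 a2 k
        - (td0 R1 R2 a1 a2 + td1 R1 R2 a1 a2 * k ^ 2 + td2 R1 R2 a1 a2 * k ^ 4))
  with (- (R1 * (k ^ 6 * (de ^ 5 / 120))) - R1 * k ^ 2 * es + (1 + a1 * R1) * ec
        + (a2 - 1 / R2) * (R1 * ec + (1 + a1 * R1) * es)).
2:{ unfold trig_det, td0, td1, td2, ec, es; fold de; field; lra. }
assert (hb : 0 < 1 + a1 * R1 <= 1 + A * R1) by (split; nra).
assert (hR2 : 0 < / R2) by positivity.
assert (hcc : Rabs (a2 - 1 / R2) <= A + 1 / R2) by (apply Rabs_le; lra).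
assert (hk2 : 0 <= k ^ 2 <= 1).
{ split; [positivity|rewrite <- (pow1 2); apply pow_incr; lra]. }
assert (t1 : Rabs (R1 * (k ^ 6 * (de ^ 5 / 120))) <= R1 * (k ^ 6 * (de ^ 5 / 120))).
{ assert (0 < de ^ 5) by positivity.
  rewrite Rabs_right; [lra|].
  positivity. }
assert (t2 : Rabs (R1 * k ^ 2 * es) <= R1 * (k ^ 6 * (de ^ 7 / 5040))).
{ rewrite !Rabs_mult, (Rabs_right R1), (Rabs_right (k ^ 2)) by lra.
  rewrite Rmult_assoc; apply Rmult_le_compat_l; [lra|].
  pose proof (Rabs_pos es); nra. }
assert (t3 : Rabs ((1 + a1 * R1) * ec) <= (1 + A * R1) * (k ^ 6 * (de ^ 6 / 720))).
{ rewrite Rabs_mult, (Rabs_right (1 + a1 * R1)) by lra.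
  apply Rmult_le_compat; [lra|apply Rabs_pos|lra|exact hec]. }
assert (t4 : Rabs (R1 * ec + (1 + a1 * R1) * es)
   <= R1 * (k ^ 6 * (de ^ 6 / 720)) + (1 + A * R1) * (k ^ 6 * (de ^ 7 / 5040))).
{ eapply Rle_trans; [apply Rabs_triang|].
  rewrite !Rabs_mult, (Rabs_right R1), (Rabs_right (1 + a1 * R1)) by lra.
  apply Rplus_le_compat.
  - apply Rmult_le_compat_l; [lra|exact hec].
  - apply Rmult_le_compat; [lra|apply Rabs_pos|lra|exact hes]. }
assert (t5 : Rabs ((a2 - 1 / R2) * (R1 * ec + (1 + a1 * R1) * es))
   <= (A + 1 / R2) * (R1 * (k ^ 6 * (de ^ 6 / 720))
                      + (1 + A * R1) * (k ^ 6 * (de ^ 7 / 5040)))).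
{ rewrite Rabs_mult; apply Rmult_le_compat; auto using Rabs_pos. }
eapply Rle_trans; [apply Rabs_triang|].
eapply Rle_trans; [apply Rplus_le_compat_r, Rabs_triang|].
eapply Rle_trans; [apply Rplus_le_compat_r, Rplus_le_compat_r, Rabs_triang|].
rewrite !Rabs_Ropp.
unfold td_rem; fold de; lra.
Qed.

Lemma td0_Cm1 (R1 R2 a1 a2 : R) :
  0 < R1 -> 0 < R2 -> td0 R1 R2 a1 a2 = R1 ^ 2 * R2 * Cm1 R1 R2 a1 a2.
Proof. intros; unfold td0, Cm1; field; lra. Qed.

(** The spherical prefactor splits into [sqrt (PI / (2 * k))], which enters squared, and
    [r ^ (- 1 / 2)], the weight of the unified normalisation. *)
Lemma Delta_sph_unified (R1 R2 a1 a2 k : R) :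
  0 < R1 -> 0 < R2 -> 0 < k ->
  Delta_sph 0 R1 R2 a1 a2 k = PI / (2 * k) * Delta_l 3 0 R1 R2 a1 a2 k.
Proof.
intros hR1 hR2 hk; pose proof PI_RGT_0.
assert (hs : forall r, 0 < r -> sqrt (PI / (2 * (k * r)))
   = sqrt (PI / (2 * k)) * Rpower r (- nu 3)).
{ intros r hr.
  replace (PI / (2 * (k * r))) with (PI / (2 * k) * / r) by (field; lra).
  rewrite sqrt_mult_alt by positivity; f_equal.
  rewrite <- Rpower_sqrt by positivity.
  unfold Rpower; rewrite ln_Rinv by exact hr; f_equal.
  unfold nu; simpl; field. }
assert (hq : sqrt (PI / (2 * k)) * sqrt (PI / (2 * k)) = PI / (2 * k))
  by (apply sqrt_sqrt; positivity).
assert (hord : INR 0 + 1 / 2 = INR 0 + nu 3) by (unfold nu; simpl; field).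
assert (hord1 : INR 1 + 1 / 2 = INR 0 + nu 3 + 1) by (unfold nu; simpl; field).
unfold Delta_sph, Delta_l, B1_sph, B2_sph, B1, B2, sph_j, sph_y.
rewrite !hs, hord, hord1 by assumption.
set (q := sqrt (PI / (2 * k))) in *; rewrite <- hq; ring.
Qed.

Lemma Delta_sph_expansion (R1 R2 a1 a2 : R) :
  0 < R1 -> R1 < R2 -> 0 < a1 -> 0 < a2 ->
  bigO (at_right 0)
    (fun k => Delta_sph 0 R1 R2 a1 a2 k
              - (Cm1 R1 R2 a1 a2 / k + td1 R1 R2 a1 a2 / (R1 ^ 2 * R2) * k))
    (fun k => k ^ 3).
Proof.
intros hR1 hR ha1 ha2; pose proof PI_RGT_0.
assert (hR2 : 0 < R2) by lra.
set (A := Rmax a1 a2).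
exists ((Rabs (td2 R1 R2 a1 a2) + td_rem R1 R2 A) / (R1 ^ 2 * R2)).
apply (at_right_intro _ 1); [lra|]; intros k hk.
assert (hk1 : 0 < k <= 1) by lra.
assert (hA1 : 0 < a1 <= A) by (split; [exact ha1|apply Rmax_l]).
assert (hA2 : 0 < a2 <= A) by (split; [exact ha2|apply Rmax_r]).
pose proof (trig_det_expansion R1 R2 A a1 a2 k hR1 hR hA1 hA2 hk1) as h.
rewrite Delta_sph_unified, Delta_three by lra.
set (rem := trig_det R1 R2 a1 a2 k
        - (td0 R1 R2 a1 a2 + td1 R1 R2 a1 a2 * k ^ 2 + td2 R1 R2 a1 a2 * k ^ 4)) in *.
pose proof (td0_Cm1 R1 R2 a1 a2 hR1 hR2) as h0.
assert (hc : 0 < R1 ^ 2 * R2)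
  by positivity.
replace (PI / (2 * k) * (2 / (PI * R1 ^ 2 * R2) * trig_det R1 R2 a1 a2 k)
  - (Cm1 R1 R2 a1 a2 / k + td1 R1 R2 a1 a2 / (R1 ^ 2 * R2) * k))
  with ((td2 R1 R2 a1 a2 * k ^ 4 + rem) / k / (R1 ^ 2 * R2)).
2:{ unfold rem; rewrite h0; field; lra. }
assert (hk3 : 0 < k ^ 3) by positivity.
unfold Rdiv at 1 2; rewrite !Rabs_mult.
rewrite (Rabs_right (/ k)), (Rabs_right (/ (R1 ^ 2 * R2))), (Rabs_right (k ^ 3))
  by positivity.
apply Rle_trans with ((Rabs (td2 R1 R2 a1 a2) + td_rem R1 R2 A) * k ^ 4
   * / k * / (R1 ^ 2 * R2)).
- apply Rmult_le_compat_r; [positivity|].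
  apply Rmult_le_compat_r; [positivity|].
  eapply Rle_trans; [apply Rabs_triang|].
  rewrite Rabs_mult, (Rabs_right (k ^ 4)) by positivity.
  assert (hrem : td_rem R1 R2 A * k ^ 6 <= td_rem R1 R2 A * k ^ 4).
  { assert (h6 : k ^ 6 <= k ^ 4).
    { replace (k ^ 6) with (k ^ 4 * k ^ 2) by ring.
      assert (k ^ 2 <= 1) by (rewrite <- (pow1 2); apply pow_incr; lra); nra. }
    assert (0 < k ^ 6) by positivity.
    pose proof (Rabs_pos rem).
    assert (0 <= td_rem R1 R2 A) by nra.
    apply Rmult_le_compat_l; assumption. }
  lra.
- right; field; lra.
Qed.

Lemma C1_limit (R1 R2 : R) :
  0 < R1 -> R1 < R2 ->
  bigO at_right00
    (fun a => td1 R1 R2 (fst a) (snd a) / (R1 ^ 2 * R2) - C1_0 R1 R2)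
    (fun a => fst a + snd a).
Proof.
intros hR1 hR; assert (hR2 : 0 < R2) by lra.
set (de := R2 - R1).
assert (hde : 0 < de) by (unfold de; lra).
set (K := R1 * de ^ 2 / 2 + (1 + R1) * de ^ 3 / 6 + R1 * de ^ 3 / 6 / R2).
exists (K / (R1 ^ 2 * R2)).
apply (at_right00_intro _ 1); [lra|]; intros a1 a2 ha1 ha2; simpl fst; simpl snd.
assert (hc : 0 < R1 ^ 2 * R2)
  by positivity.
replace (td1 R1 R2 a1 a2 / (R1 ^ 2 * R2) - C1_0 R1 R2)
  with ((a1 * (- (R1 * de ^ 2 / 2) + R1 * de ^ 3 / 6 / R2)
         + a2 * (- (R1 * de ^ 2 / 2) - (1 + a1 * R1) * de ^ 3 / 6))
        / (R1 ^ 2 * R2)) by (unfold td1, C1_0, de; field; lra).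
rewrite Rabs_div, (Rabs_right (R1 ^ 2 * R2)), (Rabs_right (a1 + a2)) by lra.
replace (K / (R1 ^ 2 * R2) * (a1 + a2)) with (K * (a1 + a2) / (R1 ^ 2 * R2))
  by (unfold Rdiv; ring).
apply (Rmult_le_compat_r (/ (R1 ^ 2 * R2)));
  [positivity|].
assert (h2 : 0 < R1 * de ^ 2) by positivity.
assert (hd3 : 0 < de ^ 3) by positivity.
assert (h3 : 0 < R1 * de ^ 3) by positivity.
assert (h4 : 0 < R1 * de ^ 3 / 6 / R2) by positivity.
assert (h5 : 0 <= (1 + a1 * R1) * de ^ 3 <= (1 + R1) * de ^ 3).
{ assert (0 < a1 * R1 <= R1) by (split; nra).
  split; [positivity|apply Rmult_le_compat_r; lra]. }
eapply Rle_trans; [apply Rabs_triang|].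
rewrite !Rabs_mult, (Rabs_right a1), (Rabs_right a2) by lra.
rewrite Rmult_plus_distr_l, !(Rmult_comm K).
apply Rplus_le_compat; apply Rmult_le_compat_l; try lra;
  apply Rabs_le; unfold K; lra.
Qed.

(** * Orders of vanishing in the two impedances *)

(** Explicit form of a bound of order [(a1 + a2) ^ n], with one nonnegative constant on a square, so
    that orders add under products and the expansion reduces to counting. *)
Definition vanishes (n : nat) (f : R -> R -> R) : Prop :=
  exists M e, 0 <= M /\ 0 < e /\ forall a1 a2, 0 < a1 < e -> 0 < a2 < e ->
    Rabs (f a1 a2) <= M * (a1 + a2) ^ n.

Lemma vanishes_ext (n : nat) (g f : R -> R -> R) :
  (forall a1 a2, 0 < a1 -> 0 < a2 -> g a1 a2 = f a1 a2) ->
  vanishes n g -> vanishes n f.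
Proof.
intros h [M [e [hM [he hg]]]]; exists M, e; split; [exact hM|split; [exact he|]].
intros a1 a2 h1 h2; rewrite <- h by lra; apply hg; assumption.
Qed.

Lemma vanishes_const (c : R) : vanishes 0 (fun _ _ => c).
Proof.
exists (Rabs c), 1; split; [apply Rabs_pos|split; [lra|]].
intros; simpl; lra.
Qed.

Lemma vanishes_fst : vanishes 1 (fun a1 _ => a1).
Proof.
exists 1, 1; split; [lra|split; [lra|]]; intros; rewrite Rabs_right; simpl; lra.
Qed.

Lemma vanishes_snd : vanishes 1 (fun _ a2 => a2).
Proof.
exists 1, 1; split; [lra|split; [lra|]]; intros; rewrite Rabs_right; simpl; lra.
Qed.

Lemma vanishes_plus (n : nat) (f g : R -> R -> R) :
  vanishes n f -> vanishes n g -> vanishes n (fun a1 a2 => f a1 a2 + g a1 a2).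
Proof.
intros [M [e [hM [he hf]]]] [M' [e' [hM' [he' hg]]]].
exists (M + M'), (Rmin e e'); split; [lra|split; [apply Rmin_glb_lt; assumption|]].
intros a1 a2 h1 h2; pose proof (Rmin_l e e'); pose proof (Rmin_r e e').
eapply Rle_trans; [apply Rabs_triang|].
rewrite Rmult_plus_distr_r; apply Rplus_le_compat; [apply hf|apply hg]; lra.
Qed.

Lemma vanishes_mult (n m : nat) (f g : R -> R -> R) :
  vanishes n f -> vanishes m g ->
  vanishes (n + m) (fun a1 a2 => f a1 a2 * g a1 a2).
Proof.
intros [M [e [hM [he hf]]]] [M' [e' [hM' [he' hg]]]].
exists (M * M'), (Rmin e e'); split; [positivity|].
split; [apply Rmin_glb_lt; assumption|].
intros a1 a2 h1 h2; pose proof (Rmin_l e e'); pose proof (Rmin_r e e').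
rewrite Rabs_mult, pow_add.
replace (M * M' * ((a1 + a2) ^ n * (a1 + a2) ^ m))
  with (M * (a1 + a2) ^ n * (M' * (a1 + a2) ^ m)) by ring.
apply Rmult_le_compat; try apply Rabs_pos; [apply hf|apply hg]; lra.
Qed.

Lemma vanishes_scal (n : nat) (c : R) (f : R -> R -> R) :
  vanishes n f -> vanishes n (fun a1 a2 => c * f a1 a2).
Proof. intros hf; apply (vanishes_mult 0 n _ _ (vanishes_const c) hf). Qed.

Lemma vanishes_le (n m : nat) (f : R -> R -> R) :
  (n <= m)%nat -> vanishes m f -> vanishes n f.
Proof.
intros hnm [M [e [hM [he hf]]]].
exists M, (Rmin e (1 / 2)); split; [exact hM|].
split; [apply Rmin_glb_lt; lra|].
intros a1 a2 h1 h2; pose proof (Rmin_l e (1 / 2)); pose proof (Rmin_r e (1 / 2)).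
apply Rle_trans with (M * (a1 + a2) ^ m); [apply hf; lra|].
apply Rmult_le_compat_l; [exact hM|].
replace m with (n + (m - n))%nat by lia; rewrite pow_add.
assert (0 <= (a1 + a2) ^ n) by positivity.
assert ((a1 + a2) ^ (m - n) <= 1) by (rewrite <- (pow1 (m - n)); apply pow_incr; lra).
nra.
Qed.

Lemma kc_trig_root (R1 R2 a1 a2 : R) :
  0 < R1 -> R1 < R2 -> 0 < a1 -> 0 < a2 ->
  0 < kc 3 R1 R2 a1 a2 /\ trig_det R1 R2 a1 a2 (kc 3 R1 R2 a1 a2) = 0.
Proof.
intros hR1 hR ha1 ha2; assert (hd : (2 <= 3)%nat) by lia; assert (hR2 : 0 < R2) by lra.
rewrite kc_eq_kcl_zero by assumption.
destruct (kcl_spec 3 0 R1 R2 a1 a2 hd hR1 hR ha1 ha2) as [hk [h0 _]].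
split; [exact hk|].
rewrite Delta_three in h0 by assumption.
apply Rmult_integral in h0; destruct h0 as [h0|h0]; [exfalso|exact h0].
pose proof PI_RGT_0.
assert (0 < 2 / (PI * R1 ^ 2 * R2)); [|lra].
apply Rdiv_lt_0_compat; [lra|].
positivity.
Qed.

Lemma cube_lt (R1 R2 : R) : 0 < R1 -> R1 < R2 -> 0 < R2 ^ 3 - R1 ^ 3.
Proof.
intros hR1 hR; replace (R2 ^ 3 - R1 ^ 3)
  with ((R2 - R1) * (R1 ^ 2 + R1 * R2 + R2 ^ 2)) by ring.
positivity.
Qed.

Lemma kc2_lead_three (R1 R2 a1 a2 : R) :
  0 < R1 -> R1 < R2 ->
  kc2_lead 3 R1 R2 a1 a2 = mu1 R1 R2 * a1 + mu2 R1 R2 * a2.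
Proof.
intros hR1 hR; pose proof (cube_lt R1 R2 hR1 hR).
unfold kc2_lead, mu1, mu2; simpl (3 - 1)%nat; simpl (INR 3).
field; lra.
Qed.

Lemma vanishes_linear (c1 c2 : R) : vanishes 1 (fun a1 a2 => c1 * a1 + c2 * a2).
Proof.
apply vanishes_plus; apply vanishes_scal; [apply vanishes_fst|apply vanishes_snd].
Qed.

(** The Rayleigh bound supplies the a priori size of the root. *)
Lemma vanishes_kc2 (R1 R2 : R) :
  0 < R1 -> R1 < R2 -> vanishes 1 (fun a1 a2 => kc 3 R1 R2 a1 a2 ^ 2).
Proof.
intros hR1 hR; assert (hd : (2 <= 3)%nat) by lia.
destruct (vanishes_linear (mu1 R1 R2) (mu2 R1 R2)) as [M [e [hM [he h]]]].
exists M, e; split; [exact hM|split; [exact he|]]; intros a1 a2 h1 h2.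
apply Rle_trans with (2 := h a1 a2 h1 h2).
destruct (kc2_lead_bounds 3 R1 R2 a1 a2 hd hR1 hR (proj1 h1) (proj1 h2))
  as [b1 [b2 _]].
rewrite kc2_lead_three in b1, b2 by assumption.
pose proof (pow2_ge_0 (kc 3 R1 R2 a1 a2)).
rewrite !Rabs_right by lra; exact b2.
Qed.

(** As [trig_det] vanishes at [kc], this is its Taylor remainder there. It has order [k ^ 6], hence
    order three in the impedances. *)
Definition kc_rem (R1 R2 a1 a2 : R) : R :=
  - (td0 R1 R2 a1 a2 + td1 R1 R2 a1 a2 * kc 3 R1 R2 a1 a2 ^ 2
     + td2 R1 R2 a1 a2 * (kc 3 R1 R2 a1 a2 ^ 2) ^ 2).

Lemma vanishes_kc_rem (R1 R2 : R) :
  0 < R1 -> R1 < R2 -> vanishes 3 (kc_rem R1 R2).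
Proof.
intros hR1 hR.
destruct (vanishes_kc2 R1 R2 hR1 hR) as [M [e [hM [he h]]]].
set (T := Rabs (td_rem R1 R2 1)).
assert (hT : 0 <= T) by apply Rabs_pos.
assert (hM1 : 0 < / (2 * (M + 1))) by positivity.
(* The last radius forces [M * (a1 + a2) <= 1], hence [kc <= 1], as [trig_det_expansion] demands. *)
exists (T * M ^ 3), (Rmin (Rmin e 1) (/ (2 * (M + 1)))).
split; [positivity|].
split; [repeat apply Rmin_glb_lt; lra|]; intros a1 a2 h1 h2.
pose proof (Rmin_l (Rmin e 1) (/ (2 * (M + 1)))).
pose proof (Rmin_r (Rmin e 1) (/ (2 * (M + 1)))).
pose proof (Rmin_l e 1); pose proof (Rmin_r e 1).
assert (ha1 : 0 < a1 <= 1) by lra; assert (ha2 : 0 < a2 <= 1) by lra.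
destruct (kc_trig_root R1 R2 a1 a2 hR1 hR (proj1 ha1) (proj1 ha2)) as [hk hroot].
assert (hl : Rabs (kc 3 R1 R2 a1 a2 ^ 2) <= M * (a1 + a2) ^ 1) by (apply h; lra).
rewrite pow_1 in hl.
set (k := kc 3 R1 R2 a1 a2) in *.
rewrite Rabs_right in hl by positivity.
assert (hs : M * (a1 + a2) <= 1).
{ assert (hs1 : (M + 1) * (a1 + a2) <= 1).
  { apply Rle_trans with ((M + 1) * (2 * / (2 * (M + 1)))).
    - apply Rmult_le_compat_l; lra.
    - right; field; lra. }
  nra. }
assert (hk1 : k <= 1) by nra.
pose proof (trig_det_expansion R1 R2 1 a1 a2 k hR1 hR ha1 ha2 (conj hk hk1)) as hexp.
rewrite hroot in hexp.
unfold kc_rem; fold k.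
replace (- (td0 R1 R2 a1 a2 + td1 R1 R2 a1 a2 * k ^ 2
            + td2 R1 R2 a1 a2 * (k ^ 2) ^ 2))
  with (0 - (td0 R1 R2 a1 a2 + td1 R1 R2 a1 a2 * k ^ 2
             + td2 R1 R2 a1 a2 * k ^ 4)) by ring.
apply Rle_trans with (1 := hexp).
assert (h6 : 0 <= k ^ 6 <= M ^ 3 * (a1 + a2) ^ 3).
{ split; [positivity|].
  replace (k ^ 6) with ((k ^ 2) ^ 3) by ring; rewrite <- Rpow_mult_distr.
  apply pow_incr; split; [positivity|exact hl]. }
rewrite Rmult_assoc.
pose proof (Rle_abs (td_rem R1 R2 1)) as hTr; fold T in hTr.
apply Rle_trans with (T * k ^ 6);
  [apply Rmult_le_compat_r|apply Rmult_le_compat_l]; lra.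
Qed.

(** The root equation reads [m * lam = E0 + (linear) * lam + ...]; inserting
    [lam = lead + rho] twice gives the quadratic coefficients. *)
Lemma vanishes_kc2_quad (R1 R2 : R) :
  0 < R1 -> R1 < R2 ->
  vanishes 3 (fun a1 a2 => kc 3 R1 R2 a1 a2 ^ 2 - kc2_quad R1 R2 a1 a2).
Proof.
intros hR1 hR; assert (hR2 : 0 < R2) by lra.
pose proof (cube_lt R1 R2 hR1 hR) as hD.
assert (hS : 0 < S3 R1 R2) by (unfold S3; nra).
set (de := R2 - R1).
(* [- m] and [e2] are the values of [td1] and [td2] at zero impedance, [F] is the linear part of
   [td1], and [G] is the variation of [td2]. The linear part of [td0] is [m * L]. *)
set (m := (R2 ^ 3 - R1 ^ 3) / (3 * R2)).
set (lam := fun a1 a2 => kc 3 R1 R2 a1 a2 ^ 2).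
set (L := fun a1 a2 => mu1 R1 R2 * a1 + mu2 R1 R2 * a2).
set (F := fun a1 a2 => (- R1 * de ^ 2 / 2 + R1 * de ^ 3 / (6 * R2)) * a1
                       + (- R1 * de ^ 2 / 2 - de ^ 3 / 6) * a2).
set (e2 := R1 * de ^ 3 / 6 + de ^ 4 / 24 - (R1 * de ^ 4 / 24 + de ^ 5 / 120) / R2).
set (G := fun a1 a2 =>
  ((R1 * de ^ 4 / 24 - R1 * de ^ 5 / (120 * R2)) * a1
   + (R1 * de ^ 4 / 24 + de ^ 5 / 120) * a2) + R1 * de ^ 5 / 120 * (a1 * a2)).
set (rho := fun a1 a2 => lam a1 a2 - L a1 a2).
assert (vlam : vanishes 1 lam) by (apply vanishes_kc2; assumption).
assert (vrem : vanishes 3 (kc_rem R1 R2)) by (apply vanishes_kc_rem; assumption).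
assert (vL : vanishes 1 L) by apply vanishes_linear.
assert (vF : vanishes 1 F) by apply vanishes_linear.
assert (v12 : vanishes 2 (fun a1 a2 => a1 * a2))
  by apply (vanishes_mult 1 1 _ _ vanishes_fst vanishes_snd).
assert (vG : vanishes 1 G).
{ apply vanishes_plus; [apply vanishes_linear|].
  apply vanishes_scal, (vanishes_le 1 2); [lia|exact v12]. }
assert (vlam2 : vanishes 2 (fun a1 a2 => lam a1 a2 * lam a1 a2))
  by apply (vanishes_mult 1 1 _ _ vlam vlam).
(* First pass: the root equation solved for [m * rho] has only terms of order at least two on the
   right. *)
assert (vrho : vanishes 2 rho).
{ apply (vanishes_ext 2 (fun a1 a2 => / m *
    (R1 * de * (a1 * a2) + (- R1 * de ^ 3 / 6) * (a1 * a2 * lam a1 a2)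
     + F a1 a2 * lam a1 a2 + e2 * (lam a1 a2 * lam a1 a2)
     + G a1 a2 * (lam a1 a2 * lam a1 a2) + kc_rem R1 R2 a1 a2))).
  - intros a1 a2 h1 h2; unfold rho, kc_rem, td0, td1, td2.
    change (kc 3 R1 R2 a1 a2 ^ 2) with (lam a1 a2).
    generalize (lam a1 a2); intros y.
    unfold L, F, G, e2, m, mu1, mu2, de; field; repeat split; lra.
  - apply vanishes_scal; repeat apply vanishes_plus.
    + apply vanishes_scal, v12.
    + apply vanishes_scal, (vanishes_le 2 3); [lia|].
      apply (vanishes_mult 2 1 _ _ v12 vlam).
    + apply (vanishes_mult 1 1 _ _ vF vlam).
    + apply vanishes_scal, vlam2.
    + apply (vanishes_le 2 3); [lia|apply (vanishes_mult 1 2 _ _ vG vlam2)].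
    + apply (vanishes_le 2 3); [lia|exact vrem]. }
(* Second pass: with [lam = L + rho] in [F * lam] and [e2 * lam ^ 2], the parts free of [rho],
   together with the bilinear term of [td0], are exactly the quadratic terms of [kc2_quad]. *)
apply (vanishes_ext 3 (fun a1 a2 => / m *
  ((- R1 * de ^ 3 / 6) * (a1 * a2 * lam a1 a2) + F a1 a2 * rho a1 a2
   + G a1 a2 * (lam a1 a2 * lam a1 a2) + (2 * e2) * (L a1 a2 * rho a1 a2)
   + e2 * (rho a1 a2 * rho a1 a2) + kc_rem R1 R2 a1 a2))).
- intros a1 a2 h1 h2; unfold rho, kc_rem, td0, td1, td2.
  change (kc 3 R1 R2 a1 a2 ^ 2) with (lam a1 a2).
  generalize (lam a1 a2); intros y.
  unfold kc2_quad, L, F, G, e2, m, mu1, mu2, nu1, nu2, nu12, de.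
  replace (R2 ^ 3 - R1 ^ 3) with ((R2 - R1) * S3 R1 R2) by (unfold S3; ring).
  unfold S3 in *; field; repeat split; lra.
- apply vanishes_scal; repeat apply vanishes_plus.
  + apply vanishes_scal, (vanishes_mult 2 1 _ _ v12 vlam).
  + apply (vanishes_mult 1 2 _ _ vF vrho).
  + apply (vanishes_mult 1 2 _ _ vG vlam2).
  + apply vanishes_scal, (vanishes_mult 1 2 _ _ vL vrho).
  + apply vanishes_scal, (vanishes_le 3 4); [lia|].
    apply (vanishes_mult 2 2 _ _ vrho vrho).
  + exact vrem.
Qed.

Lemma nu_signs (R1 R2 : R) :
  0 < R1 -> R1 < R2 -> nu1 R1 R2 < 0 /\ nu2 R1 R2 < 0 /\ 0 < nu12 R1 R2.
Proof.
intros hR1 hR; assert (hR2 : 0 < R2) by lra.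
assert (hS : 0 < 5 * S3 R1 R2 ^ 3).
{ apply Rmult_lt_0_compat; [lra|]; apply pow_lt; unfold S3; nra. }
pose proof (pow_lt R1 2 hR1); pose proof (pow_lt R2 2 hR2).
pose proof (pow_lt R1 3 hR1); pose proof (pow_lt R2 3 hR2).
assert (0 < R1 ^ 2 * R2) by positivity.
assert (0 < R1 * R2 ^ 2) by positivity.
assert (0 < R1 * R2) by positivity.
unfold nu1, nu2, nu12; split; [|split].
- apply Ropp_lt_gt_0_contravar, Rdiv_lt_0_compat; [|exact hS].
  positivity.
- apply Ropp_lt_gt_0_contravar, Rdiv_lt_0_compat; [|exact hS].
  positivity.
- apply Rdiv_lt_0_compat; [|exact hS].
  positivity.
Qed.

(** The expression is rational in [r1] with no pole at [0], so the limit is its value there. *)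
Lemma kc2_quad_ball_limit (R2 a1 a2 : R) :
  0 < R2 ->
  filterlim (fun r1 => kc2_quad r1 R2 a1 a2) (at_right 0)
    (locally (3 * a2 / R2 * (1 - a2 * R2 / 5))).
Proof.
intros hR2.
replace (3 * a2 / R2 * (1 - a2 * R2 / 5)) with (kc2_quad 0 R2 a1 a2).
2:{ unfold kc2_quad, mu1, mu2, nu1, nu2, nu12, S3; field; lra. }
assert (hc : continuous (fun r1 => kc2_quad r1 R2 a1 a2) 0).
{ apply (ex_derive_continuous (V := R_NormedModule)).
  pose proof (pow_lt R2 2 hR2) as h2; pose proof (pow_lt R2 3 hR2) as h3.
  assert (hS : 5 * S3 0 R2 ^ 3 <> 0).
  { apply Rgt_not_eq, Rmult_lt_0_compat; [lra|]; apply pow_lt; unfold S3; lra. }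
  unfold kc2_quad, mu1, mu2, nu1, nu2, nu12, S3 in *; auto_derive.
  simpl in *; repeat split; try assumption; lra. }
intros P hP; specialize (hc P hP); destruct hc as [e he].
exists e; intros y hy _; apply he, hy.
Qed.

(** * The ball *)

(** [sqrt x * J_{1/2} x] and [sqrt x * J_{-1/2} x] are multiples of [sin] and
    [cos]: written through their power series they solve [f' = g, g' = - f] on
    the whole line. *)
Lemma besselJ_half (x : R) :
  0 < x ->
  Rpower x (1 / 2) * besselJ (1 / 2) x = sqrt 2 * rgamma (1 / 2) * sin x /\
  Rpower x (1 / 2) * besselJ (1 / 2 - 1) x = sqrt 2 * rgamma (1 / 2) * cos x.
Proof.
intros hx.
assert (h2 : sqrt 2 * sqrt 2 = 2) by (apply sqrt_sqrt; lra).
assert (hs2 : 0 < sqrt 2) by (apply sqrt_lt_R0; lra).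
set (f := fun y => y / sqrt 2 * PSeries (bessel_coef (1 / 2)) ((y / 2) ^ 2)).
set (g := fun y => sqrt 2 * PSeries (bessel_coef (1 / 2 - 1)) ((y / 2) ^ 2)).
assert (hsq : forall y, is_derive (fun y => (y / 2) ^ 2) y (y / 2)).
{ intros y; auto_derive; [exact I|field]. }
assert (df : forall y, is_derive f y (g y)).
{ intros y; evar_last.
  - apply (is_derive_Rmult (fun y => y / sqrt 2)
      (fun y => PSeries (bessel_coef (1 / 2)) ((y / 2) ^ 2)) y (/ sqrt 2)).
    + auto_derive; [lra|field; lra].
    + apply (is_derive_Rcomp (PSeries (bessel_coef (1 / 2))) (fun y => (y / 2) ^ 2));
        [apply is_derive_bessel_pseries|apply hsq].
  - unfold g; rewrite (bessel_pseries_rec (1 / 2)).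
    replace (sqrt 2) with (2 / sqrt 2) at 3 by (rewrite <- h2 at 1; field; lra).
    field; lra. }
assert (dg : forall y, is_derive g y (- f y)).
{ intros y; evar_last.
  - apply is_derive_scal.
    apply (is_derive_Rcomp (PSeries (bessel_coef (1 / 2 - 1)))
             (fun y => (y / 2) ^ 2)); [apply is_derive_bessel_pseries|apply hsq].
  - unfold f; replace (1 / 2 - 1 + 1) with (1 / 2) by field.
    replace (sqrt 2) with (2 / sqrt 2) at 1 by (rewrite <- h2 at 1; field; lra).
    field; lra. }
set (c := sqrt 2 * rgamma (1 / 2)).
assert (f0 : f 0 = 0) by (unfold f, Rdiv; ring).
assert (g0 : g 0 = c).
{ unfold g, c; replace ((0 / 2) ^ 2) with 0 by field.
  rewrite PSeries_0; unfold bessel_coef; simpl.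
  replace (1 / 2 - 1 + 0 + 1) with (1 / 2) by field; field. }
destruct (harmonic_uniqueness (fun y => f y - c * sin y) (fun y => g y - c * cos y)
  1 0 x) as [e1 e2]; [lra|lra| | | |].
- intros y _; split.
  + apply is_derive_Rminus;
      [apply df|apply is_derive_scal].
    apply is_derive_Reals, derivable_pt_lim_sin.
  + evar_last.
    * apply is_derive_Rminus;
        [apply dg|apply is_derive_scal].
      apply is_derive_Reals, derivable_pt_lim_cos.
    * ring.
- rewrite f0, sin_0; ring.
- rewrite g0, cos_0; ring.
- assert (hq : Rpower x (1 / 2) = sqrt x)
    by (replace (1 / 2) with (/ 2) by field; apply Rpower_sqrt, hx).
  assert (hq2 : Rpower (x / 2) (1 / 2) = sqrt x / sqrt 2).
  { replace (1 / 2) with (/ 2) by field; rewrite Rpower_sqrt by lra.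
    apply sqrt_div_alt; lra. }
  assert (hxx : sqrt x * sqrt x = x) by (apply sqrt_sqrt; lra).
  assert (hsx : 0 < sqrt x) by (apply sqrt_lt_R0, hx).
  rewrite !besselJ_pseries, hq; split.
  + rewrite hq2; transitivity (f x); [unfold f|lra].
    replace (x / sqrt 2) with (sqrt x * (sqrt x / sqrt 2));
      [ring|rewrite <- hxx at 3; field; lra].
  + assert (hq3 : Rpower (x / 2) (1 / 2 - 1) = sqrt 2 / sqrt x).
    { replace (1 / 2 - 1) with (- (1 / 2)) by field.
      rewrite Rpower_Ropp, hq2; field; lra. }
    rewrite hq3; transitivity (g x); [unfold g; field; lra|lra].
Qed.

(** The recurrence expresses [J_(3/2)] by [J_(1/2)] and [J_(-1/2)]. The common factor is nonzero
    because [rgamma (1 / 2) ^ 2 = / PI]. *)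
Lemma ball_zero_iff (R2 a2 k : R) :
  0 < R2 -> 0 < k ->
  (B2_sph sph_j 0 R2 a2 k = 0 <->
   k * R2 * cos (k * R2) - (1 - a2 * R2) * sin (k * R2) = 0).
Proof.
intros hR2 hk.
assert (hx : 0 < k * R2) by positivity.
destruct (besselJ_half (k * R2) hx) as [h1 h2].
pose proof (besselJ_rec (1 / 2) (k * R2) hx) as hr.
set (x := k * R2) in *; set (c := sqrt 2 * rgamma (1 / 2)) in *.
assert (hc : c <> 0).
{ unfold c; intros h; apply Rmult_integral in h.
  assert (0 < sqrt 2) by (apply sqrt_lt_R0; lra).
  destruct h as [h|h]; [lra|].
  pose proof rgamma_half as hh; rewrite h in hh.
  pose proof (Rinv_0_lt_compat _ PI_RGT_0); simpl in hh; lra. }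
set (p := Rpower x (1 / 2)) in *.
assert (hp : 0 < p) by apply Rpower_pos.
set (q := sqrt (PI / (2 * x))).
assert (hq : 0 < q).
{ apply sqrt_lt_R0, Rdiv_lt_0_compat; [apply PI_RGT_0|lra]. }
assert (heq : B2_sph sph_j 0 R2 a2 k
  = q * c / (p * R2) * (x * cos x - (1 - a2 * R2) * sin x)).
{ unfold B2_sph, sph_j; fold x; fold q.
  replace (INR 0 + 1 / 2) with (1 / 2) by (simpl; ring).
  replace (INR 1 + 1 / 2) with (1 / 2 + 1) by (simpl; ring).
  assert (hj : besselJ (1 / 2) x = c * sin x / p) by (rewrite <- h1; field; lra).
  assert (hj' : besselJ (1 / 2 - 1) x = c * cos x / p) by (rewrite <- h2; field; lra).
  assert (hj1 : besselJ (1 / 2 + 1) x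
    = 2 * (1 / 2) / x * besselJ (1 / 2) x - besselJ (1 / 2 - 1) x) by lra.
  rewrite hj1, hj, hj'; simpl INR.
  replace k with (x / R2) by (unfold x; field; lra).
  field; repeat split; lra. }
assert (hf : q * c / (p * R2) <> 0).
{ apply Rmult_integral_contrapositive_currified.
  - apply Rmult_integral_contrapositive_currified; [lra|exact hc].
  - apply Rinv_neq_0_compat, Rgt_not_eq, Rmult_lt_0_compat; assumption. }
rewrite heq; split; intros h.
- apply Rmult_integral in h; destruct h; [contradiction|assumption].
- rewrite h; ring.
Qed.

(** [G] is the Taylor polynomial in [y = x ^ 2] of the determinant divided by [x]; the cubic errors
    come from the last terms of the [cos] and [sin] bounds. *)
Lemma ball_det_bounds (be x : R) :
  0 < be <= 1 -> 0 < x ->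
  let y := x ^ 2 in
  let G := be - y / 3 - be * y / 6 + y ^ 2 / 30 + be * y ^ 2 / 120 in
  x * (G - y ^ 3 / 720) <= x * cos x - (1 - be) * sin x
    <= x * (G + y ^ 3 / 5040).
Proof.
intros hb hx y G.
destruct (sin_cos_taylor x (Rlt_le _ _ hx)) as [[c1 c2] [s1 s2]].
assert (m1 : x * (1 - x ^ 2 / 2 + x ^ 4 / 24 - x ^ 6 / 720) <= x * cos x)
  by (apply Rmult_le_compat_l; lra).
assert (m2 : x * cos x <= x * (1 - x ^ 2 / 2 + x ^ 4 / 24))
  by (apply Rmult_le_compat_l; lra).
assert (m3 : (1 - be) * (x - x ^ 3 / 6 + x ^ 5 / 120 - x ^ 7 / 5040)
             <= (1 - be) * sin x) by (apply Rmult_le_compat_l; lra).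
assert (m4 : (1 - be) * sin x <= (1 - be) * (x - x ^ 3 / 6 + x ^ 5 / 120))
  by (apply Rmult_le_compat_l; lra).
assert (m5 : 0 <= be * (x ^ 7 / 5040)) by positivity.
unfold G, y; split.
- replace (x * (be - x ^ 2 / 3 - be * x ^ 2 / 6 + (x ^ 2) ^ 2 / 30
      + be * (x ^ 2) ^ 2 / 120 - (x ^ 2) ^ 3 / 720))
    with (x * (1 - x ^ 2 / 2 + x ^ 4 / 24 - x ^ 6 / 720)
          - (1 - be) * (x - x ^ 3 / 6 + x ^ 5 / 120)) by field.
  lra.
- replace (x * (be - x ^ 2 / 3 - be * x ^ 2 / 6 + (x ^ 2) ^ 2 / 30
      + be * (x ^ 2) ^ 2 / 120 + (x ^ 2) ^ 3 / 5040))
    with (x * (1 - x ^ 2 / 2 + x ^ 4 / 24)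
          - (1 - be) * (x - x ^ 3 / 6 + x ^ 5 / 120 - x ^ 7 / 5040)
          + be * (x ^ 7 / 5040)) by field.
  lra.
Qed.

(** To leading order [x ^ 2] is [3 * be]. Accordingly the determinant is positive up to [x ^ 2 = be]
    and nonpositive at [x ^ 2 = 4 * be], which brackets the first root. *)
Lemma kc_ball_root (R2 a2 : R) :
  0 < R2 -> 0 < a2 -> a2 * R2 <= 1 / 10 ->
  let be := a2 * R2 in
  let x := kc_ball R2 a2 * R2 in
  be <= x ^ 2 <= 4 * be /\ 0 < x /\ x * cos x - (1 - be) * sin x = 0.
Proof.
intros hR2 ha2 hsmall be.
assert (hb : 0 < be <= 1 / 10)
  by (unfold be; split; [positivity|exact hsmall]).
set (T := fun x => x * cos x - (1 - be) * sin x).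
assert (hsb : sqrt be * sqrt be = be) by (apply sqrt_sqrt; lra).
assert (hs0 : 0 < sqrt be) by (apply sqrt_lt_R0; lra).
assert (hpos : forall x, 0 < x <= sqrt be -> 0 < T x).
{ intros x hx; assert (hb1 : 0 < be <= 1) by lra.
  destruct (ball_det_bounds be x hb1 (proj1 hx)) as [hlo _]; cbv zeta in hlo.
  assert (hy : 0 < x ^ 2 <= be) by (split; [positivity|nra]).
  set (y := x ^ 2) in *.
  apply Rlt_le_trans with (2 := hlo); apply Rmult_lt_0_compat; [apply hx|].
  assert (0 <= y ^ 2) by positivity.
  assert (y ^ 3 <= y ^ 2) by (replace (y ^ 3) with (y * y ^ 2) by ring; nra).
  assert (0 <= be * y ^ 2) by positivity.
  assert (be * y <= be) by nra.
  lra. }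
assert (hneg : T (2 * sqrt be) <= 0).
{ assert (hb1 : 0 < be <= 1) by lra.
  assert (hx : 0 < 2 * sqrt be) by lra.
  destruct (ball_det_bounds be _ hb1 hx) as [_ hhi]; cbv zeta in hhi.
  replace ((2 * sqrt be) ^ 2) with (4 * be) in hhi by (rewrite <- hsb at 1; ring).
  apply Rle_trans with (1 := hhi).
  assert (hG : be - 4 * be / 3 - be * (4 * be) / 6 + (4 * be) ^ 2 / 30
     + be * (4 * be) ^ 2 / 120 + (4 * be) ^ 3 / 5040 <= 0).
  { replace (be - 4 * be / 3 - be * (4 * be) / 6 + (4 * be) ^ 2 / 30
       + be * (4 * be) ^ 2 / 120 + (4 * be) ^ 3 / 5040)
      with (be * (- (1 / 3) + be * (- (2 / 3) + 16 / 30)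
                  + be * be * (16 / 120 + 64 / 5040))) by field.
    assert (be * be <= 1 / 100) by nra.
    nra. }
  nra. }
assert (hTc : forall x, continuity_pt T x).
{ intros x; apply (is_derive_continuity T x (cos x - x * sin x - (1 - be) * cos x)).
  unfold T; auto_derive; [exact I|ring]. }
destruct (first_zero T (sqrt be) (2 * sqrt be)) as [c [hc [hc0 hcpos]]]; try lra.
{ intros; apply hTc. }
{ apply hpos; lra. }
assert (hkc : kc_ball R2 a2 = c / R2).
{ apply first_positive_root_unique.
  - positivity.
  - apply ball_zero_iff; [exact hR2|positivity|].
    replace (c / R2 * R2) with c by (field; lra); exact hc0.
  - intros k hk h.
    assert (hkR : 0 < k * R2 < c).
    { split; [positivity|].
      apply Rmult_lt_reg_r with (/ R2); [positivity|].
      rewrite Rmult_assoc, Rinv_r, Rmult_1_r by lra; apply hk. }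
    apply ball_zero_iff in h; [|exact hR2|lra].
    change (T (k * R2) = 0) in h.
    destruct (Rle_dec (k * R2) (sqrt be)) as [h'|h'].
    + assert (0 < T (k * R2)) by (apply hpos; lra); lra.
    + assert (0 < T (k * R2)) by (apply hcpos; lra); lra. }
cbv zeta; rewrite hkc; replace (c / R2 * R2) with c by (field; lra).
split; [split; nra|split; [lra|exact hc0]].
Qed.

Lemma kc_ball_expansion (R2 : R) :
  0 < R2 ->
  bigO (at_right 0)
    (fun a2 => kc_ball R2 a2 ^ 2 / (3 * a2 / R2) - (1 - a2 * R2 / 5))
    (fun a2 => a2 ^ 2).
Proof.
intros hR2; exists (10 * R2 ^ 2).
apply (at_right_intro _ (/ (10 * R2))).
{ positivity. }
intros a2 ha2.
assert (hsmall : a2 * R2 <= 1 / 10).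
{ apply Rle_trans with (/ (10 * R2) * R2);
    [apply Rmult_le_compat_r; lra|right; field; lra]. }
destruct (kc_ball_root R2 a2 hR2 (proj1 ha2) hsmall) as [hy [hx h0]].
cbv zeta in hy, hx, h0.
set (be := a2 * R2) in *; set (x := kc_ball R2 a2 * R2) in *.
assert (hb : 0 < be <= 1 / 10)
  by (unfold be; split; [positivity|exact hsmall]).
assert (hb1 : 0 < be <= 1) by lra.
destruct (ball_det_bounds be x hb1 hx) as [hlo hhi]; cbv zeta in hlo, hhi.
rewrite h0 in hlo, hhi.
replace (kc_ball R2 a2 ^ 2 / (3 * a2 / R2) - (1 - be / 5))
  with ((x ^ 2 - 3 * be * (1 - be / 5)) / (3 * be))
  by (unfold x, be; field; lra).
set (y := x ^ 2) in *.
set (G := be - y / 3 - be * y / 6 + y ^ 2 / 30 + be * y ^ 2 / 120) in *.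
assert (hG1 : G <= y ^ 3 / 720).
{ apply Rmult_le_reg_l with x; [exact hx|]; lra. }
assert (hG2 : - (y ^ 3 / 5040) <= G).
{ apply Rmult_le_reg_l with x; [exact hx|]; lra. }
assert (hbb : 0 < be * be) by positivity.
assert (hy2 : y ^ 2 <= 16 * (be * be)) by (simpl; nra).
assert (hy2p : 0 <= y ^ 2) by positivity.
assert (hb3 : be * (be * be) <= 1 / 10 * (be * be)) by (apply Rmult_le_compat_r; lra).
assert (hy3 : 0 <= y ^ 3 <= 64 * (be * (be * be))).
{ replace (y ^ 3) with (y * y ^ 2) by ring; split; [positivity|].
  replace (64 * (be * (be * be))) with (4 * be * (16 * (be * be))) by ring.
  apply Rmult_le_compat; lra. }
assert (hby : 0 <= be * y <= 4 * (be * be)) by (split; nra).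
assert (hby2 : 0 <= be * y ^ 2 <= 16 * (be * (be * be))) by (split; nra).
set (u := y - 3 * be).
(* First pass: the bracketing alone determines [y] up to an error of order [be ^ 2]. *)
assert (hu : Rabs u <= 3 * (be * be)).
{ unfold u; apply Rabs_le; unfold G in *; split; lra. }
assert (hmain : Rabs (y - 3 * be * (1 - be / 5)) <= 6 * (be * (be * be))).
(* Second pass: an exact identity in [y = 3 * be + u], whose right side has only terms of order
   [be ^ 3], since [G] is bounded by multiples of [y ^ 3]. *)
{ assert (e : y - 3 * be * (1 - be / 5)
     = be * u / 10 + u * u / 10 + be * y ^ 2 / 40 - 3 * G).
  { unfold G, u; field. }
  rewrite e.
  apply Rabs_le_between in hu.
  assert (- (3 * (be * (be * be))) <= be * u <= 3 * (be * (be * be)))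
    by (split; nra).
  assert (0 <= u * u <= be * (be * be)).
  { split; [nra|].
    assert (u * u <= 9 * ((be * be) * (be * be))) by nra.
    assert ((be * be) * (be * be) <= 1 / 10 * (be * (be * be)))
      by (replace ((be * be) * (be * be)) with (be * (be * (be * be))) by ring;
          apply Rmult_le_compat_r; lra).
    lra. }
  apply Rabs_le; split; lra. }
rewrite Rabs_div by lra.
rewrite (Rabs_right (3 * be)), (Rabs_right (a2 ^ 2))
  by positivity.
apply Rmult_le_reg_r with (3 * be); [lra|].
unfold Rdiv; rewrite Rmult_assoc, Rinv_l, Rmult_1_r by lra.
apply Rle_trans with (1 := hmain).
replace (10 * R2 ^ 2 * a2 ^ 2 * (3 * be)) with (30 * (be * (be * be)))
  by (unfold be; ring).
lra.
Qed.

(** * Signs and small-wave-number expansions in the required normalisations *)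

Lemma Cm1_pos (R1 R2 a1 a2 : R) :
  0 < R1 -> R1 < R2 -> 0 < a1 -> 0 < a2 -> 0 < Cm1 R1 R2 a1 a2.
Proof.
intros hR1 hR ha1 ha2; assert (hR2 : 0 < R2) by lra; unfold Cm1.
assert (0 < a1 * a2) by positivity.
assert (0 < R1 * R2) by positivity.
repeat apply Rplus_lt_0_compat; apply Rdiv_lt_0_compat;
  try assumption; try (apply pow_lt; assumption).
positivity.
Qed.

Lemma C1_0_neg (R1 R2 : R) : 0 < R1 -> R1 < R2 -> C1_0 R1 R2 < 0.
Proof.
intros hR1 hR; pose proof (cube_lt R1 R2 hR1 hR) as hc.
assert (hp : 0 < 3 * R1 ^ 2 * R2 ^ 2)
  by positivity.
unfold C1_0; unfold Rdiv; rewrite Ropp_mult_distr_l_reverse.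
apply Ropp_lt_gt_0_contravar, Rmult_lt_0_compat;
  [exact hc|positivity].
Qed.

Lemma A0_pos (d : nat) (R1 R2 a1 a2 : R) :
  (3 <= d)%nat -> 0 < R1 -> R1 < R2 -> 0 < a1 -> 0 < a2 ->
  0 < A0 d R1 R2 a1 a2.
Proof.
intros hd hR1 hR ha1 ha2; assert (hR2 : 0 < R2) by lra.
rewrite A0_eq by assumption.
pose proof PI_RGT_0; pose proof (radial_primitive_pos d R1 R2 hd hR1 hR).
apply Rmult_lt_0_compat; [positivity|].
repeat apply Rplus_lt_0_compat.
- positivity.
- positivity.
- positivity.
Qed.

Lemma Delta_expansion_3 (d : nat) (R1 R2 a1 a2 : R) :
  (3 <= d)%nat -> 0 < R1 -> R1 < R2 -> 0 < a1 -> 0 < a2 ->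
  exists A2, bigO (at_right 0)
    (fun k => Delta_l d 0 R1 R2 a1 a2 k - (A0 d R1 R2 a1 a2 + A2 * k ^ 2))
    (fun k => k ^ 4).
Proof.
intros hd hR1 hR ha1 ha2; rewrite A0_eq by (assumption || lra).
apply Delta_small_k; try assumption; [lia| |].
- intros r hr; apply is_derive_radial_primitive; assumption.
- unfold radial_primitive, Rdiv; ring.
Qed.

Lemma A0_three (R1 R2 a1 a2 : R) :
  0 < R1 -> 0 < R2 -> A0 3 R1 R2 a1 a2 = 2 * Cm1 R1 R2 a1 a2 / PI.
Proof.
intros hR1 hR2; rewrite A0_eq by (assumption || lia).
assert (hp : forall r, 0 < r -> Rpower r (- 2 * nu 3) = / r).
{ intros r hr; rewrite <- (Rpower_1 r) at 2 by exact hr.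
  rewrite <- Rpower_Ropp; f_equal; unfold nu; simpl; field. }
unfold radial_primitive; rewrite !hp by assumption.
pose proof PI_RGT_0; unfold Cm1, nu; simpl (3 - 1)%nat; simpl (INR 3).
field; lra.
Qed.

Lemma Delta_limit_2 (R1 R2 a1 a2 : R) :
  0 < R1 -> R1 < R2 -> 0 < a1 -> 0 < a2 ->
  bigO (at_right 0) (Delta_l 2 0 R1 R2 a1 a2) (fun _ => 1) /\
  filterlim (Delta_l 2 0 R1 R2 a1 a2) (at_right 0)
    (locally (2 / PI * (a1 / R2 + a2 / R1 + a1 * a2 * ln (R2 / R1)))).
Proof.
intros hR1 hR ha1 ha2.
destruct (Delta_small_k 2 R1 R2 a1 a2 (fun r => ln r - ln R1)) as [A2 hA2];
  try assumption; [lia| |ring|].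
- intros r hr; auto_derive; [exact hr|simpl; field; lra].
- apply bigO_limit, (bigO_of_correction _ _ A2).
  rewrite ln_div by lra; simpl (2 - 1)%nat in hA2; rewrite !pow_1 in hA2.
  exact hA2.
Qed.

Theorem theorem3p5 (d : nat) (R1 R2 : R)
  (hd : (2 <= d)%nat) (hR1 : 0 < R1) (hR12 : R1 < R2) :
  ((d = 3%nat ->
      (exists C1 : R -> R -> R,
         (forall a1 a2 : R, 0 < a1 -> 0 < a2 ->
            bigO (at_right 0)
              (fun k => Delta_sph 0 R1 R2 a1 a2 k
                        - (Cm1 R1 R2 a1 a2 / k + C1 a1 a2 * k))
              (fun k => k ^ 3)) /\
         bigO at_right00
           (fun a => C1 (fst a) (snd a) - C1_0 R1 R2)
           (fun a => fst a + snd a)) /\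
      (forall a1 a2 : R, 0 < a1 -> 0 < a2 -> 0 < Cm1 R1 R2 a1 a2) /\
      C1_0 R1 R2 < 0 /\
      (forall a1 a2 : R, 0 < a1 -> 0 < a2 ->
         bigO (at_right 0) (Delta_l d 0 R1 R2 a1 a2) (fun _ => 1) /\
         bigO (at_right 0)
           (fun k => Delta_l d 0 R1 R2 a1 a2 k - 2 * Cm1 R1 R2 a1 a2 / PI)
           (fun k => k ^ 2))) /\
   (forall (a1 a2 : R) (l : nat), 0 < a1 -> 0 < a2 -> (1 <= l)%nat ->
      at_right 0 (fun k => 0 < Delta_l d l R1 R2 a1 a2 k)) /\
   ((3 <= d)%nat ->
      forall a1 a2 : R, 0 < a1 -> 0 < a2 ->
        0 < A0 d R1 R2 a1 a2 /\
        (exists A2 : R,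
           bigO (at_right 0)
             (fun k => Delta_l d 0 R1 R2 a1 a2 k
                       - (A0 d R1 R2 a1 a2 + A2 * k ^ 2))
             (fun k => k ^ 4))) /\
   (d = 2%nat ->
      forall a1 a2 : R, 0 < a1 -> 0 < a2 ->
        bigO (at_right 0) (Delta_l d 0 R1 R2 a1 a2) (fun _ => 1) /\
        filterlim (Delta_l d 0 R1 R2 a1 a2) (at_right 0)
          (locally (2 / PI * (a1 / R2 + a2 / R1 + a1 * a2 * ln (R2 / R1)))) /\
        0 < 2 / PI * (a1 / R2 + a2 / R1 + a1 * a2 * ln (R2 / R1))))
  /\
  (forall a1 a2 : R, 0 < a1 -> 0 < a2 ->
     (forall l : nat,
        is_first_positive_root (Delta_l d l R1 R2 a1 a2) (kcl d R1 R2 a1 a2 l) /\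
        (forall k, 0 < k < kcl d R1 R2 a1 a2 l ->
           0 < Delta_l d l R1 R2 a1 a2 k)) /\
     (forall l m : nat, (l < m)%nat ->
        kcl d R1 R2 a1 a2 l < kcl d R1 R2 a1 a2 m) /\
     (forall l : nat, kc d R1 R2 a1 a2 <= kcl d R1 R2 a1 a2 l) /\
     kc d R1 R2 a1 a2 = kcl d R1 R2 a1 a2 0 /\
     0 < kc d R1 R2 a1 a2 /\
     (forall (l : nat) (k : R), 0 < k < kc d R1 R2 a1 a2 ->
        Delta_l d l R1 R2 a1 a2 k <> 0))
  /\
  (((3 <= d)%nat ->
      bigO at_right00
        (fun a => kc d R1 R2 (fst a) (snd a) ^ 2
                  / kc2_lead d R1 R2 (fst a) (snd a) - 1)
        (fun a => fst a * R1 + snd a * R2)) /\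
   (d = 2%nat ->
      bigO at_right00
        (fun a => kc d R1 R2 (fst a) (snd a) ^ 2
                  / kc2_lead d R1 R2 (fst a) (snd a) - 1)
        (fun a => (fst a + snd a) * Rabs (ln (fst a + snd a)))) /\
   (forall a1 a2 : R, 0 < a1 -> 0 < a2 ->
      kc d R1 R2 a1 a2 ^ 2 <= kc2_lead d R1 R2 a1 a2) /\
   (d = 3%nat ->
      bigO at_right00
        (fun a => kc d R1 R2 (fst a) (snd a) ^ 2
                  - kc2_quad R1 R2 (fst a) (snd a))
        (fun a => (fst a + snd a) ^ 3) /\
      nu1 R1 R2 < 0 /\ nu2 R1 R2 < 0 /\ 0 < nu12 R1 R2 /\
      (forall a1 a2 : R, 0 < a1 -> 0 < a2 ->
         filterlim (fun r1 => kc2_quad r1 R2 a1 a2) (at_right 0)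
           (locally (3 * a2 / R2 * (1 - a2 * R2 / 5)))) /\
      bigO (at_right 0)
        (fun a2 => kc_ball R2 a2 ^ 2 / (3 * a2 / R2) - (1 - a2 * R2 / 5))
        (fun a2 => a2 ^ 2) /\
      (exists c : R,
         Rabs (c - (- (4111 / 10000))) <= 5 / 100000 /\
         bigO (at_right 0)
           (fun eta => kc d 1 2 eta eta ^ 2 - (15 / 7 * eta + c * eta ^ 2))
           (fun eta => eta ^ 3)))).
Proof.
assert (hR2 : 0 < R2) by lra.
split; [|split].
- split; [|split; [|split]].
  + intros ->; split; [|split; [|split]].
    * exists (fun a1 a2 => td1 R1 R2 a1 a2 / (R1 ^ 2 * R2)); split.
      -- intros; apply Delta_sph_expansion; assumption.
      -- apply C1_limit; assumption.
    * intros; apply Cm1_pos; assumption.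
    * apply C1_0_neg; assumption.
    * intros a1 a2 ha1 ha2.
      destruct (Delta_expansion_3 3 R1 R2 a1 a2) as [A2 hA2]; auto with arith.
      rewrite A0_three in hA2 by assumption.
      apply bigO_of_correction in hA2; split; [|exact hA2].
      eapply bigO_limit; exact hA2.
  (* Positivity for small [k] is read off from the transparent interval, without asymptotics of [J]
     and [Y]. *)
  + intros a1 a2 l ha1 ha2 _.
    destruct (kcl_spec d l R1 R2 a1 a2 hd hR1 hR12 ha1 ha2) as [hk [_ [_ hb]]].
    apply (at_right_intro _ _ hk); intros k h; apply hb, h.
  + intros hd3 a1 a2 ha1 ha2; split.
    * apply A0_pos; assumption.
    * apply Delta_expansion_3; assumption.
  + intros -> a1 a2 ha1 ha2.
    destruct (Delta_limit_2 R1 R2 a1 a2 hR1 hR12 ha1 ha2) as [h1 h2].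
    split; [exact h1|split; [exact h2|]].
    assert (0 < ln (R2 / R1)).
    { rewrite ln_div by assumption; pose proof (ln_increasing R1 R2 hR1 hR12); lra. }
    pose proof PI_RGT_0.
    assert (0 < a1 * a2) by positivity.
    apply Rmult_lt_0_compat; [positivity|].
    repeat apply Rplus_lt_0_compat; try (apply Rdiv_lt_0_compat; assumption).
    positivity.
- intros a1 a2 ha1 ha2.
  assert (hspec : forall l, 0 < kcl d R1 R2 a1 a2 l /\
    Delta_l d l R1 R2 a1 a2 (kcl d R1 R2 a1 a2 l) = 0 /\
    forall k, 0 < k < kcl d R1 R2 a1 a2 l -> 0 < Delta_l d l R1 R2 a1 a2 k).
  { intros l; destruct (kcl_spec d l R1 R2 a1 a2 hd hR1 hR12 ha1 ha2)
      as [h1 [h2 [_ h4]]].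
    split; [exact h1|split; [exact h2|intros k hk; apply h4, hk]]. }
  assert (hkc := kc_eq_kcl_zero d R1 R2 a1 a2 hd hR1 hR12 ha1 ha2).
  assert (hle := fun l => kcl_zero_le d l R1 R2 a1 a2 hd hR1 hR12 ha1 ha2).
  rewrite hkc; split; [|split; [|split; [|split; [|split]]]].
  + intros l; destruct (hspec l) as [h1 [h2 h3]]; split; [|exact h3].
    split; [exact h1|split; [exact h2|]].
    intros x hx; apply Rgt_not_eq, h3, hx.
  + intros l m hlm; apply kcl_increasing; assumption.
  + exact hle.
  + reflexivity.
  + apply hspec.
  + intros l k hk; apply Rgt_not_eq, hspec; specialize (hle l); lra.
- split; [|split; [|split]].
  + intros hd3; exists ((R2 - R1) / R1 ^ (d - 1) * R2 ^ (d - 2)).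
    apply (at_right00_intro _ 1); [lra|]; intros a1 a2 ha1 ha2; simpl fst; simpl snd.
    rewrite (Rabs_right (a1 * R1 + a2 * R2)).
    * apply kc2_lead_bounds; (assumption || lra).
    * apply Rle_ge, Rplus_le_le_0_compat; positivity.
  (* The remainder is in fact linear in the impedances. Since [a1 + a2 < exp (- 1)] gives
     [Rabs (ln (a1 + a2)) >= 1], the logarithmic bound follows. *)
  + intros ->; exists ((R2 - R1) / R1 ^ (2 - 1) * R2 ^ (2 - 2) * R2).
    apply (at_right00_intro _ (exp (- 1) / 2));
      [pose proof (exp_pos (- 1)); lra|].
    intros a1 a2 ha1 ha2; simpl fst; simpl snd.
    assert (hc : 0 <= (R2 - R1) / R1 ^ (2 - 1) * R2 ^ (2 - 2)).
    { simpl; rewrite !Rmult_1_r; apply Rmult_le_pos; [lra|].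
      positivity. }
    assert (hln : 1 <= Rabs (ln (a1 + a2))).
    { assert (ln (a1 + a2) <= - 1)
        by (rewrite <- (ln_exp (- 1)); apply ln_le; lra).
      rewrite Rabs_left by lra; lra. }
    rewrite Rabs_mult, Rabs_Rabsolu, (Rabs_right (a1 + a2)) by lra.
    apply Rle_trans with ((R2 - R1) / R1 ^ (2 - 1) * R2 ^ (2 - 2)
                          * (a1 * R1 + a2 * R2)).
    * apply kc2_lead_bounds; (assumption || lra).
    * rewrite (Rmult_assoc _ R2); apply Rmult_le_compat_l; [exact hc|].
      apply Rle_trans with (R2 * ((a1 + a2) * 1)); [nra|].
      apply Rmult_le_compat_l; [lra|apply Rmult_le_compat_l; lra].
  + intros a1 a2 ha1 ha2; apply kc2_lead_bounds; assumption.
  + intros ->.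
    destruct (nu_signs R1 R2 hR1 hR12) as [n1 [n2 n3]].
    split; [|split; [exact n1|split; [exact n2|split; [exact n3|]]]].
    * destruct (vanishes_kc2_quad R1 R2 hR1 hR12) as [M [e [hM [he h]]]].
      exists M; apply (at_right00_intro _ e he); intros a1 a2 ha1 ha2.
      simpl fst; simpl snd.
      rewrite (Rabs_right ((a1 + a2) ^ 3)) by positivity.
      apply h; assumption.
    * split; [|split].
      -- intros a1 a2 _ _; apply kc2_quad_ball_limit, hR2.
      -- apply kc_ball_expansion, hR2.
      (* The exact value of [nu1 + nu2 + nu12] at [R1 = 1], [R2 = 2], where [S3 = 7]. *)
      -- exists (- (141 / 343)); split.
         ++ apply Rabs_le; lra.
         ++ destruct (vanishes_kc2_quad 1 2) as [M [e [hM [he h]]]]; try lra.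
            exists (8 * M); apply (at_right_intro _ e he); intros eta heta.
            rewrite (Rabs_right (eta ^ 3)) by positivity.
            replace (15 / 7 * eta + - (141 / 343) * eta ^ 2)
              with (kc2_quad 1 2 eta eta)
              by (unfold kc2_quad, mu1, mu2, nu1, nu2, nu12, S3; field).
            replace (8 * M * eta ^ 3) with (M * (eta + eta) ^ 3) by ring.
            apply h; assumption.
Qed.
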